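(* Let $M$ be the asymptotically rigid mapping class group of $\mathbb{D}$, $Pt$ the universal Ptolemy groupoid and $Pt_{\rm dot}$ the dotted universal Ptolemy groupoid. For any marked tessellation $\tau^\circ_{\rm mark}$ and any dotted tessellation $\tau^\circ_{\rm dot}$, there is a unique functor $\mathcal{F}:Pt\to Pt_{\rm dot}$ which is equivariant under the $M$-actions on the objects and sends $\tau^\circ_{\rm mark}$ to $\tau^\circ_{\rm dot}$. This functor is injective on the set of objects.
   Context: Let $\mathbb{D}\subset\mathbb{C}$ be the open unit disc, $S^1=\partial\mathbb{D}$, and $\mu(x)=\frac{x-i}{x+i}$ the Cayley transform, identifying $\mathbb{RP}^1=\mathbb{R}\cup\{\infty\}$ with $S^1$; rational points of $S^1$ are the $\mu(r)$, $r\in\mathbb{Q}\cup\{\infty\}$. Homotopies of $\mathbb{D}$ are required to extend continuously to the closed disc and to fix every point of $S^1$ at all times. An ideal arc is a homotopy class of unoriented paths in $\mathbb{D}$ joining two distinct points of $S^1$; an ideal triangle is the region bounded by the three ideal arcs (its sides) joining three distinct points of $S^1$. Rationals are written in reduced form $p/q$ ($q>0$, coprime), $0=0/1$, $\infty=1/0$ or $-1/0$. The Farey tessellation $\tau^*$ consists of the ideal arcs joining $\mu(a/b)$ and $\mu(c/d)$ for all $a/b,c/d$ with $|ad-bc|=1$. A *tessellation* here means a countable locally finite collection $\tau$ of ideal arcs (edges) whose complement is a disjoint union of ideal triangles, whose vertices are all rational points of $S^1$, and all but finitely many of whose edges are edges of $\tau^*$. A *marked tessellation* $(\tau,\vec a)$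 is a tessellation $\tau$ with a distinguished oriented edge (d.o.e.) $\vec a$. Each triangle of $\tau^*$ has vertices $\mu(\frac ab),\mu(\frac{a+c}{b+d}),\mu(\frac cd)$ (reduced expressions, with $\infty=1/0$ or $-1/0$ according to whether the other vertices are $\ge0$ or $\le0$); its middle vertex is $\mu(\frac{a+c}{b+d})$. A *dotted tessellation* $(\tau,D,L)$ is a tessellation $\tau$ with a choice $D$ of a distinguished corner (dot) in each ideal triangle, which for all but finitely many triangles is the middle vertex of a triangle of $\tau^*$, and a bijection $L$ from the set of ideal triangles of $\tau$ to $\mathbb{Q}^\times=\mathbb{Q}\setminus\{0\}$ (labels). $Pt$ (resp. $Pt_{\rm dot}$) is the category whose objects are the marked (resp. dotted) tessellations, with exactly one morphism $[x,y]$ from any object $x$ to any object $y$, composed by $[y,z]\circ[x,y]=[x,z]$. $M$ is the group of homotopy classes $[\varphi]$ of asymptotically rigid homeomorphisms $\varphi:\mathbb{D}\to\mathbb{D}$, i.e. those which extend continuously to $S^1$ and for which $\mu^{-1}\circ\varphi|_{S^1}\circ\mu$ is piecewise-${\rm PSL}(2,\mathbb{Z})$ with finitely many pieces whose endpoints are rational; $[\varphi]\circ[\psi]=[\varphi\circ\psi]$. $M$ acts on marked and dotted tessellations by transporting the edges, d.o.e., dots and triangle labels by $\varphi$. *)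

(* Defs.v *)
From mathcomp Require Import all_boot all_order all_algebra.
From mathcomp Require Import all_classical all_reals all_analysis.
From mathcomp Require Import complex.

Set Implicit Arguments.
Unset Strict Implicit.
Unset Printing Implicit Defensive.

Import Order.TTheory GRing.Theory Num.Theory.
Import numFieldNormedType.Exports.

Local Open Scope ring_scope.
Local Open Scope classical_set_scope.
Local Open Scope complex_scope.

(* Packing R[i] as a numFieldType gives it the topology of its modulus. *)
Definition plane (R : realType) : numFieldType := R[i].

Section Disc.
Context {R : realType}.
Local Notation C := (plane R).

Definition disc : set C := [set z | `|z| < 1].
Definition circle : set C := [set z | `|z| = 1].
Definition cdisc : set C := [set z | `|z| <= 1].

(* [option R] is the projective line, with [None] the point at infinity. *)
Definition cayley (x : option R) : C :=
  if x is Some t then (t -i* 1) / (t +i* 1) else 1.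

Definition rat_pt (x : option rat) : C := cayley (omap ratr x).

(* Paths and homotopies are total functions constrained only on [0, 1],
   resp. on [0, 1] x [0, 1]. *)
Definition ideal_path (g : R -> C) : Prop :=
  [/\ {within `[0, 1], continuous g}, circle (g 0), circle (g 1), g 0 <> g 1
    & forall t, 0 < t < 1 -> disc (g t)].

Definition path_homotopic (g h : R -> C) : Prop :=
  exists H : R * R -> C,
    [/\ {within `[0, 1] `*` `[0, 1], continuous H},
        forall t, 0 <= t <= 1 -> H (0, t) = g t,
        forall t, 0 <= t <= 1 -> H (1, t) = h t,
        forall s, 0 <= s <= 1 -> H (s, 0) = g 0 /\ H (s, 1) = g 1
      & forall s t, 0 <= s <= 1 -> 0 < t < 1 -> disc (H (s, t))].

Definition path_class (g : R -> C) : set (R -> C) :=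
  [set h | ideal_path h /\ path_homotopic g h].

Definition path_rev (g : R -> C) : R -> C := fun t => g (1 - t).

Definition arc_class (g : R -> C) : set (R -> C) :=
  path_class g `|` path_class (path_rev g).

Definition ideal_arc (A : set (R -> C)) : Prop :=
  exists2 g, ideal_path g & A = arc_class g.

Definition joins (A : set (R -> C)) (p q : C) : Prop :=
  exists g, [/\ A g, g 0 = p & g 1 = q].

(* The straight representative of an ideal arc, i.e. its geodesic in the Klein
   model of the hyperbolic plane. It is used to speak of the subset of the disc
   covered by a collection of homotopy classes. *)
Definition chord (A : set (R -> C)) : set C :=
  [set z | exists p q t, [/\ joins A p q, 0 < t < 1
                           & z = (1 - t)%:C * p + t%:C * q]].

(* An ideal triangle is encoded by the set of its three sides. *)
Definition triangle_on (T : set (set (R -> C))) (p q r : C) : Prop :=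
  [/\ circle p /\ circle q /\ circle r, p <> q, q <> r, r <> p
    & exists A B E, [/\ ideal_arc A /\ joins A p q, ideal_arc B /\ joins B q r,
                        ideal_arc E /\ joins E r p & T = A |` [set B; E]]].

Definition ideal_triangle (T : set (set (R -> C))) : Prop :=
  exists p q r, triangle_on T p q r.

Definition corner (T : set (set (R -> C))) (v : C) : Prop :=
  exists q r, triangle_on T v q r.

(* The open region bounded by the straight representatives of the sides. *)
Definition region (T : set (set (R -> C))) : set C :=
  [set z | exists p q r a b c,
     [/\ triangle_on T p q r, 0 < a, 0 < b, 0 < c & a + b + c = 1]
     /\ z = a%:C * p + b%:C * q + c%:C * r].

Definition edge_support (tau : set (set (R -> C))) : set C :=
  \bigcup_(A in tau) chord A.

Definition triangles (tau : set (set (R -> C))) : set (set (set (R -> C))) :=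
  [set T | [/\ ideal_triangle T, T `<=` tau
             & region T `&` edge_support tau = set0]].

(* Reduced expression of a point of the rational projective line; the sign [s]
   selects s/0 for infinity and plays no role elsewhere. *)
Definition reduced_expr (s : int) (x : option rat) : int * int :=
  if x is Some r then (numq r, denq r) else (s, 0).

Definition farey : set (set (R -> C)) :=
  [set A | ideal_arc A /\ exists x y : option rat,
     [/\ joins A (rat_pt x) (rat_pt y)
       & let: (a, b) := reduced_expr 1 x in let: (c, d) := reduced_expr 1 y in
         `|a * d - b * c| = 1]].

(* [s] is 1 if the finite vertices are >= 0 and -1 if they are <= 0; the second
   vertex z has expression (a + c)/(b + d). *)
Definition middle_vertex (T : set (set (R -> C))) (v : C) : Prop :=
  exists (s : int) (x y z : option rat),
    [/\ s = 1 \/ s = -1,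
        forall r : rat, Some r \in [:: x; y; z] -> 0 <= s%:~R * r,
        reduced_expr s z = reduced_expr s x + reduced_expr s y,
        triangle_on T (rat_pt x) (rat_pt z) (rat_pt y)
      & v = rat_pt z].

Definition locally_finite (tau : set (set (R -> C))) : Prop :=
  forall z, disc z ->
    exists2 U, nbhs z U & finite_set [set A | tau A /\ chord A `&` U !=set0].

Definition tessellation (tau : set (set (R -> C))) : Prop :=
  [/\ [/\ tau `<=` ideal_arc, countable tau & locally_finite tau],
      disc `\` edge_support tau = \bigcup_(T in triangles tau) region T,
      trivIset (triangles tau) region,
      [set p | exists A q, tau A /\ joins A p q] = range rat_pt
    & finite_set (tau `\` farey)].

(* An oriented edge is the homotopy class of an oriented path. *)
Definition oriented_edge (tau : set (set (R -> C))) (e : set (R -> C)) : Prop :=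
  exists g, [/\ ideal_path g, e = path_class g & tau (arc_class g)].

(* [dot] and [label] are the graphs of functions on [triangles tau]. *)
Definition dotting (tau : set (set (R -> C)))
    (dot : set (set (set (R -> C)) * C)) : Prop :=
  exists d : set (set (R -> C)) -> C,
    [/\ dot = [set (T, d T) | T in triangles tau],
        forall T, triangles tau T -> corner T (d T)
      & finite_set [set T | triangles tau T /\
                            ~ (triangles farey T /\ middle_vertex T (d T))]].

Definition labelling (tau : set (set (R -> C)))
    (label : set (set (set (R -> C)) * rat)) : Prop :=
  exists2 l : set (set (R -> C)) -> rat,
    label = [set (T, l T) | T in triangles tau]
    & set_bij (triangles tau) [set q | q != 0] l.

Definition mobius (A : 'M[int]_2) (x : R) : option R :=
  let den := (A 1 0)%:~R * x + (A 1 1)%:~R in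
  if den == 0 then None else Some (((A 0 0)%:~R * x + (A 0 1)%:~R) / den).

(* [B] lists the finite breakpoints, and the number of breakpoints smaller than
   x tells in which piece x lies. Infinity is always an endpoint of pieces; the
   value there is determined by continuity. *)
Definition piecewise_PSL2Z (f : C -> C) : Prop :=
  exists (B : seq rat) (A : nat -> 'M[int]_2),
    (forall k, \det (A k) = 1) /\
    forall x : R, f (cayley (Some x))
                  = cayley (mobius (A (count (fun b => ratr b < x) B)) x).

(* A homeomorphism of the open disc with a continuous extension to the closed
   disc is given by that extension; values off the closed disc are junk. *)
Definition asymp_rigid (f : C -> C) : Prop :=
  [/\ set_bij disc disc f,
      exists2 g : C -> C, {within disc, continuous g}
                        & forall z, disc z -> g (f z) = z,
      {within cdisc, continuous f}
    & piecewise_PSL2Z f].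

Definition disc_homotopic (f g : C -> C) : Prop :=
  exists H : R * C -> C,
    [/\ {within `[0, 1] `*` cdisc, continuous H},
        forall z, cdisc z -> H (0, z) = f z,
        forall z, cdisc z -> H (1, z) = g z,
        forall s z, 0 <= s <= 1 -> circle z -> H (s, z) = f z
      & forall s z, 0 <= s <= 1 -> disc z -> disc (H (s, z))].

Definition map_class (f : C -> C) : set (C -> C) :=
  [set g | asymp_rigid g /\ disc_homotopic f g].

End Disc.

Record marked_tessellation (R : realType) := MarkedTessellation {
  mt_edges : set (set (R -> plane R));
  mt_doe : set (R -> plane R);
  mt_edgesP : tessellation mt_edges;
  mt_doeP : oriented_edge mt_edges mt_doe }.

Record dotted_tessellation (R : realType) := DottedTessellation {
  dt_edges : set (set (R -> plane R));
  dt_dot : set (set (set (R -> plane R)) * plane R);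
  dt_label : set (set (set (R -> plane R)) * rat);
  dt_edgesP : tessellation dt_edges;
  dt_dotP : dotting dt_edges dt_dot;
  dt_labelP : labelling dt_edges dt_label }.

Record mcg (R : realType) := Mcg {
  mcg_class :> set (plane R -> plane R);
  mcgP : exists2 f, asymp_rigid f & mcg_class = map_class f }.

Section Action.
Context {R : realType}.
Local Notation C := (plane R).

(* Transport of a homotopy class of paths, oriented or not. *)
Definition act_arc (m : mcg R) (A : set (R -> C)) : set (R -> C) :=
  \bigcup_(f in mcg_class m) \bigcup_(g in A) path_class (f \o g).

Definition act_triangle (m : mcg R) (T : set (set (R -> C))) :
  set (set (R -> C)) := act_arc m @` T.

(* [y = m x] in the action of the mapping class group. *)
Definition marked_act (m : mcg R) (x y : marked_tessellation R) : Prop :=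
  mt_edges y = act_arc m @` mt_edges x /\ mt_doe y = act_arc m (mt_doe x).

Definition dotted_act (m : mcg R) (x y : dotted_tessellation R) : Prop :=
  [/\ dt_edges y = act_arc m @` dt_edges x,
      dt_dot y = [set Tv | exists T v f, [/\ dt_dot x (T, v), mcg_class m f
                                           & Tv = (act_triangle m T, f v)]]
    & dt_label y = [set (act_triangle m Tq.1, Tq.2) | Tq in dt_label x]].

End Action.

Record category := Category {
  obj : Type;
  hom : obj -> obj -> Type;
  idm : forall x, hom x x;
  comp : forall x y z, hom y z -> hom x y -> hom x z;
  comp1m : forall x y (f : hom x y), comp (idm y) f = f;
  compm1 : forall x y (f : hom x y), comp f (idm x) = f;
  compA : forall x y z t (h : hom z t) (g : hom y z) (f : hom x y),
    comp h (comp g f) = comp (comp h g) f }.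

Record functor (A B : category) := Functor {
  fobj :> obj A -> obj B;
  fmap : forall x y, hom x y -> hom (fobj x) (fobj y);
  fmap1 : forall x, fmap (idm x) = idm (fobj x);
  fmapM : forall x y z (g : hom y z) (f : hom x y),
    fmap (comp g f) = comp (fmap g) (fmap f) }.

Definition one_morphism_category (T : Type) : category.
Proof.
by refine (@Category T (fun _ _ => unit) (fun=> tt) (fun _ _ _ _ _ => tt) _ _ _)
  => [x y []|x y []|].
Defined.

Definition Pt (R : realType) : category :=
  one_morphism_category (marked_tessellation R).

Definition Ptdot (R : realType) : category :=
  one_morphism_category (dotted_tessellation R).

(* For all m and x: m x is an object and F (m x) = m (F x). *)
Definition equivariant (R : realType) (F : functor (Pt R) (Ptdot R)) : Prop :=
  forall (m : mcg R) (x : marked_tessellation R),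
    exists2 y, marked_act m x y & dotted_act m (F x) (F y).

(* Main.v *)
Require Import Defs.
From mathcomp Require Import all_boot all_order all_algebra.
From mathcomp Require Import all_classical all_reals all_analysis.
From mathcomp Require Import complex.
From mathcomp Require Import ring lra zify.

(* Straight-line homotopies show that an ideal arc is determined by its two
   endpoints and a mapping class by its values on the circle, so everything
   reduces to the cyclic order of the projective line [option R], with
   [None] for infinity. In these terms the mapping classes are exactly the
   orientation preserving, piecewise PSL(2, Z) bijections.

   The group acts simply transitively on marked tessellations. Starting from the
   distinguished oriented edges of two of them, match the adjacent triangles on
   each side step by step; this determines the boundary map on all vertices.
   After finitely many steps the remaining edges cut off arcs on which both
   tessellations coincide with the Farey one, so that the map can be taken in
   PSL(2, Z) there, and these finitely many pieces are glued. The action is free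
   on dotted tessellations, since the labels determine the image of each
   triangle and the dots determine the images of its corners. Hence the functor
   must be m tau_mark |-> m tau_dot on objects, and this is injective. *)

Set Implicit Arguments.
Unset Strict Implicit.
Unset Printing Implicit Defensive.

Import Order.TTheory GRing.Theory Num.Theory.
Import numFieldNormedType.Exports.

Local Open Scope ring_scope.
Local Open Scope classical_set_scope.
Local Open Scope complex_scope.

(** * Cyclic order on the circle *)

Section CyclicOrder.
Context {R : realType}.
Local Notation P := (option R).

(** Three facts carry the weight. The matching ends after finitely many steps because a Farey edge
    between the integer vectors [u] and [w] is a chord of squared length [4 / (|u|^2 |w|^2)]: only
    finitely many edges meet a smaller concentric disc, and the inductions count these. An
    asymptotically rigid map is only given as a homeomorphism of the open disc with a continuous,
    piecewise projective extension; that it is injective on the circle and keeps the cyclic order is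
    derived from the fact that a chord separates the disc, the determinant 1 of a single piece
    excluding reversal. Finally, the image of a tessellation or of a dotting must again agree with
    the Farey one up to finitely many exceptions: a given rational point lies inside only finitely
    many Farey arcs, so almost all of these arcs contain no breakpoint and no preimage of 0 or
    infinity, and there mediants go to mediants. Tessellations are replaced by the combinatorial
    notion [ctess], which monotone circle maps transport without any geometry. *)

Definition hx (x : P) : R := if x is Some t then t else 1.
Definition hy (x : P) : R := if x is Some _ then 1 else 0.
Definition br (x y : P) : R := hx x * hy y - hy x * hx y.
(** [br] is the determinant of homogeneous coordinates. Each point enters the product twice, so its
    sign does not depend on how these are scaled. *)
Definition ccw (x y z : P) : Prop := 0 < br x y * br y z * br z x.
Definition sqn (x : P) : R := hx x ^+ 2 + hy x ^+ 2.

(* An increasing embedding of the line in (-1, 1), with infinity sent to 1: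
   it reduces statements on the cyclic order to linear arithmetic. *)
Definition lp (x : P) : R := if x is Some t then t / (1 + `|t|) else 1.

Lemma sqn_gt0 x : 0 < sqn x.
Proof. by case: x => [t|]; rewrite /sqn /=; [have := sqr_ge0 t|]; lra. Qed.

Lemma lp_lt1 t : lp (Some t) < 1.
Proof.
rewrite /lp ltr_pdivrMr; last by have := normr_ge0 t; lra.
by have := ler_norm t; lra.
Qed.

Lemma lp_mono t u : (lp (Some t) < lp (Some u)) = (t < u).
Proof.
rewrite /lp ltr_pdivrMr; last by have := normr_ge0 t; lra.
rewrite mulrAC ltr_pdivlMr; last by have := normr_ge0 u; lra.
case: (lerP 0 t) => ht; case: (lerP 0 u) => hu;
  rewrite ?(ger0_norm ht) ?(ltr0_norm ht) ?(ger0_norm hu) ?(ltr0_norm hu);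
  apply/idP/idP => h; nra.
Qed.

Lemma br_lt0 x y : (br x y < 0) = (lp x < lp y).
Proof.
case: x y => [t|] [u|]; rewrite /br /hx /hy.
- by rewrite lp_mono mulr1 mul1r subr_lt0.
- by rewrite lp_lt1; apply/idP; lra.
- by apply/idP/idP; have := lp_lt1 u; rewrite [lp None]/=; lra.
- by rewrite ltxx; apply/idP; lra.
Qed.

Lemma brC x y : br y x = - br x y.
Proof. by rewrite /br; ring. Qed.

Lemma br_gt0 x y : (0 < br x y) = (lp y < lp x).
Proof. by rewrite -br_lt0 [br y x]brC oppr_lt0. Qed.

Lemma lp_inj : injective lp.
Proof.
move=> [t|] [u|] //.
- move=> e; congr Some; apply/eqP.
  by rewrite eq_le !leNgt -(lp_mono u) -(lp_mono t) e ltxx.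
- by move=> e; have := lp_lt1 t; rewrite e ltxx.
- by move=> e; have := lp_lt1 u; rewrite -e ltxx.
Qed.

Lemma br_eq0 x y : br x y = 0 <-> x = y.
Proof.
split=> [e|->]; last by rewrite /br; ring.
apply: lp_inj; apply/eqP; rewrite eq_le !leNgt -(br_lt0 x) -(br_lt0 y).
by rewrite (brC x) e oppr0 ltxx.
Qed.

Lemma ccwE x y z : ccw x y z <->
  [\/ lp x < lp y /\ lp y < lp z, lp y < lp z /\ lp z < lp x
    | lp z < lp x /\ lp x < lp y].
Proof.
have sgbr u v : [/\ br u v < 0 & lp u < lp v] \/ [/\ 0 < br u v & lp v < lp u] \/
    u = v.
  case: (ltrgtP (lp u) (lp v)) => [h|h|/lp_inj ->]; last by right; right.
  - by left; rewrite br_lt0.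
  - by right; left; rewrite br_gt0.
have br0 u : br u u = 0 by apply/br_eq0.
rewrite /ccw; case: (sgbr x y) => [[a h1]|[[a h1]|<-]]; last first.
- by rewrite br0 !mul0r ltxx; split=> [//|[[? ?]|[? ?]|[? ?]]]; lra.
- case: (sgbr y z) => [[b h2]|[[b h2]|<-]]; last first.
  + by rewrite br0 mulr0 mul0r ltxx; split=> [//|[[? ?]|[? ?]|[? ?]]]; lra.
  + rewrite pmulr_rgt0 ?mulr_gt0 // br_gt0.
    by split=> [?|[[? ?]|[? ?]|[? ?]]]; lra.
  + rewrite nmulr_rgt0 ?br_lt0; last by rewrite pmulr_rlt0.
    by split=> [?|[[? ?]|[? ?]|[? ?]]]; [apply: Or32|lra..].
- case: (sgbr y z) => [[b h2]|[[b h2]|<-]]; last first.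
  + by rewrite br0 mulr0 mul0r ltxx; split=> [//|[[? ?]|[? ?]|[? ?]]]; lra.
  + rewrite nmulr_rgt0 ?br_lt0; last by rewrite nmulr_rlt0.
    by split=> [?|[[? ?]|[? ?]|[? ?]]]; [apply: Or33|lra..].
  + rewrite pmulr_rgt0 ?br_gt0; last by rewrite nmulr_rgt0.
    by split=> [_|_]; [apply: Or31|lra].
Qed.

Lemma lpP x y : x <> y -> lp x < lp y \/ lp y < lp x.
Proof.
move=> h; case: (ltrgtP (lp x) (lp y)) => hh; [by left|by right|].
by case: h; apply: lp_inj.
Qed.

Lemma nccwE x y z : ~ ccw x y z <->
  x = y \/ y = z \/ z = x \/ [\/ lp y < lp x /\ lp z < lp y, lp z < lp y /\ lp x < lp z
    | lp x < lp z /\ lp y < lp x].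
Proof.
split.
  move=> h.
  case: (pselect (x = y)) => [->|/lpP hxy]; first by left.
  case: (pselect (y = z)) => [->|/lpP hyz]; first by right; left.
  case: (pselect (z = x)) => [->|/lpP hzx]; first by right; right; left.
  do 3!right; rewrite ccwE in h.
  by case: hxy => h1; case: hyz => h2; case: hzx => h3; try lra;
    try (by apply: Or31); try (by apply: Or32); try (by apply: Or33);
    case: h; try (by apply: Or31); try (by apply: Or32); try (by apply: Or33).
move=> h; rewrite ccwE => h'; move: h => [e|[e|[e|h]]]; first 3 last.
  by case: h h' => -[? ?] [[? ?]|[? ?]|[? ?]]; lra.
all: by subst; case: h' => -[? ?]; lra.
Qed.

End CyclicOrder.

Section LtP.
Context {R : realType}.
Implicit Types x y z w : option R.
Definition ltp x y : Prop := lp x < lp y.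
Lemma ltp_irr x : ~ ltp x x. Proof. by rewrite /ltp ltxx. Qed.
Lemma ltp2 x y : ltp x y -> ltp y x -> False.
Proof. by rewrite /ltp => h1 h2; have := lt_trans h1 h2; rewrite ltxx. Qed.
Lemma ltp3 x y z : ltp x y -> ltp y z -> ltp z x -> False.
Proof. by move=> h1 h2; apply: ltp2; apply: lt_trans h1 h2. Qed.
Lemma ltp4 x y z w : ltp x y -> ltp y z -> ltp z w -> ltp w x -> False.
Proof. by move=> h1 h2; apply: ltp3; apply: lt_trans h1 h2. Qed.
Lemma ltp5 x y z w v :
  ltp x y -> ltp y z -> ltp z w -> ltp w v -> ltp v x -> False.
Proof. by move=> h1 h2; apply: ltp4; apply: lt_trans h1 h2. Qed.
Lemma ltp_ccw x y z : ccw x y z ->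
  ltp x y /\ ltp y z \/ ltp y z /\ ltp z x \/ ltp z x /\ ltp x y.
Proof. by case/ccwE; [left|right; left|right; right]. Qed.
Lemma ltp_nccw x y z : ~ ccw x y z -> x = y \/ y = z \/ z = x \/
  ltp y x /\ ltp z y \/ ltp z y /\ ltp x z \/ ltp x z /\ ltp y x.
Proof.
case/nccwE => [|[|[|h]]]; [by left|by right; left|by right; right; left|].
by do 3 right; case: h; [left|right; left|right; right].
Qed.
Lemma ltp_neq x y : x <> y -> ltp x y \/ ltp y x. Proof. exact: lpP. Qed.
End LtP.

(* The closed arc from [x] counterclockwise to [y]. *)
Definition cl {R : realType} (x y z : option R) := z = x \/ z = y \/ ccw x z y.

(** Not symmetric in [a] and [b]: excluding that two edges cross takes both orientations of one of
    them. *)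
Definition cross {R : realType} (x y a b : option R) := ccw x a y /\ ccw y b x.

Ltac cyc_close :=
  match goal with
  | H : ltp ?x ?x |- _ => exact (False_ind _ (ltp_irr H))
  | H1 : ltp ?x ?y, H2 : ltp ?y ?x |- _ => exact (False_ind _ (ltp2 H1 H2))
  | H1 : ltp ?x ?y, H2 : ltp ?y ?z, H3 : ltp ?z ?x |- _ =>
    exact (False_ind _ (ltp3 H1 H2 H3))
  | H1 : ltp ?x ?y, H2 : ltp ?y ?z, H3 : ltp ?z ?w, H4 : ltp ?w ?x |- _ =>
    exact (False_ind _ (ltp4 H1 H2 H3 H4))
  | H1 : ltp ?x ?y, H2 : ltp ?y ?z, H3 : ltp ?z ?w, H4 : ltp ?w ?v,
    H5 : ltp ?v ?x |- _ => exact (False_ind _ (ltp5 H1 H2 H3 H4 H5))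
  | H : ?x <> ?x |- _ => exact (False_ind _ (H erefl))
  end.

Ltac cyc_split :=
  lazymatch goal with
  | H : ?x = ?x :> option _ |- _ => clear H
  | H : ~ (_ \/ _) |- _ => apply not_orP in H; destruct H as [H ?]
  | H : ~ (_ /\ _) |- _ => apply not_andP in H
  | H : _ /\ _ |- _ => let a := fresh "a" in let b := fresh "b" in destruct H as [a b]
  | H : ?x = ?y :> option _ |- _ => first [subst x | subst y | rewrite -> H in *; clear H | clear H]
  | H : ltp _ _ \/ ltp _ _ |- _ => destruct H as [H|H]
  | H : _ /\ _ \/ _ /\ _ |- _ => destruct H as [H|H]
  | H : _ /\ _ \/ _ /\ _ \/ _ /\ _ |- _ => destruct H as [H|[H|H]]
  | H : _ = _ :> option _ \/ _ |- _ => destruct H as [H|H]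
  | H : _ \/ _ |- _ => destruct H as [H|H]
  | H : ccw _ _ _ |- _ => apply ltp_ccw in H
  | H : ~ ccw _ _ _ |- _ => apply ltp_nccw in H
  | H : ?x <> ?y :> option _ |- _ => apply ltp_neq in H
  | H : ~ (?x = ?y :> option _) |- _ => apply ltp_neq in H
  end.

Ltac cyc_loop := first [cyc_close | cyc_split; cyc_loop].

(** The goal is negated, every fact on the cyclic order is expanded into the possible linear orders
    of the points, and each branch closes on a cycle of at most five strict inequalities or on some
    [x <> x]. *)
Ltac cyc :=
  intros; unfold cl, cross in *;
  repeat match goal with
  | |- ~ _ => intro
  | |- False => fail 1
  | |- _ => apply: contrapT; intro
  end; cyc_loop.

Section CyclicOrder2.
Context {R : realType}.
Implicit Types x y z : option R.

Lemma ccw_rot x y z : ccw x y z -> ccw y z x. Proof. cyc. Qed.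
Lemma ccw_total x y z : x <> y -> y <> z -> z <> x -> ccw x y z \/ ccw x z y.
Proof. by move=> *; case: (pselect (ccw x y z)); [left|right]; cyc. Qed.
Lemma ccw_neq x y z : ccw x y z -> [/\ x <> y, y <> z & z <> x].
Proof. by move=> h; split; cyc. Qed.
End CyclicOrder2.

(** * Plane geometry *)

Section Plane.
Context {R : realType}.
Local Notation C := (plane R).
Local Notation P := (option R).
Implicit Types z w : C.

Definition re z : R := complex.Re z.
Definition im z : R := complex.Im z.
Definition nsq z : R := re z ^+ 2 + im z ^+ 2.

Lemma plane_eq z w : re z = re w -> im z = im w -> z = w.
Proof. by case: z w => a b [c d] /= -> ->. Qed.
Lemma reD z w : re (z + w) = re z + re w. Proof. by case: z; case: w. Qed.
Lemma imD z w : im (z + w) = im z + im w. Proof. by case: z; case: w. Qed.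
Lemma reN z : re (- z) = - re z. Proof. by case: z. Qed.
Lemma imN z : im (- z) = - im z. Proof. by case: z. Qed.
Lemma reM z w : re (z * w) = re z * re w - im z * im w.
Proof. by case: z; case: w. Qed.
Lemma imM z w : im (z * w) = re z * im w + im z * re w.
Proof. by case: z; case: w => * /=; rewrite addrC. Qed.
Lemma re_real (t : R) : re t%:C = t. Proof. by []. Qed.
Lemma im_real (t : R) : im t%:C = 0. Proof. by []. Qed.
Lemma norm_plane z : `|z| = (Num.sqrt (nsq z))%:C :> C.
Proof. by case: z => a b; rewrite /nsq /= normc_def. Qed.

Definition planeE := (reD, imD, reN, imN, reM, imM, re_real, im_real).

Lemma nsq_ge0 z : 0 <= nsq z.
Proof. by rewrite addr_ge0 ?sqr_ge0. Qed.

Lemma discE z : disc z <-> nsq z < 1.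
Proof.
rewrite /disc /= norm_plane ltcR -{1}sqrtr1 ltr_sqrt ?ltr01 //.
Qed.
Lemma cdiscE z : cdisc z <-> nsq z <= 1.
Proof. by rewrite /cdisc /= norm_plane lecR -{1}sqrtr1 ler_sqrt ?ltr01. Qed.
Lemma circleE z : circle z <-> nsq z = 1.
Proof.
rewrite /circle /= norm_plane; split.
  by case=> e; rewrite -(sqr_sqrtr (nsq_ge0 z)) e expr1n.
by move=> ->; rewrite sqrtr1.
Qed.

Lemma cayleyE (x : P) : cayley x =
  ((hx x ^+ 2 - hy x ^+ 2) / sqn x +i* (- (2 * hx x * hy x) / sqn x)) :> C.
Proof.
have n0 := sqn_gt0 x.
case: x n0 => [t|] n0; last first.
  by apply: plane_eq; rewrite /re /im /sqn /=; field.
rewrite /cayley; apply: (canLR (mulfK _)).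
  by apply/eqP => /(congr1 im) /eqP; rewrite /im /= oner_eq0.
have h : t ^+ 2 + 1 != 0 by have := sqr_ge0 t; lra.
by apply: plane_eq; rewrite ?planeE /re /im /sqn /= ?expr1n; field.
Qed.

Lemma re_cayley (x : P) : re (cayley x) = (hx x ^+ 2 - hy x ^+ 2) / sqn x.
Proof. by rewrite cayleyE. Qed.
Lemma im_cayley (x : P) : im (cayley x) = - (2 * hx x * hy x) / sqn x.
Proof. by rewrite cayleyE. Qed.

Lemma cayley_circle (x : P) : circle (cayley x : C).
Proof.
apply/circleE; rewrite /nsq re_cayley im_cayley /sqn.
have := sqn_gt0 x; rewrite /sqn => n0; field; lra.
Qed.

(** Twice the signed area of the triangle. It is affine in the last point, and on the circle it has
    the sign of the cyclic order. *)
Definition orient z1 z2 z3 : R :=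
  (re z2 - re z1) * (im z3 - im z1) - (im z2 - im z1) * (re z3 - re z1).

Lemma orient_cayley (x y z : P) : orient (cayley x) (cayley y) (cayley z) =
  4 * (br x y * br y z * br z x) / (sqn x * sqn y * sqn z).
Proof.
rewrite /orient !re_cayley !im_cayley /sqn /br.
have := sqn_gt0 x; have := sqn_gt0 y; have := sqn_gt0 z; rewrite /sqn.
by move=> *; field; apply/and3P; split; apply: lt0r_neq0.
Qed.

Lemma orient_gt0 (x y z : P) :
  (0 < orient (cayley x) (cayley y) (cayley z)) <-> ccw x y z.
Proof.
rewrite orient_cayley ltr_pdivlMr ?mul0r; last by rewrite !mulr_gt0 ?sqn_gt0.
by rewrite pmulr_rgt0 // /ccw; lra.
Qed.

Lemma orient_rot z1 z2 z3 : orient z2 z3 z1 = orient z1 z2 z3.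
Proof. by rewrite /orient; ring. Qed.
Lemma orient_swap z1 z2 z3 : orient z2 z1 z3 = - orient z1 z2 z3.
Proof. by rewrite /orient; ring. Qed.

Lemma orient_lt0 (x y z : P) :
  (orient (cayley x) (cayley y) (cayley z) < 0) <-> ccw x z y.
Proof.
have -> : orient (cayley x) (cayley y) (cayley z) =
          - orient (cayley x) (cayley z) (cayley y) by rewrite /orient; ring.
by rewrite oppr_lt0; apply: orient_gt0.
Qed.

Lemma cayley_dist (x y : P) :
  nsq (cayley x - cayley y) = 4 * br x y ^+ 2 / (sqn x * sqn y).
Proof.
rewrite /nsq !planeE !re_cayley !im_cayley /sqn /br.
have := sqn_gt0 x; have := sqn_gt0 y; rewrite /sqn.
by move=> *; field; apply/andP; split; apply: lt0r_neq0.
Qed.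

Lemma nsq_eq0 z : nsq z = 0 -> z = 0.
Proof.
move=> /eqP; rewrite paddr_eq0 ?sqr_ge0 // !sqrf_eq0 => /andP[/eqP a /eqP b].
exact: plane_eq.
Qed.

Lemma cayley_inj : injective (cayley : P -> C).
Proof.
move=> x y e; have := cayley_dist x y; rewrite e subrr.
have -> : nsq (0 : C) = 0 by rewrite /nsq /re /im /= expr0n addr0.
move=> /esym/eqP; rewrite !mulf_eq0 invr_eq0 mulf_eq0 pnatr_eq0 /=.
rewrite (gt_eqF (sqn_gt0 x)) (gt_eqF (sqn_gt0 y)) !orbF ?orbb.
by move=> /eqP/br_eq0.
Qed.

Lemma cayley_surj z : circle z -> exists x : P, cayley x = z.
Proof.
move=> /circleE; rewrite /nsq => n1.
have [e|e] := eqVneq (re z) 1.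
  exists None; apply: plane_eq; rewrite ?re_cayley ?im_cayley /sqn /=.
    by rewrite e; field.
  have : im z ^+ 2 = 0 by rewrite e in n1; lra.
  by move=> /eqP; rewrite sqrf_eq0 => /eqP ->; field.
(* Stereographic projection from [1], the image of infinity. *)
exists (Some (- im z / (1 - re z))).
have h : 1 - re z != 0 by move/eqP: e => e; apply/eqP; lra.
have im2 : im z ^+ 2 = (1 - re z) * (1 + re z) by lra.
have n2 : (- im z / (1 - re z)) ^+ 2 = (1 + re z) / (1 - re z).
  by rewrite expr_div_n sqrrN im2; field.
apply: plane_eq; rewrite ?re_cayley ?im_cayley /sqn /= n2; field; apply/andP;
  split=> //; lra.
Qed.

Definition lin (t : R) z w : C := (1 - t)%:C * z + t%:C * w.

Lemma re_lin t z w : re (lin t z w) = (1 - t) * re z + t * re w.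
Proof. by rewrite /lin !planeE; ring. Qed.
Lemma im_lin t z w : im (lin t z w) = (1 - t) * im z + t * im w.
Proof. by rewrite /lin !planeE; ring. Qed.
Lemma orient_lin z1 z2 t z w :
  orient z1 z2 (lin t z w) = (1 - t) * orient z1 z2 z + t * orient z1 z2 w.
Proof. by rewrite /orient re_lin im_lin; ring. Qed.

Lemma nsq_lin t z w :
  nsq (lin t z w) = (1 - t) * nsq z + t * nsq w - t * (1 - t) * nsq (z - w).
Proof. by rewrite /nsq re_lin im_lin !planeE; ring. Qed.

Lemma nsq_lin_le t z w r : 0 <= t <= 1 -> nsq z <= r -> nsq w <= r ->
  nsq (lin t z w) <= r.
Proof.
move=> /andP[t0 t1] hz hw; rewrite nsq_lin; have := nsq_ge0 (z - w).
move=> n; have s0 : 0 <= 1 - t by lra.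
have := mulr_ge0 (mulr_ge0 t0 s0) n; have : 0 <= r - nsq w by lra.
have : 0 <= r - nsq z by lra.
by move=> /(mulr_ge0 s0) ? /(mulr_ge0 t0) ? ?; lra.
Qed.

Lemma nsq_gt0 z w : z <> w -> 0 < nsq (z - w).
Proof.
move=> h; rewrite lt_def nsq_ge0 andbT; apply/eqP => /nsq_eq0 /eqP.
by rewrite subr_eq0 => /eqP.
Qed.

Lemma disc_lin t z w : 0 < t < 1 -> cdisc z -> cdisc w -> z <> w ->
  disc (lin t z w).
Proof.
move=> /andP[t0 t1] /cdiscE hz /cdiscE hw /nsq_gt0 n.
have s0 : 0 < 1 - t by lra.
have := mulr_gt0 (mulr_gt0 t0 s0) n; have : 0 <= 1 - nsq w by lra.
have : 0 <= 1 - nsq z by lra.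
move=> /(mulr_ge0 (ltW s0)) ? /(mulr_ge0 (ltW t0)) ? ?.
by apply/discE; rewrite nsq_lin; lra.
Qed.

Lemma cdisc_lin t z w : 0 <= t <= 1 -> cdisc z -> cdisc w -> cdisc (lin t z w).
Proof. by move=> ht /cdiscE hz /cdiscE hw; apply/cdiscE; apply: nsq_lin_le. Qed.

Lemma disc_convex t z w : 0 <= t <= 1 -> disc z -> disc w -> disc (lin t z w).
Proof.
move=> ht /discE hz /discE hw; apply/discE.
apply: (@le_lt_trans _ _ (Num.max (nsq z) (nsq w))); last by rewrite gt_max hz.
by apply: nsq_lin_le; rewrite // le_max lexx ?orbT.
Qed.

Lemma circle_cdisc z : circle z -> cdisc z.
Proof. by move=> /circleE e; apply/cdiscE; rewrite e. Qed.
Lemma disc_cdisc z : disc z -> cdisc z.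
Proof. by move=> /discE e; apply/cdiscE; rewrite ltW. Qed.
Lemma cdisc_split z : cdisc z -> disc z \/ circle z.
Proof.
by move=> /cdiscE; rewrite le_eqVlt => /orP[/eqP/circleE|/discE]; [right|left].
Qed.
Lemma disc_ncircle z : disc z -> ~ circle z.
Proof. by move=> /discE h /circleE; lra. Qed.

Lemma orient0_lin p q z : p <> q -> orient p q z = 0 -> exists t, z = lin t p q.
Proof.
move=> /nsq_gt0 n h.
(* Parameter of the orthogonal projection of [z] to the line through [p] and [q]. *)
pose t := ((re q - re p) * (re z - re p) + (im q - im p) * (im z - im p)) /
   nsq (p - q).
have e : nsq (p - q) = (re q - re p) ^+ 2 + (im q - im p) ^+ 2.
  by rewrite /nsq !planeE; ring.
have n0 : (re q - re p) ^+ 2 + (im q - im p) ^+ 2 != 0 by rewrite -e; lra.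
rewrite /orient in h.
exists t; apply: plane_eq; rewrite ?re_lin ?im_lin /t e.
  apply: (mulIf n0); apply/eqP; rewrite -subr_eq0; apply/eqP.
  transitivity (- (im q - im p) * ((re q - re p) * (im z - im p) - (im q - im p) * (re z - re p))).
    by field.
  by rewrite h mulr0.
apply: (mulIf n0); apply/eqP; rewrite -subr_eq0; apply/eqP.
transitivity ((re q - re p) * ((re q - re p) * (im z - im p) - (im q - im p) * (re z - re p))).
  by field.
by rewrite h mulr0.
Qed.

Lemma orient0_chord p q z : circle p -> circle q -> p <> q -> disc z ->
  orient p q z = 0 -> exists2 t, 0 < t < 1 & z = lin t p q.
Proof.
move=> /circleE np /circleE nq pq /discE nz /(orient0_lin pq)[t ez].
exists t => //; have := nsq_gt0 pq; move: nz; rewrite ez nsq_lin np nq => h n.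
have : 0 < t * (1 - t) by nra.
by move=> ?; apply/andP; split; nra.
Qed.

Lemma orient_chord p q t : orient p q (lin t p q) = 0.
Proof. by rewrite orient_lin /orient; ring. Qed.

Definition bary (a b c : R) p q r : C := a%:C * p + b%:C * q + c%:C * r.

Lemma orient_bary a b c p q r : a + b + c = 1 ->
  orient p q (bary a b c p q r) = c * orient p q r.
Proof.
move=> e; have -> : a = 1 - b - c by lra.
by rewrite /orient /bary !planeE; ring.
Qed.

Lemma bary_rot a b c p q r : bary a b c p q r = bary b c a q r p.
Proof. by rewrite /bary -addrA addrC. Qed.

Lemma orient_sum p q r z :
  orient p q z + orient q r z + orient r p z = orient p q r.
Proof. by rewrite /orient; ring. Qed.

(** Cramer's rule: barycentric coordinates are ratios of signed areas. *)
Lemma baryE p q r z : orient p q r != 0 ->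
  z = bary (orient q r z / orient p q r) (orient r p z / orient p q r)
           (orient p q z / orient p q r) p q r.
Proof.
move=> h; apply: plane_eq; rewrite /bary !planeE; apply: (mulIf h).
  have [h1 h2] : orient p q r != 0 /\ orient p q r = orient p q r by [].
  transitivity (orient q r z * re p + orient r p z * re q + orient p q z * re r);
    last by field.
  by rewrite /orient; ring.
transitivity (orient q r z * im p + orient r p z * im q + orient p q z * im r);
  last by field.
by rewrite /orient; ring.
Qed.
End Plane.

(** * Straight-line homotopies *)

Section Topology.
Context {R : realType}.
Local Notation C := (plane R).
Local Notation P := (option R).
Implicit Types z w : C.

(** The norm of [plane R] is itself complex-valued; describing neighbourhoods by the real number
    [nsq] lets limits be checked on real and imaginary parts. *)
Lemma nbhs_plane z (S : set C) :
  nbhs z S <-> exists2 e : R, 0 < e & forall w, nsq (w - z) < e -> S w.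
Proof.
split.
  move=> /nbhs_ballP[e /= e0 eS].
  have [d d0 de] : exists2 d : R, 0 < d & e = d%:C.
    move: e0; rewrite ltcE => /andP[/eqP b0 a0].
    by exists (re e); [exact: a0|apply: plane_eq; rewrite // im_real; move: b0].
  exists (d ^+ 2); first by rewrite exprn_gt0.
  move=> w h; apply: eS; rewrite -ball_normE /= norm_plane de ltcR.
  have -> : nsq (z - w) = nsq (w - z) by rewrite /nsq !planeE; ring.
  by rewrite -(ger0_norm (ltW d0)) -sqrtr_sqr ltr_sqrt // exprn_gt0.
case=> e e0 eS; apply/nbhs_ballP; exists (Num.sqrt e)%:C.
  by rewrite /= ltcR sqrtr_gt0.
move=> w; rewrite -ball_normE /= norm_plane ltcR ltr_sqrt // => h.
apply: eS; have -> : nsq (w - z) = nsq (z - w) by rewrite /nsq !planeE; ring.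
by [].
Qed.

Section Filters.
Context {T : Type} (F : set_system T) {FF : Filter F}.

Lemma cvg_plane (f : T -> C) (l : C) :
  re (f x) @[x --> F] --> re l -> im (f x) @[x --> F] --> im l ->
  f x @[x --> F] --> l.
Proof.
move=> hr hi S /nbhs_plane[e e0 eS].
have e2 : 0 < e / 4 by lra.
have hs : 0 < Num.sqrt (e / 4) by rewrite sqrtr_gt0.
move/cvgrPdist_lt: hr => /(_ _ hs) hr'; move/cvgrPdist_lt: hi => /(_ _ hs) hi'.
apply: filterS2 hr' hi' => x h1 h2; apply: eS; rewrite /nsq !planeE.
have sq (a b : R) : `|a - b| < Num.sqrt (e / 4) -> (b - a) ^+ 2 < e / 4.
  move=> h; rewrite -(sqr_sqrtr (ltW e2)) -[in X in X < _]sqrrN opprB.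
  by rewrite -real_normK ?num_real // ltr_pXn2r ?nnegrE ?normr_ge0 ?sqrtr_ge0.
by have := sq _ _ h1; have := sq _ _ h2; lra.
Qed.

Lemma cvg_re (f : T -> C) (l : C) : f x @[x --> F] --> l ->
  re (f x) @[x --> F] --> re l.
Proof.
move=> h; apply/cvgrPdist_lt => e e0.
have : nbhs l [set w | nsq (w - l) < e ^+ 2].
  by apply/nbhs_plane; exists (e ^+ 2) => //; rewrite exprn_gt0.
move=> /h {}h; apply: (@filterS _ F FF _ _ _ h) => x /=; rewrite /nsq !planeE => hx.
rewrite -(ger0_norm (ltW e0)) -ltr_sqr ?nnegrE ?normr_ge0 //.
by rewrite !real_normK ?num_real //; have := sqr_ge0 (im (f x) - im l); nra.
Qed.

Lemma cvg_im (f : T -> C) (l : C) : f x @[x --> F] --> l ->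
  im (f x) @[x --> F] --> im l.
Proof.
move=> h; apply/cvgrPdist_lt => e e0.
have : nbhs l [set w | nsq (w - l) < e ^+ 2].
  by apply/nbhs_plane; exists (e ^+ 2) => //; rewrite exprn_gt0.
move=> /h {}h; apply: (@filterS _ F FF _ _ _ h) => x /=; rewrite /nsq !planeE => hx.
rewrite -(ger0_norm (ltW e0)) -ltr_sqr ?nnegrE ?normr_ge0 //.
by rewrite !real_normK ?num_real //; have := sqr_ge0 (re (f x) - re l); nra.
Qed.

Lemma cvg_lin (a : T -> R) (f g : T -> C) a' l m :
  a x @[x --> F] --> a' -> f x @[x --> F] --> l -> g x @[x --> F] --> m ->
  lin (a x) (f x) (g x) @[x --> F] --> lin a' l m.
Proof.
move=> ha hf hg; apply: cvg_plane.
  under eq_fun do rewrite re_lin; rewrite re_lin.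
  apply: cvgD; apply: cvgM => //; try exact: cvg_re.
  by apply: cvgB => //; apply: cvg_cst.
under eq_fun do rewrite im_lin; rewrite im_lin.
apply: cvgD; apply: cvgM => //; try exact: cvg_im.
by apply: cvgB => //; apply: cvg_cst.
Qed.

Lemma cvg_orient p q (f : T -> C) (l : C) : f x @[x --> F] --> l ->
  orient p q (f x) @[x --> F] --> orient p q l.
Proof.
move=> hf; apply: cvgB; apply: cvgM; (try exact: cvg_cst);
  apply: cvgB; (try exact: cvg_cst); [exact: cvg_im|exact: cvg_re].
Qed.

Lemma cvg_nsq (f : T -> C) (l : C) : f x @[x --> F] --> l ->
  nsq (f x) @[x --> F] --> nsq l.
Proof.
move=> hf; rewrite /nsq; under eq_fun do rewrite !expr2; rewrite !expr2.
by apply: cvgD; apply: cvgM; first [exact: cvg_re|exact: cvg_im].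
Qed.

End Filters.

Lemma cvg_within_fst {T U : topologicalType} (D : set (T * U)) (A : set T) (x : T * U) :
  D `<=` A `*` setT -> fst @ within D (nbhs x) --> within A (nbhs x.1).
Proof.
move=> DA S; rewrite /within /= => hS.
case: x hS => x y /= hS; exists ([set u | A u -> S u], setT) => /=.
  by split=> //; exact: filterT.
by move=> [u v] [/= h _] /DA[/= Au _]; exact: h.
Qed.

Lemma cvg_within_snd {T U : topologicalType} (D : set (T * U)) (A : set U) (x : T * U) :
  D `<=` setT `*` A -> snd @ within D (nbhs x) --> within A (nbhs x.2).
Proof.
move=> DA S; rewrite /within /= => hS.
case: x hS => x y /= hS; exists (setT, [set u | A u -> S u]) => /=.
  by split=> //; exact: filterT.
by move=> [u v] [/= _ h] /DA[/= _ Au]; exact: h.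
Qed.

Lemma within_lin_homotopy (T : topologicalType) (A : set T) (f g : T -> C) :
  {within A, continuous f} -> {within A, continuous g} ->
  {within `[0, 1] `*` A,
    continuous (fun u : R * T => lin u.1 (f u.2) (g u.2))}.
Proof.
move=> /subspace_continuousP hf /subspace_continuousP hg.
apply/subspace_continuousP => -[s t] [/= hs ht]; apply: cvg_lin.
- move=> S hS; apply: (@cvg_within_fst _ _ _ setT (s, t)) => /=.
    by move=> [u v] [].
  by rewrite /within /=; apply: filterS hS.
- apply: (@cvg_comp _ _ _ snd f _ (within A (nbhs t))); last exact: hf.
  by apply: cvg_within_snd => -[u v] [].
- apply: (@cvg_comp _ _ _ snd g _ (within A (nbhs t))); last exact: hg.
  by apply: cvg_within_snd => -[u v] [].
Qed.

Lemma within_lin_path z w : {within `[0, 1], continuous (fun t => lin t z w)}.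
Proof.
apply: continuous_subspaceT => t; apply: cvg_lin; [|exact: cvg_cst..].
exact: cvg_id.
Qed.

Lemma itv01 (t : R) : (`[0, 1] : set R) t <-> 0 <= t <= 1.
Proof. by rewrite /= in_itv. Qed.

Lemma ideal_path_lin z w : circle z -> circle w -> z <> w ->
  ideal_path (fun t => lin t z w).
Proof.
move=> cz cw zw.
have e0 : lin 0 z w = z by rewrite /lin subr0 mul1r mul0r addr0.
have e1 : lin 1 z w = w by rewrite /lin subrr mul1r mul0r add0r.
split; rewrite ?e0 ?e1 //; first exact: within_lin_path.
by move=> t ht; apply: disc_lin => //; apply: circle_cdisc.
Qed.

Lemma ideal_path_cdisc (g : R -> C) t : ideal_path g -> 0 <= t <= 1 -> cdisc (g t).
Proof.
move=> [_ g0 g1 _ gd] /andP[]; rewrite le_eqVlt => /orP[/eqP <-|t0].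
  by move=> _; apply: circle_cdisc.
rewrite le_eqVlt => /orP[/eqP ->|t1]; first exact: circle_cdisc.
by apply: disc_cdisc; apply: gd; rewrite t0.
Qed.

Lemma path_classE (g : R -> C) : ideal_path g ->
  path_class g = [set h | [/\ ideal_path h, h 0 = g 0 & h 1 = g 1]].
Proof.
move=> ig; apply/seteqP; split=> h /=.
  case=> ih [H [_ _ H1 Hs _]].
  have r01 : is_true (((0 : R) <= 0) && ((0 : R) <= 1)) by rewrite lexx ler01.
  have r11 : is_true (((0 : R) <= 1) && ((1 : R) <= 1)) by rewrite lexx ler01.
  by split=> //; rewrite -H1 //; case: (Hs 1 r11).
case=> ih e0 e1; split=> //.
exists (fun u => lin u.1 (g u.2) (h u.2)).
have ell t (z : C) : lin t z z = z.
  by apply: plane_eq; rewrite ?re_lin ?im_lin; ring.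
have [cg _ _ _ gd] := ig; have [ch _ _ _ hd] := ih.
split=> /=.
- exact: (@within_lin_homotopy R _ _ _ cg ch).
- by move=> t _; apply: plane_eq; rewrite ?re_lin ?im_lin; ring.
- by move=> t _; apply: plane_eq; rewrite ?re_lin ?im_lin; ring.
- by move=> s _; rewrite e0 e1 !ell.
- by move=> s t hs ht; apply: disc_convex; [|exact: gd|exact: hd].
Qed.

Lemma disc_homotopicP (f g : C -> C) :
  {within cdisc, continuous f} -> {within cdisc, continuous g} ->
  (forall z, disc z -> disc (f z)) -> (forall z, disc z -> disc (g z)) ->
  disc_homotopic f g <-> (forall z, circle z -> f z = g z).
Proof.
move=> cf cg df dg; split.
  move=> [H [_ _ H1 Hc _]] z cz.
  by rewrite -(H1 z (circle_cdisc cz)) Hc // lexx ler01.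
move=> e; exists (fun u => lin u.1 (f u.2) (g u.2)).
split=> /=.
- exact: (@within_lin_homotopy C _ _ _ cf cg).
- by move=> t _; apply: plane_eq; rewrite ?re_lin ?im_lin; ring.
- by move=> t _; apply: plane_eq; rewrite ?re_lin ?im_lin; ring.
- by move=> s z _ cz; rewrite -e //; apply: plane_eq; rewrite ?re_lin ?im_lin; ring.
- by move=> s z hs dz; apply: disc_convex; [|exact: df|exact: dg].
Qed.

End Topology.

(** * Ideal arcs and ideal triangles *)

Section Arcs.
Context {R : realType}.
Local Notation C := (plane R).
Local Notation P := (option R).
Local Notation mu := (@cayley R).
Implicit Types (x y z : P) (w : C).

Definition dpath x y : set (R -> C) :=
  [set h | [/\ ideal_path h, h 0 = mu x & h 1 = mu y]].
Definition arc x y : set (R -> C) := dpath x y `|` dpath y x.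

Lemma arcC x y : arc x y = arc y x. Proof. exact: setUC. Qed.

Lemma dpath_lin x y : x <> y -> dpath x y (fun t => lin t (mu x) (mu y)).
Proof.
move=> xy; split; [|by rewrite /lin subr0 mul1r mul0r addr0|
  by rewrite /lin subrr mul1r mul0r add0r].
by apply: ideal_path_lin; try exact: cayley_circle; move=> /cayley_inj.
Qed.

Lemma ideal_pathP (g : R -> C) : ideal_path g ->
  exists x y, [/\ x <> y, g 0 = mu x & g 1 = mu y].
Proof.
move=> [_ /cayley_surj[x ex] /cayley_surj[y ey] g01 _].
by exists x, y; split=> // e; apply: g01; rewrite -ex -ey e.
Qed.

Lemma path_class_dpath (g : R -> C) x y : ideal_path g -> g 0 = mu x ->
  g 1 = mu y -> path_class g = dpath x y.
Proof. by move=> ig e0 e1; rewrite path_classE // e0 e1. Qed.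

Lemma ideal_path_rev (g : R -> C) : ideal_path g -> ideal_path (path_rev g).
Proof.
move=> [/subspace_continuousP cg g0 g1 g01 gd].
split; rewrite /path_rev ?subr0 ?subrr //.
- apply/subspace_continuousP => t /itv01 ht.
  have ht' : (`[0, 1] : set R) (1 - t) by apply/itv01; lra.
  apply: (@cvg_comp _ _ _ (fun t => 1 - t) g _ (within `[0, 1] (nbhs (1 - t))));
    last exact: cg.
  have hc : (1 - s) @[s --> t] --> 1 - t.
    by apply: cvgB; [exact: cvg_cst|exact: cvg_id].
  move=> S hS; have {hS} := hc _ hS; rewrite /within /=.
  apply: (@filterS _ (nbhs t)) => s /= hs hs'.
  by apply: hs; move: hs'; rewrite !in_itv /=; lra.
- by move=> e; apply: g01.
- by move=> t ht; apply: gd; lra.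
Qed.

Lemma arc_classE (g : R -> C) x y : ideal_path g -> g 0 = mu x ->
  g 1 = mu y -> arc_class g = arc x y.
Proof.
move=> ig e0 e1; rewrite /arc_class (path_class_dpath ig e0 e1).
congr (_ `|` _); apply: path_class_dpath; first exact: ideal_path_rev.
  by rewrite /path_rev subr0.
by rewrite /path_rev subrr.
Qed.

Lemma ideal_arcP A : ideal_arc A <-> exists x y, x <> y /\ A = arc x y.
Proof.
split=> [[g ig ->]|[x [y [xy ->]]]].
  have [x [y [xy e0 e1]]] := ideal_pathP ig.
  by exists x, y; rewrite (arc_classE ig e0 e1).
have [ig e0 e1] := dpath_lin xy.
by exists (fun t => lin t (mu x) (mu y)) => //; rewrite (arc_classE ig e0 e1).
Qed.

Lemma arc_xx x : arc x x = set0.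
Proof.
by apply/seteqP; split=> // h [] [[_ _ _ h01 _] e0 e1]; case: h01; rewrite e0 e1.
Qed.

Lemma ideal_arc_neq x y : ideal_arc (arc x y) -> x <> y.
Proof.
move=> /ideal_arcP[a [b [ab e]]] xy; move: e; rewrite xy arc_xx => e.
have : arc a b (fun t => lin t (mu a) (mu b)) by left; apply: dpath_lin.
by rewrite -e.
Qed.

Lemma joins_arc x y p q : x <> y -> joins (arc x y) p q <->
  (p = mu x /\ q = mu y) \/ (p = mu y /\ q = mu x).
Proof.
move=> xy; split.
  by move=> [g [[[_ e0 e1]|[_ e0 e1]] <- <-]]; rewrite e0 e1; [left|right].
case=> -[-> ->].
  exists (fun t => lin t (mu x) (mu y)); have := dpath_lin xy.
  by move=> h; split; [by left| |]; case: h.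
have yx : y <> x by move=> e; apply: xy.
exists (fun t => lin t (mu y) (mu x)); have := dpath_lin yx.
by move=> h; split; [by right| |]; case: h.
Qed.

Lemma arc_inj x y a b : x <> y -> arc x y = arc a b ->
  (x = a /\ y = b) \/ (x = b /\ y = a).
Proof.
move=> xy e.
have : arc a b (fun t => lin t (mu x) (mu y)) by rewrite -e; left; apply: dpath_lin.
have [_ e0 e1] := dpath_lin xy.
by case=> -[_ f0 f1]; [left|right]; split; apply: cayley_inj;
  [exact: etrans (esym e0) f0|exact: etrans (esym e1) f1
  |exact: etrans (esym e0) f0|exact: etrans (esym e1) f1].
Qed.

Lemma joins_arcE A x y : ideal_arc A -> joins A (mu x) (mu y) -> A = arc x y.
Proof.
move=> /ideal_arcP[a [b [ab ->]]] /joins_arc-/(_ ab).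
by case=> -[/cayley_inj -> /cayley_inj ->] //; rewrite arcC.
Qed.

Lemma chord_arc x y w : x <> y ->
  chord (arc x y) w <-> exists2 t, 0 < t < 1 & w = lin t (mu x) (mu y).
Proof.
move=> xy; split.
  move=> [p [q [t [/joins_arc-/(_ xy) [] [-> ->] ht ->]]]].
    by exists t.
  exists (1 - t); first by lra.
  by rewrite /lin subKr addrC.
move=> [t ht ->]; exists (mu x), (mu y), t; split=> //.
by apply/joins_arc => //; left.
Qed.

Lemma lin_disc x y t : x <> y -> 0 < t < 1 -> disc (lin t (mu x) (mu y)).
Proof.
move=> xy ht; apply: disc_lin => //; try by apply: circle_cdisc; apply: cayley_circle.
by move=> /cayley_inj.
Qed.

Definition onch x y w := disc w /\ orient (mu x) (mu y) w = 0.

Lemma chordE x y w : x <> y -> chord (arc x y) w <-> onch x y w.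
Proof.
move=> xy; rewrite chord_arc //; split.
  by move=> [t ht ->]; split; [exact: lin_disc|exact: orient_chord].
move=> [dw ow]; apply: orient0_chord => //; try exact: cayley_circle.
by move=> /cayley_inj.
Qed.

Lemma onchC x y w : onch x y w -> onch y x w.
Proof. by move=> [dw ow]; split=> //; rewrite orient_swap ow oppr0. Qed.

Definition tri x y z : set (set (R -> C)) := arc x y |` [set arc y z; arc z x].

Lemma tri_rot x y z : tri y z x = tri x y z.
Proof. by rewrite /tri [RHS]setUC setUA. Qed.
Lemma tri_swap x y z : tri y x z = tri x y z.
Proof. by rewrite /tri (arcC y x) (arcC x z) (arcC z y) [X in _ |` X]setUC. Qed.

Definition distinct3 x y z := [/\ x <> y, y <> z & z <> x].
Definition mem3 a x y z := [\/ a = x, a = y | a = z].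

Lemma tri_perm a b c x y z : distinct3 a b c -> mem3 a x y z -> mem3 b x y z ->
  mem3 c x y z -> tri a b c = tri x y z.
Proof.
move=> [ab bc ca] [] ea [] eb [] ec; move: ab bc ca; rewrite ea eb ec => ab bc ca //.
- by rewrite -(tri_rot x z y) tri_swap tri_rot.
- by rewrite tri_swap.
- by rewrite (tri_rot x).
- by rewrite 2!tri_rot.
- by rewrite tri_swap tri_rot.
Qed.

Lemma tri_inj a b c x y z : distinct3 a b c -> tri a b c = tri x y z ->
  [/\ mem3 a x y z, mem3 b x y z & mem3 c x y z].
Proof.
move=> [ab bc ca] e.
have m u v : u <> v -> tri a b c (arc u v) -> mem3 u x y z /\ mem3 v x y z.
  rewrite e => uv [|[]] /(arc_inj uv) [] [-> ->]; rewrite /mem3; split;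
    by [apply: Or31|apply: Or32|apply: Or33].
have [ma mb] : mem3 a x y z /\ mem3 b x y z by apply: m => //; left.
have [_ mc] : mem3 b x y z /\ mem3 c x y z by apply: m => //; right; left.
by split.
Qed.

Lemma triangle_onP T p q r : triangle_on T p q r <-> exists x y z,
  [/\ distinct3 x y z, p = mu x, q = mu y, r = mu z & T = tri x y z].
Proof.
split.
  move=> [[/cayley_surj[x <-] [/cayley_surj[y <-] /cayley_surj[z <-]]] xy yz zx].
  move=> [A [B [E [[iA jA] [iB jB] [iE jE] ->]]]]; exists x, y, z.
  rewrite (joins_arcE iA jA) (joins_arcE iB jB) (joins_arcE iE jE); split=> //.
  by split=> e; [apply: xy|apply: yz|apply: zx]; rewrite e.
move=> [x [y [z [[xy yz zx] -> -> -> ->]]]]; split.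
- by split; [|split]; apply: cayley_circle.
- by move=> /cayley_inj.
- by move=> /cayley_inj.
- by move=> /cayley_inj.
exists (arc x y), (arc y z), (arc z x); split=> //; split;
  by [apply/ideal_arcP; do 2!eexists; split; last reflexivity
     |apply/joins_arc => //; left].
Qed.

Lemma ideal_triangleP T : ideal_triangle T <-> exists x y z,
  ccw x y z /\ T = tri x y z.
Proof.
split.
  move=> [p [q [r /triangle_onP[x [y [z [[xy yz zx] _ _ _ ->]]]]]]].
  have [h|h] := ccw_total xy yz zx; first by exists x, y, z.
  by exists x, z, y; split=> //; rewrite -(tri_rot x z y) tri_swap tri_rot.
move=> [x [y [z [h ->]]]]; exists (mu x), (mu y), (mu z).
by apply/triangle_onP; exists x, y, z; split=> //; apply: ccw_neq.
Qed.

Lemma cornerP x y z v : distinct3 x y z ->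
  corner (tri x y z) v <-> [\/ v = mu x, v = mu y | v = mu z].
Proof.
move=> d; split.
  move=> [q [r /triangle_onP[a [b [c [d' -> _ _]]]]]] /esym/(tri_inj d')[m _ _].
  by case: m => ->; [apply: Or31|apply: Or32|apply: Or33].
have [xy yz zx] := d.
case=> ->.
- exists (mu y), (mu z); apply/triangle_onP; exists x, y, z; split=> //.
- exists (mu z), (mu x); apply/triangle_onP; exists y, z, x; split=> //.
  by rewrite (tri_rot x).
- exists (mu x), (mu y); apply/triangle_onP; exists z, x, y; split=> //.
  by rewrite tri_rot.
Qed.

Definition inT x y z w := exists a b c : R,
  [/\ 0 < a, 0 < b, 0 < c & a + b + c = 1] /\ w = bary a b c (mu x) (mu y) (mu z).

Lemma inT_rot x y z w : inT x y z w -> inT y z x w.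
Proof.
move=> [a [b [c [[a0 b0 c0 e] ->]]]]; exists b, c, a.
by split; [split=> //; lra|rewrite bary_rot].
Qed.
Lemma inT_swap x y z w : inT x y z w -> inT y x z w.
Proof.
move=> [a [b [c [[a0 b0 c0 e] ->]]]]; exists b, a, c.
by split; [split=> //; lra|rewrite /bary [X in X + _]addrC].
Qed.

Lemma region_tri x y z w : distinct3 x y z -> region (tri x y z) w <-> inT x y z w.
Proof.
move=> d; split; last first.
  move=> [a [b [c [[a0 b0 c0 e] ->]]]].
  exists (mu x), (mu y), (mu z), a, b, c; split=> //; split=> //.
  by apply/triangle_onP; exists x, y, z.
move=> [p [q [r [a [b [c [[/triangle_onP[x' [y' [z' [d' -> -> -> e]]]] a0 b0 c0 e1 ew]]]]]]]].
have : inT x' y' z' w by exists a, b, c; split.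
have [m1 m2 m3] := tri_inj d' (esym e).
have [xy yz zx] := d'; move=> h.
case: m1 m2 m3 => ea [] eb [] ec; move: h xy yz zx; rewrite ea eb ec => h xy yz zx //.
- by apply: inT_swap; apply: inT_rot; apply: inT_rot.
- exact: inT_swap.
- by apply: inT_rot; apply: inT_rot.
- exact: inT_rot.
- by apply: inT_swap; apply: inT_rot.
Qed.

Lemma inTE x y z w : ccw x y z -> inT x y z w <->
  [/\ 0 < orient (mu x) (mu y) w, 0 < orient (mu y) (mu z) w
    & 0 < orient (mu z) (mu x) w].
Proof.
move=> /orient_gt0 h; split.
  move=> [a [b [c [[a0 b0 c0 e] ->]]]]; split.
  - by rewrite orient_bary // mulr_gt0.
  - by rewrite bary_rot orient_bary ?mulr_gt0 // ?(orient_rot (mu x)) //; lra.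
  - rewrite bary_rot bary_rot orient_bary ?mulr_gt0 //; last by lra.
    by rewrite -(orient_rot (mu z)).
move=> [h1 h2 h3]; exists (orient (mu y) (mu z) w / orient (mu x) (mu y) (mu z)).
exists (orient (mu z) (mu x) w / orient (mu x) (mu y) (mu z)).
exists (orient (mu x) (mu y) w / orient (mu x) (mu y) (mu z)).
split; last by apply: baryE; apply: lt0r_neq0.
split; try exact: divr_gt0.
have n0 : orient (mu x) (mu y) (mu z) != 0 by apply: lt0r_neq0.
apply: (mulIf n0); rewrite mul1r -[RHS](orient_sum _ _ _ w).
by field.
Qed.

Lemma inT_disc x y z w : ccw x y z -> inT x y z w -> disc w.
Proof.
move=> /ccw_neq[xy yz zx] [a [b [c [[a0 b0 c0 e] ->]]]].
have h : 0 < b / (a + b) < 1.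
  by rewrite divr_gt0 ?ltr_pdivrMr; lra.
have -> : bary a b c (mu x) (mu y) (mu z) =
    lin c (lin (b / (a + b)) (mu x) (mu y)) (mu z).
  have n0 : a + b != 0 by apply: lt0r_neq0; lra.
  have -> : c = 1 - a - b by lra.
  by apply: plane_eq; rewrite ?re_lin ?im_lin /bary !planeE; field.
have d := lin_disc xy h.
apply: disc_lin; [lra|exact: disc_cdisc|exact/circle_cdisc/cayley_circle|].
by move=> e'; move: d; rewrite e'; move=> /disc_ncircle; apply; apply: cayley_circle.
Qed.

End Arcs.

(** * Triangles of a tessellation at an edge *)

Lemma near_finite {T U : Type} (F : set_system U) {FF : Filter F} (S : set T)
    (Q : T -> U -> Prop) : finite_set S ->
  (forall A, S A -> \forall w \near F, Q A w) ->
  \forall w \near F, forall A, S A -> Q A w.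
Proof.
move=> /(@finite_fsetP {classic T})[X ->] h.
have := @filter_bigI _ {classic T} X Q F FF (fun i iX => h i iX).
by apply: filterS => w hw A AX; apply: hw.
Qed.

Section Tess.
Context {R : realType}.
Local Notation C := (plane R).
Local Notation P := (option R).
Local Notation mu := (@cayley R).
Implicit Types (x y z p q r : P) (w : C) (tau : set (set (R -> C))).

Lemma near0_pos (c d : R) : 0 < c -> \forall s \near 0^'+, 0 < c + d * s.
Proof.
move=> c0; have h : 0 < c / (`|d| + 1).
  by rewrite divr_gt0 // ltr_pwDr.
near=> s.
have s0 : 0 < s by [].
have : s < c / (`|d| + 1) by near: s; apply: nbhs_right_lt.
rewrite ltr_pdivlMr; last by rewrite ltr_pwDr.
have : - (s * `|d|) <= d * s.
  by rewrite -{1}(gtr0_norm s0) -normrM mulrC lerNl -normrN ler_norm.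
by move=> ? ?; lra.
Unshelve. all: by end_near. Qed.

Lemma near0_lt1 : \forall s \near (0 : R)^'+, 0 < s < 1.
Proof.
near=> s; apply/andP; split; first by [].
by near: s; apply: nbhs_right_lt.
Unshelve. all: by end_near. Qed.

Definition E tau x y := tau (arc x y).

Lemma EC tau x y : E tau x y -> E tau y x.
Proof. by rewrite /E arcC. Qed.

Lemma E_neq tau x y : tau `<=` ideal_arc -> E tau x y -> x <> y.
Proof. by move=> h /h/ideal_arc_neq. Qed.

Lemma triangle_edges tau x y z : triangles tau (tri x y z) ->
  [/\ E tau x y, E tau y z & E tau z x].
Proof.
by move=> [_ h _]; split; apply: h; [left|right; left|right; right].
Qed.

Lemma trianglesP tau T : triangles tau T ->
  exists x y z, [/\ ccw x y z, T = tri x y z & triangles tau (tri x y z)].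
Proof.
move=> tT; case: (tT) => /ideal_triangleP[x [y [z [h e]]]] _ _.
by exists x, y, z; split=> //; rewrite -e.
Qed.

Lemma ccw_distinct3 x y z : ccw x y z -> distinct3 x y z.
Proof. exact: ccw_neq. Qed.

Lemma orient0_eq x y z : x <> y -> orient (mu x) (mu y) (mu z) = 0 ->
  z = x \/ z = y.
Proof.
move=> xy e; apply: contrapT => /not_orP[zx zy].
have [h|h] := @ccw_total _ x y z xy (fun e => zy (esym e)) zx.
  by move/orient_gt0: h; rewrite e ltxx.
by move/orient_lt0: h; rewrite e ltxx.
Qed.

(* Otherwise the chord of [a b] would enter the triangle at [w]. *)
Lemma edge_through_side tau p q r a b w : tau `<=` ideal_arc ->
  ccw p q r -> triangles tau (tri p q r) -> onch p q w ->
  E tau a b -> onch a b w -> a = p \/ a = q.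
Proof.
move=> tI pqr tT [dw ow] Eab [_ ow'].
have ab := E_neq tI Eab; have [pq qr rp] := ccw_neq pqr.
have [t ht ew] : exists2 t, 0 < t < 1 & w = lin t (mu p) (mu q).
  by apply/chord_arc/chordE.
have ow2 : 0 < orient (mu q) (mu r) w.
  rewrite ew orient_lin [X in _ + _ * X](_ : _ = 0); last by rewrite /orient; ring.
  by move/orient_gt0: pqr; rewrite -orient_rot => h; rewrite mulr0 addr0 mulr_gt0 //; lra.
have ow3 : 0 < orient (mu r) (mu p) w.
  rewrite ew orient_lin [X in _ * X + _](_ : _ = 0); last by rewrite /orient; ring.
  by move/orient_gt0: pqr; rewrite -2!orient_rot => h; rewrite mulr0 add0r mulr_gt0 //; lra.
apply: contrapT => na.
(* An end strictly on the side of [r] is impossible. As [w] is strictly between [a] and [b], one of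
   them would be on that side if [a] were off the line. *)
suff key c d : E tau c d -> onch c d w -> c <> d ->
    ~ 0 < orient (mu p) (mu q) (mu c).
  have oa : orient (mu p) (mu q) (mu a) != 0.
    by apply/eqP => /(orient0_eq pq) [] e; apply: na; [left|right].
  have [s hs ew'] : exists2 t, 0 < t < 1 & w = lin t (mu a) (mu b).
    by apply/chord_arc/chordE.
  have kab := key _ _ Eab (conj dw ow') ab.
  have kba := key _ _ (EC Eab) (onchC (conj dw ow')) (fun e => ab (esym e)).
  move: ow; rewrite ew' orient_lin => ow.
  case: (ltrgtP (orient (mu p) (mu q) (mu a)) 0) => h.
  - by apply: kba; nra.
  - exact: kab.
  - by rewrite h eqxx in oa.
move=> Ecd ocd cd oc.
have [s hs ew'] : exists2 t, 0 < t < 1 & w = lin t (mu c) (mu d).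
  by apply/chord_arc/chordE.
near (0 : R)^'+ => e.
have he : 0 < e < 1 by near: e; apply: near0_lt1.
pose v := lin e w (mu c).
have vT : inT p q r v.
  apply/inTE => //; rewrite !orient_lin ow mulr0 add0r; split.
  - by rewrite mulr_gt0 //; lra.
  - have : 0 < orient (mu q) (mu r) w +
      (orient (mu q) (mu r) (mu c) - orient (mu q) (mu r) w) * e.
      by near: e; apply: near0_pos.
    by lra.
  - have : 0 < orient (mu r) (mu p) w +
      (orient (mu r) (mu p) (mu c) - orient (mu r) (mu p) w) * e.
      by near: e; apply: near0_pos.
    by lra.
have vc : onch c d v.
  split; first exact: inT_disc vT.
  by rewrite /v orient_lin (proj2 ocd) /orient; ring.
have [_ _ ] := tT; rewrite -subset0 => /(_ v); apply; split.
  by apply/region_tri => //; apply: ccw_distinct3.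
by exists (arc c d) => //; apply/chordE.
Unshelve. all: by end_near. Qed.

Lemma near_nsq w (e : R) : nsq w < e -> \forall v \near w, nsq v < e.
Proof.
move=> dw; have h : nsq v @[v --> w] --> nsq w.
  exact: (@cvg_nsq _ _ (nbhs w) _ id w (@cvg_id _ _)).
near=> v; near: v; exact: (cvgr_lt _ h _ dw).
Unshelve. all: by end_near. Qed.

Lemma near_disc w : disc w -> \forall v \near w, disc v.
Proof.
move=> /discE/near_nsq h; near=> v; apply/discE; near: v; exact: h.
Unshelve. all: by end_near. Qed.

Lemma near_orient_neq0 (a b w : C) : orient a b w != 0 ->
  \forall v \near w, orient a b v != 0.
Proof.
move=> h; have c : orient a b v @[v --> w] --> orient a b w.
  exact: (@cvg_orient _ _ (nbhs w) _ a b id w (@cvg_id _ _)).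
exact: (cvgr_neq0 _ c h).
Qed.

(* A point approaching [w] along a parabola tangent to the chord leaves every
   chord through [w], so it falls in a triangle having [w] on one of its sides. *)
Lemma touch tau x y w : tessellation tau -> E tau x y -> onch x y w ->
  exists z, [/\ ccw x z y, triangles tau (tri x z y) &
    forall a b, E tau a b -> onch a b w -> arc a b = arc x y].
Proof.
move=> [[tI _ tF] tC _ _ _] Exy xyw.
have xy := E_neq tI Exy.
have [dw ow] := xyw.
have [U nU finS] := tF _ dw; set S := [set A | _] in finS.
have tauP A : tau A -> exists a b, a <> b /\ A = arc a b.
  by move=> /tI/ideal_arcP.
(* Only the finitely many edges of [S] come close to [w], so nearby points avoid every line of such
   an edge that misses [w]. *)
have nearw : \forall v \near w, [/\ U v, disc v & forall A, S A ->
    forall a b, A = arc a b -> orient (mu a) (mu b) w <> 0 ->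
    orient (mu a) (mu b) v <> 0].
  have n3 : \forall v \near w, forall A, S A ->
    forall a b, A = arc a b -> orient (mu a) (mu b) w <> 0 ->
    orient (mu a) (mu b) v <> 0.
    apply: (@near_finite _ _ (nbhs w) _ S) => // A [/tauP[a [b [ab eA]]] _].
    case: (eqVneq (orient (mu a) (mu b) w) 0) => [ ow0|/near_orient_neq0].
      apply: nearW => v c d ec; move: eA; rewrite ec => eA.
      have [[-> ->]|[-> ->]] : (c = a /\ d = b) \/ (c = b /\ d = a).
        have := arc_inj ab (esym eA); case=> -[-> ->]; first by left.
        by right.
        by rewrite ow0.
      by rewrite orient_swap ow0 oppr0.
    apply: filterS => v hv c d ec _; move: eA; rewrite ec => eA.
    have := arc_inj ab (esym eA); case=> -[<- <-]; first exact/eqP.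
    by rewrite orient_swap => /eqP; rewrite oppr_eq0; apply/negP.
  by have := near_disc dw; apply: filterS3 n3 nU => v ? ? ?; split.
have [e e0 eU] := (nbhs_plane _ _).1 nearw.
pose dx := re (mu y) - re (mu x); pose dy := im (mu y) - im (mu x).
pose N := dx ^+ 2 + dy ^+ 2.
have N0 : 0 < N.
  have := @nsq_gt0 _ (mu y) (mu x) (fun e => xy (esym (cayley_inj e))).
  by rewrite /nsq !planeE.
(* The first-order term follows the chord, the second-order one pushes to its right, the side on
   which the apex is sought. *)
pose v s : C := (re w + s * dx + s ^+ 2 * dy) +i* (im w + s * dy - s ^+ 2 * dx).
have rev s : re (v s) = re w + s * dx + s ^+ 2 * dy by [].
have imv s : im (v s) = im w + s * dy - s ^+ 2 * dx by [].
have [t ht ew] : exists2 t, 0 < t < 1 & w = lin t (mu x) (mu y).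
  by apply/chord_arc/chordE.
have vS : \forall s \near 0^'+, forall A, S A -> forall a b, A = arc a b ->
    arc a b <> arc x y -> orient (mu a) (mu b) w = 0 ->
    orient (mu a) (mu b) (v s) <> 0.
  apply: (@near_finite _ _ (0^'+) _ S) => // A [/tauP[a [b [ab eA]]] _].
  (* The derivative at [s = 0] of [orient a b] along the parabola. It vanishes only for a chord
     parallel to [x y], which through [w] is [x y] itself. *)
  pose k := orient (mu a) (mu b) (mu y) - orient (mu a) (mu b) (mu x).
  pose l := - ((re (mu b) - re (mu a)) * dx + (im (mu b) - im (mu a)) * dy).
  have ov s : orient (mu a) (mu b) (v s) = orient (mu a) (mu b) w + s * (k + l * s).
    by rewrite /orient rev imv /k /l /dx /dy /orient; ring.
  case: (pselect (arc a b <> arc x y /\ orient (mu a) (mu b) w = 0)); last first.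
    move=> no; apply: nearW => s c d ec h1 h2; case: no; rewrite -eA ec; split=> //.
    move: eA; rewrite ec => eA.
    have := arc_inj ab (esym eA); case=> -[-> ->] //.
    by rewrite orient_swap h2 oppr0.
  move=> [nab oab].
  have k0 : k != 0.
    apply/eqP => k0; apply: nab.
    have ew' : (1 - t) * orient (mu a) (mu b) (mu x) + t * orient (mu a) (mu b) (mu y) = 0.
      by rewrite -orient_lin -ew.
    have ox : orient (mu a) (mu b) (mu x) = 0 by rewrite /k in k0; nra.
    have oy : orient (mu a) (mu b) (mu y) = 0 by rewrite /k in k0; nra.
    case: (orient0_eq ab ox) xy => ->; case: (orient0_eq ab oy) => -> // _.
    by rewrite arcC.
  have nz : \forall s \near (0 : R)^'+, k + l * s != 0.
    case: (ltrgtP k 0) => hk; last by rewrite hk eqxx in k0.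
    - have kp : 0 < - k by lra.
      by have := near0_pos (- l) kp; apply: filterS => s hs; apply/eqP; nra.
    - by have := near0_pos l hk; apply: filterS => s hs; apply: lt0r_neq0.
  near=> s; move=> c d ec _ _.
  have ns : orient (mu a) (mu b) (v s) != 0.
    have kl : k + l * s != 0 by near: s.
    have hs0 : 0 < s by [].
    by rewrite ov oab add0r mulf_eq0 negb_or kl (gt_eqF hs0).
  move: eA; rewrite ec => eA.
  have := arc_inj ab (esym eA); case=> -[<- <-]; first exact/eqP.
  by rewrite orient_swap => /eqP; rewrite oppr_eq0; apply/negP.
have [s [hs nv hS]] : exists s, [/\ 0 < s < 1, nsq (v s - w) < e &
    forall A, S A -> forall a b, A = arc a b ->
    arc a b <> arc x y -> orient (mu a) (mu b) w = 0 ->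
    orient (mu a) (mu b) (v s) <> 0].
  near (0 : R)^'+ => s; exists s; split.
  - by near: s; apply: near0_lt1.
  - have : 0 < e + (- (2 * N)) * s by near: s; apply: near0_pos.
    have hs : 0 < s < 1 by near: s; apply: near0_lt1.
    have -> : nsq (v s - w) = N * (s ^+ 2 * (1 + s ^+ 2)).
      by rewrite /nsq !planeE rev imv /N; ring.
    have /andP[s0 s1] := hs; have s2 : s ^+ 2 <= s by nra.
    have : s ^+ 2 * (1 + s ^+ 2) <= s * 2.
      by have q0 := sqr_ge0 s; apply: ler_pM; lra.
    by move=> /(ler_wpM2l (ltW N0)); lra.
  - by near: s.
have [Uv dv hv] := eU _ nv.
have oxy : orient (mu x) (mu y) (v s) < 0.
  have -> : orient (mu x) (mu y) (v s) = orient (mu x) (mu y) w - s ^+ 2 * N.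
    by rewrite /orient rev imv /N /dx /dy; ring.
  by case/andP: hs => hs0 _; rewrite ow sub0r oppr_lt0 mulr_gt0 // exprn_gt0.
have nsup : ~ edge_support tau (v s).
  move=> [A tA cA]; have SA : S A by split=> //; exists (v s).
  have [a [b [ab eA]]] := tauP _ tA.
  have : onch a b (v s) by apply/chordE; rewrite -?eA.
  move=> [_ oab].
  have [exy|nxy] := pselect (arc a b = arc x y).
    by have := arc_inj ab exy; case=> -[ea eb]; move: oab;
      rewrite ea eb ?(orient_swap (mu x)); lra.
  have [ow0|ow1] := eqVneq (orient (mu a) (mu b) w) 0.
    exact: (hS _ SA _ _ eA nxy ow0).
  by apply: (hv _ SA _ _ eA) oab; apply/eqP.
have : (disc `\` edge_support tau) (v s) by [].
rewrite tC => -[T tT Tv].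
have [p [q [r [pqr eT tT']]]] := trianglesP tT.
have {tT eT Tv} : inT p q r (v s).
  by apply/region_tri; [exact: ccw_distinct3|rewrite -eT].
(* Lying on an edge, [w] is not inside the triangle that contains [v s], so it is not strictly
   inside with respect to one of the sides, which a rotation renames [p' q']. *)
suff side p' q' r' : ccw p' q' r' -> triangles tau (tri p' q' r') ->
    inT p' q' r' (v s) -> orient (mu p') (mu q') w <= 0 ->
    exists z, [/\ ccw x z y, triangles tau (tri x z y) &
    forall a b, E tau a b -> onch a b w -> arc a b = arc x y].
  move=> Tv; have [|h1] := lerP (orient (mu p) (mu q) w) 0.
    exact: side pqr tT' Tv.
  have pqr' := ccw_rot pqr; have pqr'' := ccw_rot pqr'.
  have [|h2] := lerP (orient (mu q) (mu r) w) 0.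
    by apply: (side q r p) => //; [rewrite tri_rot|apply: inT_rot].
  have [|h3] := lerP (orient (mu r) (mu p) w) 0.
    by apply: (side r p q) => //; [rewrite 2!tri_rot|do 2!apply: inT_rot].
  have Tw : inT p q r w by apply/inTE.
  have [_ _] := tT'; rewrite -subset0 => /(_ w) []; split.
    by apply/region_tri => //; apply: ccw_distinct3.
  by exists (arc x y) => //; apply/chordE.
move=> {}pqr {}tT Tv ole.
have [Epq Eqr Erp] := triangle_edges tT.
have [pq _ _] := ccw_neq pqr.
have ov : 0 < orient (mu p') (mu q') (v s) by have := (inTE _ pqr).1 Tv; case.
have opq : orient (mu p') (mu q') w = 0.
  apply: contrapT => nop.
  (* At this parameter the segment from [v s] to [w] meets the line [p' q'], still near [w]. So
     [p' q'] belongs to [S], against the choice of the neighbourhood. *)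
  pose u := orient (mu p') (mu q') (v s) /
    (orient (mu p') (mu q') (v s) - orient (mu p') (mu q') w).
  have den : 0 < orient (mu p') (mu q') (v s) - orient (mu p') (mu q') w by lra.
  have hu : 0 <= u <= 1.
    by rewrite /u divr_ge0 ?ler_pdivrMr ?mul1r //; lra.
  pose y0 := lin u (v s) w.
  have ny0 : nsq (y0 - w) < e.
    have -> : nsq (y0 - w) = (1 - u) ^+ 2 * nsq (v s - w).
      by rewrite /y0 /lin /nsq !planeE; ring.
    apply: le_lt_trans nv; rewrite ler_piMl ?nsq_ge0 //.
    by case/andP: hu => u0 u1; rewrite expr_le1 //; lra.
  have [Uy dy0 hy0] := eU _ ny0.
  have oy0 : orient (mu p') (mu q') y0 = 0.
    by rewrite /y0 orient_lin /u; field; apply: lt0r_neq0.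
  have Spq : S (arc p' q').
    by split=> //; exists y0; split=> //; apply/chordE.
  exact: hy0 Spq _ _ erefl nop oy0.
have pqw : onch p' q' w by [].
have uni a b : E tau a b -> onch a b w -> arc a b = arc p' q'.
  move=> Eab ab; have nab := E_neq tI Eab.
  have := edge_through_side tI pqr tT pqw Eab ab.
  have := edge_through_side tI pqr tT pqw (EC Eab) (onchC ab).
  case=> eb; case=> ea; move: nab; rewrite ea eb // => _.
  by rewrite arcC.
have exy := uni _ _ Exy xyw.
exists r'; have := arc_inj xy exy; case=> -[ex ey].
  by move: oxy ov; rewrite ex ey; lra.
rewrite ex ey; split.
- exact: ccw_rot.
- by rewrite (tri_rot p').
- by move=> a b /uni h /h ->; rewrite arcC.
Unshelve. all: by end_near. Qed.

Lemma tess_apex tau x y : tessellation tau -> E tau x y ->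
  exists z, [/\ ccw x z y, E tau x z & E tau z y].
Proof.
move=> tt Exy; have xy := E_neq (let: And5 (And3 h _ _) _ _ _ _ := tt in h) Exy.
have h : onch x y (lin (1 / 2) (mu x) (mu y)).
  by split; [apply: lin_disc => //; lra|exact: orient_chord].
have [z [xzy /triangle_edges[? ? _] _]] := touch tt Exy h.
by exists z.
Qed.

Lemma cross_onch x y a b : cross x y a b -> exists2 w, onch x y w & onch a b w.
Proof.
move=> [/orient_lt0 h1 h2].
have ab : a <> b by move=> e; move/orient_lt0: h1; rewrite e; move: h2; cyc.
have {}h2 : 0 < orient (mu x) (mu y) (mu b).
  by apply/orient_gt0; apply: ccw_rot; apply: ccw_rot.
pose t := orient (mu x) (mu y) (mu a) /
  (orient (mu x) (mu y) (mu a) - orient (mu x) (mu y) (mu b)).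
have den : orient (mu x) (mu y) (mu a) - orient (mu x) (mu y) (mu b) < 0 by lra.
have ht : 0 < t < 1.
  by rewrite /t -[X in X / _]opprK -[X in _ / X]opprB mulNr -mulrN -invrN opprK
    divr_gt0 ?ltr_pdivrMr ?mul1r; lra.
exists (lin t (mu a) (mu b)); split; try exact: lin_disc; last exact: orient_chord.
by rewrite orient_lin /t; field; apply: ltr0_neq0.
Qed.

(** By [touch], all edges through a common point of two chords are the same arc. *)
Lemma tess_noncross tau x y a b : tessellation tau -> E tau x y -> E tau a b ->
  ~ cross x y a b.
Proof.
move=> tt Exy Eab h; have [w xyw abw] := cross_onch h.
have [z [_ _ /(_ _ _ Eab abw) e]] := touch tt Exy xyw.
have ab : a <> b := E_neq (let: And5 (And3 h _ _) _ _ _ _ := tt in h) Eab.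
have := arc_inj ab e; case: h => h1 h2.
by case=> -[ea eb]; move: h1 h2; rewrite ea eb; cyc.
Qed.
End Tess.

(** * Farey arithmetic *)

Section Farey.
Context {R : realType}.
Local Notation C := (plane R).
Local Notation P := (option R).
Local Notation mu := (@cayley R).
Implicit Types (x y z p q r : P) (u v w : int * int) (A : 'M[int]_2).

Definition prj (a b : R) : P := if b == 0 then None else Some (a / b).
Definition proj u : P := prj u.1%:~R u.2%:~R.
Definition det u w : int := u.1 * w.2 - u.2 * w.1.
Definition nv u : int := u.1 ^+ 2 + u.2 ^+ 2.
(** The vectors are free up to sign; [|det u w| = 1] makes them primitive, so that each is a reduced
    expression or the opposite of one. *)
Definition fa x y := exists u w, [/\ `|det u w| = 1, proj u = x & proj w = y].
Definition ratp x := exists r : option rat, x = omap ratr r.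

Lemma prjK (l : R) x : l != 0 -> prj (l * hx x) (l * hy x) = x.
Proof.
move=> l0; rewrite /prj; case: x => [t|] /=; last by rewrite mulr0 eqxx.
by rewrite mulr1 (negbTE l0) mulrAC divff // mul1r.
Qed.

Lemma prj_ex (a b : R) : (a != 0) || (b != 0) -> exists2 l : R, l != 0 &
  a = l * hx (prj a b) /\ b = l * hy (prj a b).
Proof.
rewrite /prj; have [->|b0] := eqVneq b 0; rewrite ?orbF => a0.
  by exists a; rewrite //= mulr1 mulr0.
by exists b; rewrite //= mulr1; split=> //; field.
Qed.

Lemma hxy_neq0 x : (hx x != 0) || (hy x != 0).
Proof. by case: x => [t|] /=; rewrite oner_eq0 ?orbT. Qed.

Lemma det_neq0 u w : det u w != 0 -> (u.1 != 0) || (u.2 != 0).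
Proof.
case: u => a b /=; rewrite /det /=; apply: contraR; rewrite negb_or !negbK.
by move=> /andP[/eqP -> /eqP ->]; rewrite !mul0r subr0.
Qed.

Lemma detC u w : det w u = - det u w.
Proof. by rewrite /det; ring. Qed.

Lemma detNl u w : det (- u) w = - det u w.
Proof. by rewrite /det /=; ring. Qed.

Lemma detNr u w : det u (- w) = - det u w.
Proof. by rewrite /det /=; ring. Qed.

Lemma det1_neq0 u w : `|det u w| = 1 -> det u w != 0.
Proof. by move=> h; apply/eqP => e; rewrite e in h. Qed.

Lemma proj_ex u : (u.1 != 0) || (u.2 != 0) -> exists2 l : R, l != 0 &
  u.1%:~R = l * hx (proj u) /\ u.2%:~R = l * hy (proj u).
Proof. by move=> h; apply: prj_ex; rewrite !intr_eq0. Qed.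

Lemma det_br u w : det u w != 0 -> exists l m : R, [/\ l != 0, m != 0,
  (det u w)%:~R = l * m * br (proj u) (proj w),
  (nv u)%:~R = l ^+ 2 * sqn (proj u) & (nv w)%:~R = m ^+ 2 * sqn (proj w)].
Proof.
move=> d0; have [l l0 [e1 e2]] := proj_ex (det_neq0 d0).
have d0' : det w u != 0 by rewrite detC oppr_eq0.
have [m m0 [f1 f2]] := proj_ex (det_neq0 d0').
exists l, m; split=> //.
- by rewrite /det intrD intrN !intrM e1 e2 f1 f2 /br; ring.
- by rewrite /nv intrD !rmorphXn /= e1 e2 /sqn; ring.
- by rewrite /nv intrD !rmorphXn /= f1 f2 /sqn; ring.
Qed.

Lemma fa_neq x y : fa x y -> x <> y.
Proof.
move=> [u [w [/det1_neq0 d <- <-]]] e; have [l [m [l0 m0 h _ _]]] := det_br d.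
have : (det u w)%:~R = 0 :> R by rewrite h e (br_eq0 _ _).2 ?mulr0.
by move=> /eqP; rewrite intr_eq0 (negbTE d).
Qed.

Lemma faC x y : fa x y -> fa y x.
Proof. by move=> [u [w [d <- <-]]]; exists w, u; rewrite detC normrN. Qed.

Lemma proj_opp u : proj (- u) = proj u.
Proof.
rewrite /proj /prj /= !intrN oppr_eq0.
by case: eqP => // e; congr Some; rewrite invrN mulrNN.
Qed.

Lemma ratp_proj u : ratp (proj u).
Proof.
rewrite /proj /prj; case: eqP => _; first by exists None.
by exists (Some (u.1%:~R / u.2%:~R)); rewrite /= rmorphM fmorphV /= !ratr_int.
Qed.

Lemma proj_reduced s (r : option rat) : s != 0 ->
  proj (reduced_expr s r) = omap ratr r.
Proof.
case: r => [r|] s0 /=; rewrite /proj /prj /=; last by rewrite eqxx.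
by rewrite intr_eq0 denq_eq0.
Qed.

Lemma ratpP x : ratp x -> exists2 u, (u.1 != 0) || (u.2 != 0) & proj u = x.
Proof.
move=> [r ->]; exists (reduced_expr 1 r); last exact: proj_reduced.
by case: r => [r|] //=; rewrite denq_eq0 orbT.
Qed.

Lemma det1_coprime u w : `|det u w| = 1 -> coprime `|u.1| `|u.2|.
Proof.
case: u w => a b [c d]; rewrite /det /= => h.
rewrite -coprimezE; apply/coprimezP.
  case: (ltrgtP (a * d - b * c) 0) => hs.
  - by exists (- d, c) => /=; rewrite ltr0_norm // in h; rewrite -h; ring.
  - by exists (d, - c) => /=; rewrite gtr0_norm // in h; rewrite -h; ring.
  - by rewrite hs in h.
Qed.

Lemma reduced_coprime (s : int) u : coprime `|u.1| `|u.2| -> 0 <= u.2 ->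
  (u.2 = 0 -> u.1 = s) -> exists2 r, proj u = omap ratr r & reduced_expr s r = u.
Proof.
case: u => a b /= cop b0 hs.
have [e|bn] := eqVneq b 0.
  by exists None; rewrite /proj /prj /= e ?eqxx // hs.
exists (Some (a%:~R / b%:~R)).
  rewrite /proj /prj /= intr_eq0 (negbTE bn); congr Some.
  by rewrite rmorphM fmorphV /= !ratr_int.
have bp : 0 < b by rewrite lt_def bn.
rewrite /= coprimeq_num // coprimeq_den // (negbTE bn) gtr0_sg // mul1r.
by rewrite gtr0_norm.
Qed.

Lemma reduced_coprime1 u : coprime `|u.1| `|u.2| ->
  exists2 r, proj u = omap ratr r &
    reduced_expr 1 r = u \/ reduced_expr 1 r = - u.
Proof.
case: u => a b; have H v : coprime `|v.1| `|v.2| -> 0 <= v.2 ->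
    exists2 r, proj v = omap ratr r & reduced_expr 1 r = v \/ reduced_expr 1 r = - v.
  case: v => c d /= cop d0; have [e|dn] := eqVneq d 0.
    exists None; first by rewrite /proj /prj /= e eqxx.
    have : `|c|%N = 1%N by move: cop; rewrite e /coprime gcdn0 => /eqP.
    move=> c1; rewrite e; case: (lerP 0 c) => c0; [left|right].
      by congr pair; lia.
    by apply/eqP; rewrite xpair_eqE /=; apply/andP; split; apply/eqP; lia.
  have [r e1 e2] := @reduced_coprime 1 (c, d) cop d0 (fun e => False_ind _ (elimN eqP dn e)).
  by exists r => //; left.
move=> cop; case: (lerP 0 b) => b0; first exact: H.
have [||r e1 e2] := H (- (a, b)); rewrite /= ?abszN ?oppr_ge0 ?ltW //.
exists r; first by rewrite -e1 proj_opp.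
by case: e2 => ->; [right|left; rewrite opprK].
Qed.

Lemma fareyP (A : set (R -> C)) :
  farey A <-> exists x y, fa x y /\ A = arc x y.
Proof.
split.
  move=> [iA [x [y [jA h]]]]; exists (omap ratr x), (omap ratr y).
  split; last exact: joins_arcE.
  exists (reduced_expr 1 x), (reduced_expr 1 y); split; [|exact: proj_reduced..].
  by move: h; rewrite /det; case: (reduced_expr 1 x) => ? ?; case: (reduced_expr 1 y).
move=> [x [y [f ->]]]; split.
  by apply/ideal_arcP; exists x, y; split=> //; apply: fa_neq.
have xy := fa_neq f.
case: f => u [w [d eu ew]].
have [r er eru] := reduced_coprime1 (det1_coprime d).
have dd : `|det w u| = 1 by rewrite detC normrN.
have [s es esw] := reduced_coprime1 (det1_coprime dd).
exists r, s; split.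
  by apply/joins_arc => //; left; rewrite /rat_pt -er -es eu ew.
case: (reduced_expr 1 r) eru => a b eru; case: (reduced_expr 1 s) esw => c e esw.
have -> : a * e - b * c = det (a, b) (c, e) by [].
by case: eru => ->; case: esw => ->; rewrite ?detNl ?detNr ?normrN.
Qed.

Lemma farey_arc x y : x <> y -> farey (arc x y : set (R -> C)) <-> fa x y.
Proof.
move=> xy; rewrite fareyP; split; last by exists x, y.
by move=> [a [b [f /(arc_inj xy)[] [-> ->]]]] //; apply: faC.
Qed.

Lemma cross_br x y p q : cross x y p q ->
  (br x p * br y q) * (br x q * br y p) < 0.
Proof.
move=> [h1 h2]; have := mulr_gt0 h1 h2.
rewrite (_ : _ * _ = - ((br x p * br y q) * (br x q * br y p)) * (br x y) ^+ 2);
  last by rewrite /br; ring.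
rewrite pmulr_lgt0 ?oppr_gt0 // exprn_even_gt0 //=.
by apply/eqP => /br_eq0 e; move: h1; rewrite e; cyc.
Qed.

(** Plücker relation: [det u w * det u' w'] is the difference of [det u u' * det w w'] and
    [det u w' * det w u']. For crossing chords these integers have opposite signs, so their
    difference has absolute value at least 2, whereas the left-hand side has absolute value 1. *)
Lemma fa_noncross x y p q : fa x y -> fa p q -> ~ cross x y p q.
Proof.
move=> [u [w [/[dup] duw /det1_neq0 nuw eu ew]]].
move=> [u' [w' [/[dup] dpq /det1_neq0 npq eu' ew']]] /cross_br.
have [l l0 [e1 e2]] := proj_ex (det_neq0 nuw).
have nwu : det w u != 0 by rewrite detC oppr_eq0.
have [m m0 [f1 f2]] := proj_ex (det_neq0 nwu).
have [l' l0' [e1' e2']] := proj_ex (det_neq0 npq).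
have nqp : det w' u' != 0 by rewrite detC oppr_eq0.
have [m' m0' [f1' f2']] := proj_ex (det_neq0 nqp).
have dE (a b : int * int) (s t : R) : a.1%:~R = s * hx (proj a) -> a.2%:~R = s * hy (proj a) ->
    b.1%:~R = t * hx (proj b) -> b.2%:~R = t * hy (proj b) ->
    (det a b)%:~R = s * t * br (proj a) (proj b).
  by move=> a1 a2 b1 b2; rewrite /det intrD intrN !intrM a1 a2 b1 b2 /br; ring.
move=> h; have {h} : ((det u u' * det w w') * (det u w' * det w u'))%:~R < 0 :> R.
  rewrite !intrM (dE u u' l l') // (dE w w' m m') // (dE u w' l m') //.
  rewrite (dE w u' m l') // eu ew eu' ew'.
  have -> : l * l' * br x p * (m * m' * br y q) *
    (l * m' * br x q * (m * l' * br y p)) = (l * m * l' * m') ^+ 2 *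
    (br x p * br y q * (br x q * br y p)) by ring.
  by rewrite pmulr_rlt0 // exprn_even_gt0 //= !mulf_neq0.
rewrite ltrz0 => h.
have e : det u w * det u' w' = det u u' * det w w' - det u w' * det w u'.
  by rewrite /det; ring.
have : `|det u w * det u' w'| = 1 by rewrite normrM duw dpq.
rewrite e; move: h; move: (det u u' * det w w') (det u w' * det w u') => X Y.
nia.
Qed.

(** * Unimodular matrices acting on the projective line *)

Definition mob A x : P := prj ((A 0 0)%:~R * hx x + (A 0 1)%:~R * hy x)
  ((A 1 0)%:~R * hx x + (A 1 1)%:~R * hy x).
Definition app A u : int * int :=
  (A 0 0 * u.1 + A 0 1 * u.2, A 1 0 * u.1 + A 1 1 * u.2).
Definition mx2 (a b c d : int) : 'M[int]_2 := \matrix_(i < 2, j < 2)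
  if i == 0 then if j == 0 then a else b else if j == 0 then c else d.

Lemma detE A : \det A = A 0 0 * A 1 1 - A 0 1 * A 1 0.
Proof.
rewrite (expand_det_row _ 0) !big_ord_recl big_ord0 addr0 /cofactor !det_mx11 !mxE.
have -> : lift 0 0 = 1 :> 'I_2 by apply/val_inj.
have -> : lift 1 0 = 0 :> 'I_2 by apply/val_inj.
by rewrite /= expr0 expr1 mul1r mulN1r mulrN.
Qed.

Lemma mx2E (a b c d : int) : [/\ mx2 a b c d 0 0 = a, mx2 a b c d 0 1 = b,
  mx2 a b c d 1 0 = c & mx2 a b c d 1 1 = d].
Proof. by split; rewrite mxE. Qed.

Lemma mobius_mob A (t : R) : mobius A t = mob A (Some t).
Proof. by rewrite /mobius /mob /prj /= !mulr1. Qed.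

Lemma mob_ex A x : \det A = 1 -> exists2 l : R, l != 0 &
  (A 0 0)%:~R * hx x + (A 0 1)%:~R * hy x = l * hx (mob A x) /\
  (A 1 0)%:~R * hx x + (A 1 1)%:~R * hy x = l * hy (mob A x).
Proof.
move=> dA; apply: prj_ex; rewrite -negb_and; apply/negP => /andP[/eqP h1 /eqP h2].
have e : ((A 0 0)%:~R * (A 1 1)%:~R - (A 0 1)%:~R * (A 1 0)%:~R) = 1 :> R.
  by rewrite -!intrM -intrB -detE dA.
have hx0 : hx x = 0.
  rewrite -[hx x]mul1r -e.
  transitivity ((A 1 1)%:~R * ((A 0 0)%:~R * hx x + (A 0 1)%:~R * hy x) -
     (A 0 1)%:~R * ((A 1 0)%:~R * hx x + (A 1 1)%:~R * hy x)); first by ring.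
  by rewrite h1 h2; ring.
have hy0 : hy x = 0.
  rewrite -[hy x]mul1r -e.
  transitivity ((A 0 0)%:~R * ((A 1 0)%:~R * hx x + (A 1 1)%:~R * hy x) -
     (A 1 0)%:~R * ((A 0 0)%:~R * hx x + (A 0 1)%:~R * hy x)); first by ring.
  by rewrite h1 h2; ring.
by have := hxy_neq0 x; rewrite hx0 hy0 eqxx.
Qed.

Lemma mob_prj A (a b : R) : \det A = 1 -> (a != 0) || (b != 0) ->
  mob A (prj a b) =
  prj ((A 0 0)%:~R * a + (A 0 1)%:~R * b) ((A 1 0)%:~R * a + (A 1 1)%:~R * b).
Proof.
move=> dA /prj_ex[l l0 []]; move: (prj a b) => c -> ->.
have [m m0 [f1 f2]] := mob_ex c dA.
rewrite -[LHS](prjK _ (mulf_neq0 l0 m0)) -!mulrA -f1 -f2; congr prj; ring.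
Qed.

Lemma mob_proj A u : \det A = 1 -> (u.1 != 0) || (u.2 != 0) ->
  mob A (proj u) = proj (app A u).
Proof.
move=> dA u0; rewrite /proj mob_prj ?intr_eq0 // /app /=.
by rewrite !intrD !intrM.
Qed.

Lemma app_det A u w : det (app A u) (app A w) = \det A * det u w.
Proof. by rewrite detE /det /app /=; ring. Qed.

Lemma mob_ccw A x y z : \det A = 1 -> ccw (mob A x) (mob A y) (mob A z) <-> ccw x y z.
Proof.
move=> dA; have [l l0 [e1 e2]] := mob_ex x dA; have [m m0 [f1 f2]] := mob_ex y dA.
have [n n0 [g1 g2]] := mob_ex z dA.
have e : ((A 0 0)%:~R * (A 1 1)%:~R - (A 0 1)%:~R * (A 1 0)%:~R) = 1 :> R.
  by rewrite -!intrM -intrB -detE dA.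
rewrite /ccw; set X := br (mob A x) _ * _ * _; set Y := br x y * _ * _.
have -> : Y = (l * m * n) ^+ 2 * X.
  transitivity (((A 0 0)%:~R * (A 1 1)%:~R - (A 0 1)%:~R * (A 1 0)%:~R) ^+ 3 * Y).
    by rewrite e expr1n mul1r.
  transitivity ((l * hx (mob A x) * (m * hy (mob A y)) - l * hy (mob A x) * (m * hx (mob A y)))
   * (m * hx (mob A y) * (n * hy (mob A z)) - m * hy (mob A y) * (n * hx (mob A z)))
   * (n * hx (mob A z) * (l * hy (mob A x)) - n * hy (mob A z) * (l * hx (mob A x)))).
    by rewrite -e1 -e2 -f1 -f2 -g1 -g2 /Y /br; ring.
  by rewrite /X /br; ring.
have h : 0 < (l * m * n) ^+ 2 by rewrite exprn_even_gt0 //= !mulf_neq0.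
by rewrite (pmulr_rgt0 _ h).
Qed.

Definition adj2 A := mx2 (A 1 1) (- A 0 1) (- A 1 0) (A 0 0).

Lemma adj2_det A : \det A = 1 -> \det (adj2 A) = 1.
Proof.
move=> dA; rewrite detE; have [-> -> -> ->] := mx2E (A 1 1) (- A 0 1) (- A 1 0) (A 0 0).
by rewrite -dA detE; ring.
Qed.

Lemma adj2K A x : \det A = 1 -> mob (adj2 A) (mob A x) = x.
Proof.
move=> dA; rewrite [mob A x]/mob mob_prj ?adj2_det //; last first.
  have [l l0 [e1 e2]] := mob_ex x dA; rewrite e1 e2 !mulf_eq0 (negbTE l0) /=.
  exact: hxy_neq0.
have [-> -> -> ->] := mx2E (A 1 1) (- A 0 1) (- A 1 0) (A 0 0).
have e : ((A 0 0)%:~R * (A 1 1)%:~R - (A 0 1)%:~R * (A 1 0)%:~R) = 1 :> R.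
  by rewrite -!intrM -intrB -detE dA.
rewrite -[RHS](prjK _ (oner_neq0 R)); congr prj; rewrite -[in RHS]e intrN; ring.
Qed.

Lemma adj2K' A x : \det A = 1 -> mob A (mob (adj2 A) x) = x.
Proof.
move=> dA; have := adj2K x (adj2_det dA); congr (mob _ _ = _).
apply/matrixP => i j; rewrite mxE.
have [-> -> -> ->] := mx2E (A 1 1) (- A 0 1) (- A 1 0) (A 0 0).
by case: i => -[|[|//]] hi; case: j => -[|[|//]] hj; rewrite /= ?opprK;
  congr (A _ _); apply/val_inj.
Qed.

Lemma mob_inj A : \det A = 1 -> injective (mob A).
Proof. by move=> dA; apply: can_inj (fun x => adj2K x dA). Qed.

Lemma mob_fa A x y : \det A = 1 -> fa x y -> fa (mob A x) (mob A y).
Proof.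
move=> dA [u [w [d <- <-]]]; exists (app A u), (app A w).
have d' : `|det w u| = 1 by rewrite detC normrN.
by rewrite app_det dA mul1r !mob_proj //; apply: det_neq0; apply: det1_neq0; eassumption.
Qed.

Lemma ratp_mob A x : \det A = 1 -> ratp x -> ratp (mob A x).
Proof.
by move=> dA /ratpP[u u0 <-]; rewrite mob_proj //; apply: ratp_proj.
Qed.

(** The matrix is the change between two unimodular bases. A sign change of [u'] makes their
    determinants equal, hence the matrix of determinant 1; the factor [e = det u w] is its own
    inverse. *)
Lemma mob_edge p q p' q' : fa p q -> fa p' q' ->
  exists A, [/\ \det A = 1, mob A p = p' & mob A q = q'].
Proof.
move=> [u [w [d <- <-]]] [u' [w' [d' <- <-]]].
have [u'' [eu'' d'']] : exists u'', proj u'' = proj u' /\ det u'' w' = det u w.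
  case: (eqVneq (det u' w') (det u w)) => [e|ne]; first by exists u'.
  exists (- u'); rewrite proj_opp; split=> //.
  have -> : det (- u') w' = - det u' w' by rewrite /det /=; ring.
  by move: d d' ne; move: (det u w) (det u' w') => X Y; lia.
have dd : det u w * det u w = 1 by move: d; move: (det u w) => X; nia.
pose e := det u w.
pose A := mx2 (e * (u''.1 * w.2 - w'.1 * u.2)) (e * (w'.1 * u.1 - u''.1 * w.1))
              (e * (u''.2 * w.2 - w'.2 * u.2)) (e * (w'.2 * u.1 - u''.2 * w.1)).
have [A0 A1 A2 A3] := mx2E (e * (u''.1 * w.2 - w'.1 * u.2)) (e * (w'.1 * u.1 - u''.1 * w.1))
              (e * (u''.2 * w.2 - w'.2 * u.2)) (e * (w'.2 * u.1 - u''.2 * w.1)).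
have dA : \det A = 1.
  rewrite detE /A A0 A1 A2 A3.
  transitivity (e * e * (det u w * det u'' w')); first by rewrite /det; ring.
  by rewrite d'' /e dd mulr1.
have dwu : `|det w u| = 1 by rewrite detC normrN.
have u0 := det_neq0 (det1_neq0 d); have w0 := det_neq0 (det1_neq0 dwu).
exists A; rewrite -eu'' !mob_proj //; split=> //.
  congr proj; rewrite /app /A A0 A1 A2 A3 [RHS]surjective_pairing; congr pair.
    by transitivity (e * det u w * u''.1); [rewrite /det; ring|rewrite dd mul1r].
  by transitivity (e * det u w * u''.2); [rewrite /det; ring|rewrite dd mul1r].
congr proj; rewrite /app /A A0 A1 A2 A3 [RHS]surjective_pairing; congr pair.
  by transitivity (e * det u w * w'.1); [rewrite /det; ring|rewrite dd mul1r].
by transitivity (e * det u w * w'.2); [rewrite /det; ring|rewrite dd mul1r].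
Qed.

Definition ints (M : nat) : seq int := [seq k%:Z - M%:Z | k <- iota 0 M.*2.+1].

Lemma intsP (M : nat) (k : int) : `|k| <= M%:Z -> k \in ints M.
Proof.
move=> h; apply/mapP; exists (absz (k + M%:Z)); last by lia.
by rewrite mem_iota; lia.
Qed.

Definition box (M : nat) : seq (int * int) := [seq (a, b) | a : int <- ints M, b : int <- ints M].

Lemma boxP (M : nat) u : `|u.1| <= M%:Z -> `|u.2| <= M%:Z -> u \in box M.
Proof.
move=> h1 h2; apply/allpairsP; exists u; rewrite !intsP //; split=> //.
exact: surjective_pairing.
Qed.

(** This is [cayley_dist] in integer coordinates, where the bracket becomes a determinant equal to 1
    or -1. Large vectors give short chords, the source of all finiteness results on Farey edges near
    the centre. *)
Lemma fa_dist x y : fa x y -> exists u w, [/\ `|det u w| = 1, proj u = x, proj w = y &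
  nsq (mu x - mu y) * ((nv u)%:~R * (nv w)%:~R) = 4].
Proof.
move=> [u [w [d eu ew]]]; exists u, w; split=> //.
have [l [m [l0 m0 e1 e2 e3]]] := det_br (det1_neq0 d).
rewrite cayley_dist e2 e3 -eu -ew.
have n1 := lt0r_neq0 (sqn_gt0 (proj u)); have n2 := lt0r_neq0 (sqn_gt0 (proj w)).
transitivity (4 * (l * m * br (proj u) (proj w)) ^+ 2); first by field; rewrite n1 n2.
have dd : det u w * det u w = 1 by move: d; move: (det u w) => X; nia.
by rewrite -e1 expr2 -intrM dd mulr1.
Qed.

End Farey.

(** * Combinatorial description of tessellations *)

Lemma mem_In (T : eqType) (x : T) s : x \in s -> List.In x s.
Proof.
elim: s => // y s IH; rewrite inE => /orP[/eqP ->|/IH h]; [by left|by right].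
Qed.

Lemma finite_list {T : Type} (S : set T) : finite_set S ->
  exists s : seq T, forall x, S x -> List.In x s.
Proof.
by move=> /(@finite_seqP {classic T})[s ->]; exists s => x /mem_In.
Qed.

Lemma count_lt {T : Type} (a b : pred T) s x : List.In x s ->
  (forall y, a y -> b y) -> ~~ a x -> b x -> (count a s < count b s)%N.
Proof.
move=> xs ab ax bx.
have le1 y : (a y <= b y)%N by case e: (a y) => //; rewrite (ab _ e).
have le s' : (count a s' <= count b s')%N.
  by elim: s' => //= y s' IH; apply: leq_add.
elim: s xs => // y s IH /= [->|/IH h]; first by rewrite (negbTE ax) bx add0n add1n ltnS.
by rewrite -addnS leq_add.
Qed.

Lemma finite_sub_list {T U : Type} (S : set T) (s : seq U) (f : U -> T) :
  (forall x, S x -> exists2 u, List.In u s & f u = x) -> finite_set S.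
Proof.
move=> h; apply: (@sub_finite_set _ _ (f @` [set u | List.In u s])).
  by move=> x /h[u us <-]; exists u.
apply: finite_image; elim: s {h} => [|u s IH].
  by rewrite (_ : [set _ | _] = set0) //; apply/seteqP.
rewrite (_ : [set _ | _] = [set u] `|` [set v | List.In v s]).
  by rewrite finite_setU; split=> //; apply: finite_set1.
by apply/seteqP; split=> v [->|?]; by [left|right].
Qed.

Section ClosedArcs.
Context {R : realType}.
Implicit Types p q r x : option R.

Lemma cl_l p q : cl p q p. Proof. by left. Qed.
Lemma cl_r p q : cl p q q. Proof. by right; left. Qed.
Lemma cl_left p r q x : ccw p r q -> cl p r x -> cl p q x. Proof. cyc. Qed.
Lemma cl_right p r q x : ccw p r q -> cl r q x -> cl p q x. Proof. cyc. Qed.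
Lemma cl_nleft p r q : ccw p r q -> ~ cl p r q. Proof. cyc. Qed.
Lemma cl_nright p r q : ccw p r q -> ~ cl r q p. Proof. cyc. Qed.
Lemma cl_out_left p r q x : ccw p r q -> cl q p x -> cl r p x. Proof. cyc. Qed.
Lemma cl_out_right p r q x : ccw p r q -> cl q p x -> cl q r x. Proof. cyc. Qed.
Lemma cl_cases p q x : p <> q -> cl p q x \/ cl q p x.
Proof. by move=> pq; case: (pselect (cl p q x)); [left|right; cyc]. Qed.
End ClosedArcs.

Section CTess.
Context {R : realType}.
Local Notation C := (plane R).
Local Notation P := (option R).
Local Notation mu := (@cayley R).
Implicit Types (x y z p q r a b : P) (w : C) (tau : set (set (R -> C))) (rho : R).

(** The properties of a tessellation that circle maps transport. The apex condition, read for [x y]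
    and for [y x], provides a triangle on each side of an edge. The covering of the disc, the
    disjointness of the triangles and local finiteness are recovered in [ctess_tess]. *)
Definition ctess tau := [/\
  forall A, tau A -> exists x y, [/\ x <> y, ratp x, ratp y & A = arc x y],
  forall x y a b, E tau x y -> E tau a b -> ~ cross x y a b,
  forall x y, E tau x y -> exists z, [/\ ccw x z y, E tau x z & E tau z y],
  forall x, ratp x -> exists y, E tau x y
  & finite_set (tau `\` farey)].

Lemma tess_ctess tau : tessellation tau -> ctess tau.
Proof.
move=> tt; have [[tI _ _] _ _ tV tF] := tt; split=> //.
- move=> A tA; have [x [y [xy eA]]] := (ideal_arcP A).1 (tI _ tA).
  have rV a b : a <> b -> A = arc a b -> ratp a.
    move=> ab eab; have : range rat_pt (mu a).
      rewrite -tV; exists A, (mu b); split=> //.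
      by rewrite eab; apply/joins_arc => //; left.
    by move=> [r _ /cayley_inj <-]; exists r.
  exists x, y; split=> //; first exact: rV eA.
  by apply: (rV y x) => [e|]; [apply: xy|rewrite arcC].
- by move=> x y a b Exy Eab; apply: tess_noncross Exy Eab.
- by move=> x y; apply: tess_apex.
- move=> x [r ex].
  have : [set p | exists A (q : C), tau A /\ joins A p q] (mu x).
    by rewrite tV; exists r => //; rewrite /rat_pt -ex.
  move=> [A [q [tA jA]]].
  have [a [b [ab eA]]] := (ideal_arcP A).1 (tI _ tA).
  move: jA; rewrite eA => /joins_arc-/(_ ab)[] [/cayley_inj -> _].
    by exists b; rewrite /E -eA.
  by exists a; rewrite /E arcC -eA.
Qed.

Lemma ctess_ideal tau : ctess tau -> tau `<=` ideal_arc.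
Proof.
move=> [tA _ _ _ _] A /tA[x [y [xy _ _ ->]]].
by apply/ideal_arcP; exists x, y.
Qed.

Lemma ctess_neq tau x y : ctess tau -> E tau x y -> x <> y.
Proof. by move=> /ctess_ideal; apply: E_neq. Qed.

Definition meets rho x y := exists2 w, onch x y w & nsq w <= rho.

(** A chord meeting the disc of squared radius [rho] has squared length at least [4 (1 - rho)]. By
    [fa_dist], the squared norms of its integer vectors then have product at most [1 / (1 - rho)],
    which leaves finitely many vectors. *)
Lemma farey_meets_finite rho : rho < 1 ->
  finite_set [set A | exists x y, [/\ fa x y, A = arc x y & meets rho x y]].
Proof.
move=> r1; have h : 0 < (1 - rho)^-1 by rewrite invr_gt0 subr_gt0.
pose M := Num.bound (1 - rho)^-1; have hM := archi_boundP (ltW h).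
apply: (@finite_sub_list _ _ _ [seq (u, v) | u <- box M, v <- box M]
  (fun uv : (int * int) * (int * int) => arc (proj uv.1) (proj uv.2))).
move=> A [x [y [f -> [w ow nw]]]].
have [u [v [d eu ev e4]]] := fa_dist f.
exists (u, v); last by rewrite /= eu ev.
have xy := fa_neq f.
have [t ht ew] : exists2 t, 0 < t < 1 & w = lin t (mu x) (mu y).
  by apply/chord_arc/chordE.
have nu0 : 0 <= nv u by rewrite /nv; nia.
have nv0 : 0 <= nv v by rewrite /nv; nia.
have nc (z : P) : nsq (mu z) = 1 by apply/circleE; apply: cayley_circle.
have hd : 4 * (1 - rho) <= nsq (mu x - mu y).
  move: nw; rewrite ew nsq_lin !nc.
  have := nsq_ge0 (mu x - mu y); case/andP: ht => t0 t1.
  have : t * (1 - t) <= 1 / 4 by have := sqr_ge0 (t - 1 / 2); lra.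
  by move=> h4 n0; have := ler_wpM2r n0 h4; lra.
have hN : (nv u * nv v)%:~R * (1 - rho) <= 1 :> R.
  have hn : 0 <= (nv u * nv v)%:~R :> R by rewrite ler0z mulr_ge0.
  have := ler_wpM2l hn hd; rewrite [X in _ <= X]mulrC intrM e4.
  by rewrite -intrM; lra.
have hN2 : nv u * nv v <= M%:Z.
  rewrite -(ler_int R); apply: ltW; apply: le_lt_trans hM.
  by rewrite -[X in _ <= X]mul1r ler_pdivlMr // subr_gt0.
have [nu nv'] : 1 <= nv u /\ 1 <= nv v.
  have du := det_neq0 (det1_neq0 d).
  have dw : (v.1 != 0) || (v.2 != 0).
    by apply: (@det_neq0 v u); rewrite detC oppr_eq0 det1_neq0.
  by rewrite /nv; split; nia.
have [hu hv] : nv u <= M%:Z /\ nv v <= M%:Z by split; nia.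
have nvb (a : int * int) : nv a <= M%:Z -> a \in box M.
  rewrite /nv => h'; apply: boxP; have := sqr_ge0 a.1; have := sqr_ge0 a.2;
    rewrite !expr2 in h' *; nia.
by apply: mem_In; apply/allpairsP; exists (u, v); split=> //; apply: nvb.
Qed.

Lemma meets_finite tau rho : finite_set (tau `\` farey) -> rho < 1 ->
  finite_set [set A | tau A /\ exists x y, A = arc x y /\ meets rho x y].
Proof.
move=> fF r1; have h := farey_meets_finite r1.
apply: (@sub_finite_set _ _ ((tau `\` farey) `|`
   [set A | exists x y, [/\ fa x y, A = arc x y & meets rho x y]])).
  move=> A [tA [x [y [eA m]]]]; case: (pselect (farey A)) => fA; last by left.
  right; exists x, y; split=> //.
  have xy : x <> y by case: fA; rewrite eA => /ideal_arc_neq.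
  by apply/farey_arc => //; rewrite -eA.
by rewrite finite_setU.
Qed.

Lemma onch_cl p q x y w : p <> q -> onch x y w -> x <> y -> cl p q x -> cl p q y ->
  orient (mu p) (mu q) w <= 0.
Proof.
move=> pq xyw xy.
have [t /andP[t0 t1] ->] : exists2 t, 0 < t < 1 & w = lin t (mu x) (mu y).
  by apply/chord_arc/chordE.
have side a : cl p q a -> orient (mu p) (mu q) (mu a) <= 0.
  move=> [->|[->|/orient_lt0/ltW //]]; first by rewrite /orient; lra.
  by rewrite /orient; lra.
by move=> /side hx /side hy; rewrite orient_lin; nra.
Qed.

(** The segment from [w] to [v] crosses the line [p q] and stays in the smaller disc by
    convexity. *)
Lemma meets_sep rho p q w v : p <> q -> rho < 1 -> nsq w <= rho -> nsq v <= rho ->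
  orient (mu p) (mu q) w <= 0 -> 0 <= orient (mu p) (mu q) v -> meets rho p q.
Proof.
move=> pq r1 nw nv ow ov.
have [t ht ot] : exists2 t, 0 <= t <= 1 & orient (mu p) (mu q) (lin t w v) = 0.
  have [e|ne] := eqVneq (orient (mu p) (mu q) w) 0.
    by exists 0; [lra|rewrite orient_lin e; ring].
  have den : 0 < orient (mu p) (mu q) v - orient (mu p) (mu q) w.
    by move/eqP: ne => ne; lra.
  exists (- orient (mu p) (mu q) w / (orient (mu p) (mu q) v - orient (mu p) (mu q) w)).
    by rewrite divr_ge0 ?ler_pdivrMr ?mul1r //; lra.
  by rewrite orient_lin; field; apply: lt0r_neq0.
exists (lin t w v); last exact: nsq_lin_le.
split=> //; apply/discE; apply: le_lt_trans r1; exact: nsq_lin_le.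
Qed.

Lemma meets_sep_edges rho p q x y a b : p <> q -> rho < 1 ->
  x <> y -> a <> b -> meets rho x y -> meets rho a b ->
  cl p q x -> cl p q y -> cl q p a -> cl q p b -> meets rho p q.
Proof.
move=> pq r1 xy ab [w xyw nw] [v abv nv] px py qa qb.
apply: (meets_sep pq r1 nw nv); first exact: onch_cl px py.
have := onch_cl (fun e => pq (esym e)) abv ab qa qb.
by rewrite orient_swap; lra.
Qed.

(* Induction on the number of edges of the arc from [p] to [q] that meet the
   disc of squared radius [rho]. *)
Lemma descent tau rho p0 q0 (Q : P -> P -> Prop) : ctess tau -> rho < 1 ->
  (forall p q, E tau p q -> cl q p p0 -> cl q p q0 -> ~ meets rho p q -> Q p q) ->
  (forall p r q, E tau p q -> cl q p p0 -> cl q p q0 ->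
    ccw p r q -> E tau p r -> E tau r q -> Q p r -> Q r q -> Q p q) ->
  forall p q, E tau p q -> cl q p p0 -> cl q p q0 -> Q p q.
Proof.
move=> ct r1 base step.
have [_ _ apex _ fF] := ct.
have [L hL] := finite_list (meets_finite fF r1).
pose inarc p q (A : set (R -> C)) :=
  `[< exists x y, [/\ x <> y, A = arc x y, cl p q x & cl p q y] >].
suff H n p q : (count (inarc p q) L < n)%N -> E tau p q -> cl q p p0 ->
    cl q p q0 -> Q p q by move=> p q; apply: H.
elim: n p q => // n IH p q; rewrite ltnS => cn Epq qp0 qq0.
have [m|m] := pselect (meets rho p q); last exact: base.
have [r [prq Epr Erq]] := apex _ _ Epq.
have pq := ctess_neq ct Epq.
have inL : List.In (arc p q) L by apply: hL; split=> //; exists p, q.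
apply: (step p r q) => //.
  apply: IH => //; try exact: cl_out_left prq _.
  (* The edge [p q] is counted for the arc from [p] to [q], but not for its part from [p] to [r]. *)
  apply: leq_trans cn; apply: count_lt inL _ _ _.
  - move=> A /asboolP[x [y [xy -> h1 h2]]]; apply/asboolP; exists x, y.
    by split=> //; apply: cl_left prq _.
  - apply/negP => /asboolP[x [y [xy e h1 h2]]]; apply: (cl_nleft prq).
    by case: (arc_inj pq e) => -[ex ey]; rewrite ey.
  - by apply/asboolP; exists p, q; split=> //; [apply: cl_l|apply: cl_r].
apply: IH => //; try exact: cl_out_right prq _.
apply: leq_trans cn; apply: count_lt inL _ _ _.
- move=> A /asboolP[x [y [xy -> h1 h2]]]; apply/asboolP; exists x, y.
  by split=> //; apply: cl_right prq _.
- apply/negP => /asboolP[x [y [xy e h1 h2]]]; apply: (cl_nright prq).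
  by case: (arc_inj pq e) => -[ex ey]; rewrite ex.
- by apply/asboolP; exists p, q; split=> //; [apply: cl_l|apply: cl_r].
Qed.

(** As it crosses no side, an edge through [w] has no end strictly beyond a side, so both its ends
    are vertices and it is a side; but [w] is strictly to the left of each side. *)
Lemma inT_noncross tau p q r a b w :
  (forall x y a b, E tau x y -> E tau a b -> ~ cross x y a b) ->
  ccw p q r -> E tau p q -> E tau q r -> E tau r p -> inT p q r w ->
  a <> b -> E tau a b -> ~ onch a b w.
Proof.
move=> nc pqr Epq Eqr Erp /(inTE _ pqr)[ o1 o2 o3] ab Eab abw.
have [t /andP[t0 t1] ew] : exists2 t, 0 < t < 1 & w = lin t (mu a) (mu b).
  by apply/chord_arc/chordE.
have side x y : E tau x y -> 0 < orient (mu x) (mu y) w ->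
    ~ ccw x a y /\ ~ ccw x b y.
  move=> Exy o; have t1' : 0 < 1 - t by lra.
  split=> h; move/orient_lt0: (h) => ho.
    apply: (nc _ _ _ _ Exy Eab); split=> //; apply: ccw_rot; apply/orient_gt0.
    have : (1 - t) * orient (mu x) (mu y) (mu a) < 0 by rewrite pmulr_rlt0.
    by rewrite -(pmulr_rgt0 _ t0); move: o; rewrite ew orient_lin; lra.
  apply: (nc _ _ _ _ Exy (EC Eab)); split=> //; apply: ccw_rot; apply/orient_gt0.
  have : t * orient (mu x) (mu y) (mu b) < 0 by rewrite pmulr_rlt0.
  by rewrite -(pmulr_rgt0 _ t1'); move: o; rewrite ew orient_lin; lra.
have [pa pb] := side _ _ Epq o1; have [qa qb] := side _ _ Eqr o2.
have [ra rb] := side _ _ Erp o3.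
have ma : mem3 a p q r.
  apply: contrapT => h; have [h1 h2 h3] : [/\ a <> p, a <> q & a <> r].
    by split=> e; apply: h; rewrite e; [apply: Or31|apply: Or32|apply: Or33].
  by cyc.
have mb : mem3 b p q r.
  apply: contrapT => h; have [h1 h2 h3] : [/\ b <> p, b <> q & b <> r].
    by split=> e; apply: h; rewrite e; [apply: Or31|apply: Or32|apply: Or33].
  by cyc.
have [_ ow] := abw.
case: ma mb => ea [] eb; move: ow ab; rewrite ea eb // => ow _.
all: rewrite ?(orient_swap (mu p) (mu q)) ?(orient_swap (mu q) (mu r))
  ?(orient_swap (mu r) (mu p)) in ow; lra.
Qed.

Lemma ctess_triangle tau p q r : ctess tau -> ccw p q r ->
  E tau p q -> E tau q r -> E tau r p -> triangles tau (tri p q r).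
Proof.
move=> ct pqr Epq Eqr Erp; have [tA nc _ _ _] := ct; split.
- by apply/ideal_triangleP; exists p, q, r.
- by move=> A [->|[->|->]].
apply/seteqP; split=> // w [/region_tri-/(_ (ccw_neq pqr)) Tw [A tauA]].
have [x [y [xy _ _ eA]]] := tA _ tauA.
rewrite eA => /chordE-/(_ xy); apply: (inT_noncross nc pqr Epq Eqr Erp Tw xy).
by rewrite /E -eA.
Qed.

Lemma half01 : 0 < (1 / 2 : R) < 1.
Proof. by lra. Qed.

(** Starting from any edge, move towards [w] through apexes: beyond an edge, [w] is in the next
    triangle or beyond one of its two other sides. The descent cannot end before, since an edge
    missing a disc that contains [w] and a point of the starting edge does not separate them. *)
Lemma ctess_cover tau w : ctess tau -> disc w -> ~ edge_support tau w ->
  exists2 T, triangles tau T & region T w.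
Proof.
move=> ct dw nw; have [_ nc _ tV _] := ct.
have [q0 E0] : exists y, E tau None y by apply: tV; exists None.
set p0 := None in E0; have pq0 := ctess_neq ct E0.
pose w0 := lin (1 / 2) (mu p0) (mu q0).
have ow0 : onch p0 q0 w0 by split; [exact: lin_disc half01|exact: orient_chord].
pose rho := Num.max (nsq w) (nsq w0).
have r1 : rho < 1 by rewrite gt_max; apply/andP; split; apply/discE => //; case: ow0.
have nw1 : nsq w <= rho by rewrite le_max lexx.
have nw2 : nsq w0 <= rho by rewrite le_max lexx orbT.
have nz p q : E tau p q -> orient (mu p) (mu q) w <> 0.
  move=> Epq o; apply: nw; exists (arc p q) => //; apply/chordE => //.
  exact: ctess_neq Epq.
have key p q : E tau p q -> cl q p p0 -> cl q p q0 ->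
    orient (mu p) (mu q) w < 0 -> exists2 T, triangles tau T & region T w.
  move: p q; apply: (descent ct r1) => [p q Epq h1 h2 nm ow|p r q Epq h1 h2 prq Epr Erq Q1 Q2 ow].
    have pq := ctess_neq ct Epq.
    case: nm; apply: (meets_sep pq r1 nw1 nw2 (ltW ow)).
    have := onch_cl (fun e => pq (esym e)) ow0 pq0 h1 h2.
    by rewrite orient_swap; lra.
  case: (ltrgtP (orient (mu p) (mu r) w) 0) => o1; [exact: Q1| |by case: (nz _ _ Epr)].
  case: (ltrgtP (orient (mu r) (mu q) w) 0) => o2; [exact: Q2| |by case: (nz _ _ Erq)].
  exists (tri p r q); first by apply: ctess_triangle => //; apply: EC.
  apply/region_tri; first exact: ccw_neq.
  apply/inTE => //; split=> //; rewrite orient_swap; lra.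
case: (ltrgtP (orient (mu p0) (mu q0) w) 0) => o; last by case: (nz _ _ E0).
  by apply: (key p0 q0) => //; cyc.
apply: (key q0 p0) => //; [exact: EC|cyc|cyc|].
by rewrite orient_swap; lra.
Qed.

Lemma ctess_locally_finite tau : ctess tau -> locally_finite tau.
Proof.
move=> ct w dw; have [tA _ _ _ fF] := ct.
pose rho := (nsq w + 1) / 2.
have [wr r1] : nsq w < rho /\ rho < 1.
  by have /discE := dw; rewrite /rho; split; lra.
exists [set v | nsq v < rho].
  exact: near_nsq.
apply: sub_finite_set (meets_finite fF r1) => A [tauA [v [cv nv]]]; split=> //.
have [x [y [xy _ _ eA]]] := tA _ tauA; exists x, y; split=> //.
by exists v; [apply/chordE; rewrite -?eA|apply: ltW].
Qed.

Lemma ctess_countable tau : ctess tau -> countable tau.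
Proof.
move=> [tA _ _ _ _].
apply: (@sub_countable _ _ _ ((fun rs : option rat * option rat =>
   arc (omap ratr rs.1) (omap ratr rs.2) : set (R -> C)) @` setT)).
  apply: subset_card_le => A /tA[x [y [_ [r ->] [s ->] ->]]].
  by exists (r, s).
apply: sub_countable (card_image_le _ _) _; exact: countableP.
Qed.

(** If two triangles share [w], no vertex of the one lies strictly beyond a side of the other: the
    segment from [w] to this vertex would meet that side inside the first triangle. So the vertices
    agree. *)
Lemma ctess_trivIset tau : ctess tau -> trivIset (triangles tau) region.
Proof.
move=> ct T T' tT tT' [w [Tw Tw']].
have [p [q [r [pqr eT tT1]]]] := trianglesP tT.
have [p' [q' [r' [pqr' eT' tT1']]]] := trianglesP tT'.
have {}Tw : inT p q r w by apply/region_tri; [exact: ccw_neq|rewrite -eT].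
have {}Tw' : inT p' q' r' w by apply/region_tri; [exact: ccw_neq|rewrite -eT'].
have [ o1 o2 o3] := (inTE _ pqr).1 Tw.
have [Epq Eqr Erp] := triangle_edges tT1.
have key x y a b c : E tau x y -> 0 < orient (mu x) (mu y) w ->
    ccw a b c -> triangles tau (tri a b c) -> inT a b c w -> ~ ccw x a y.
  move=> Exy oxy abc tabc /(inTE _ abc)[oab obc oca] /orient_lt0 oa.
  have xy := ctess_neq ct Exy.
  pose t := orient (mu x) (mu y) w / (orient (mu x) (mu y) w - orient (mu x) (mu y) (mu a)).
  have den : 0 < orient (mu x) (mu y) w - orient (mu x) (mu y) (mu a) by lra.
  have /andP[t0 t1] : 0 < t < 1 by rewrite /t divr_gt0 ?ltr_pdivrMr ?mul1r //; lra.
  have Tv : inT a b c (lin t w (mu a)).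
    have ot : 0 < 1 - t by lra.
    have oabc : 0 < orient (mu a) (mu b) (mu c) by apply/orient_gt0.
    apply/inTE => //; rewrite !orient_lin; split.
    - have -> : orient (mu a) (mu b) (mu a) = 0 by rewrite /orient; ring.
      by rewrite mulr0 addr0 mulr_gt0.
    - have obca : 0 < orient (mu b) (mu c) (mu a) by rewrite orient_rot.
      by apply: addr_gt0; apply: mulr_gt0.
    - have -> : orient (mu c) (mu a) (mu a) = 0 by rewrite /orient; ring.
      by rewrite mulr0 addr0 mulr_gt0.
  have [_ _] := tabc; rewrite -subset0 => /(_ (lin t w (mu a))); apply; split.
    by apply/region_tri => //; apply: ccw_neq.
  exists (arc x y) => //; apply/chordE => //; split; first exact: inT_disc Tv.
  by rewrite orient_lin /t; field; apply: lt0r_neq0.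
have vert a b c : ccw a b c -> triangles tau (tri a b c) -> inT a b c w -> mem3 a p q r.
  move=> abc tabc Tabc; apply: contrapT => h.
  have [h1 h2 h3] : [/\ a <> p, a <> q & a <> r].
    by split=> e; apply: h; rewrite e; [apply: Or31|apply: Or32|apply: Or33].
  have k1 := key _ _ _ _ _ Epq o1 abc tabc Tabc.
  have k2 := key _ _ _ _ _ Eqr o2 abc tabc Tabc.
  have k3 := key _ _ _ _ _ Erp o3 abc tabc Tabc.
  by clear -pqr h1 h2 h3 k1 k2 k3; cyc.
rewrite eT eT'; apply/esym/tri_perm; first exact: ccw_neq.
- exact: vert tT1' Tw'.
- apply: (vert q' r' p'); [exact: ccw_rot|by rewrite tri_rot|exact: inT_rot].
- apply: (vert r' p' q'); [by do 2!apply: ccw_rot|by rewrite 2!tri_rot|].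
  by do 2!apply: inT_rot.
Qed.

Lemma ctess_tess tau : ctess tau -> tessellation tau.
Proof.
move=> ct; have [tA nc apex tV tF] := ct; split=> //.
- split; [exact: ctess_ideal|exact: ctess_countable|exact: ctess_locally_finite].
- apply/seteqP; split=> w.
    by move=> [dw nw]; have [T tT Tw] := ctess_cover ct dw nw; exists T.
  move=> [T tT Tw]; split.
    have [p [q [r [pqr eT _]]]] := trianglesP tT.
    apply: (inT_disc pqr); apply/region_tri; first exact: ccw_neq.
    by rewrite -eT.
  by move=> sw; have [_ _] := tT; rewrite -subset0 => /(_ w); apply.
- exact: ctess_trivIset.
- apply/seteqP; split=> v.
    move=> [A [q [tauA]]]; have [x [y [xy [r er] [s es] ->]]] := tA _ tauA.
    by move=> /joins_arc-/(_ xy)[] [-> _]; [exists r|exists s];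
      rewrite // /rat_pt -?er -?es.
  move=> [r _ <-]; have [y Ey] := tV (omap ratr r) (ex_intro _ r erefl).
  exists (arc (omap ratr r) y), (mu y); split=> //.
  by apply/joins_arc; [exact: ctess_neq Ey|left].
Qed.

(** The midpoint of the chord lies on an edge or in a triangle. Since [x y] crosses no edge, [x] and
    [y] are the ends of that edge or two vertices of that triangle. *)
Lemma ctess_max tau x y : ctess tau -> x <> y ->
  (forall a b, E tau a b -> ~ cross a b x y) -> E tau x y.
Proof.
move=> ct xy ncr; pose w := lin (1 / 2) (mu x) (mu y).
have xyw : onch x y w by split; [exact: lin_disc half01|exact: orient_chord].
have [dw ow] := xyw.
have ew : w = lin (1 / 2) (mu x) (mu y) by [].
have cr a b : E tau a b -> orient (mu a) (mu b) w = 0 \/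
    0 < orient (mu a) (mu b) w -> ~ ccw a x b /\ ~ ccw a y b.
  move=> Eab ob; split=> h; move/orient_lt0: (h) => ho.
    apply: (ncr _ _ Eab); split=> //; apply: ccw_rot; apply/orient_gt0.
    by move: ob; rewrite ew orient_lin; lra.
  apply: (ncr _ _ (EC Eab)); split; last exact: h.
  apply: ccw_rot; apply/orient_gt0.
  by move: ob; rewrite ew orient_lin; lra.
have [[A tauA cA]|nw] := pselect (edge_support tau w).
  have [tA _ _ _ _] := ct; have [a [b [ab _ _ eA]]] := tA _ tauA.
  have Eab : E tau a b by rewrite /E -eA.
  have [_ oab] : onch a b w by apply/chordE; rewrite -?eA.
  have [ax ay] := cr _ _ Eab (or_introl oab).
  have oba : orient (mu b) (mu a) w = 0 by rewrite orient_swap oab oppr0.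
  have [bx by'] := cr _ _ (EC Eab) (or_introl oba).
  have hx : x = a \/ x = b by clear -ab ax bx; cyc.
  have hy : y = a \/ y = b by clear -ab ay by'; cyc.
  case: hx hy xy => -> [] -> // _; exact: EC.
have [T tT Tw] := ctess_cover ct dw nw.
have [p [q [r [pqr eT tT1]]]] := trianglesP tT.
have [Epq Eqr Erp] := triangle_edges tT1.
have [ o1 o2 o3] := (inTE _ pqr).1 ((region_tri _ (ccw_neq pqr)).1 (eq_ind _ (fun U => region U w) Tw _ eT)).
have [ax ay] := cr _ _ Epq (or_intror o1).
have [bx by'] := cr _ _ Eqr (or_intror o2).
have [cx cy] := cr _ _ Erp (or_intror o3).
have hx : x = p \/ x = q \/ x = r by clear -ax bx cx pqr; cyc.
have hy : y = p \/ y = q \/ y = r by clear -ay by' cy pqr; cyc.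
by case: hx hy xy => [->|[->|->]] [->|[->|->]] // _; apply: EC.
Qed.

End CTess.

(** * Piecewise projective circle maps *)

Section CircleMaps.
Context {R : realType}.
Local Notation C := (plane R).
Local Notation P := (option R).
Local Notation mu := (@cayley R).
Implicit Types (x y z p q r : P) (f g : P -> P) (u v w : int * int).

Definition ccw_mono f := forall x y z, ccw x y z -> ccw (f x) (f y) (f z).
Definition surj f := forall y, exists x, f x = y.

Lemma exists_ccw x y : x <> y -> exists t : R, ccw x (Some t) y.
Proof.
have L (t u : R) : t < u -> ltp (Some t) (Some u) by rewrite /ltp lp_mono.
have Linf (t : R) : ltp (Some t) None by rewrite /ltp lp_lt1.
case: x y => [x|] [y|] xy //.
- case: (ltrgtP x y) => h; last by case: xy; rewrite h.
    exists ((x + y) / 2); have := L x ((x + y) / 2) _; have := L ((x + y) / 2) y _.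
    by move=> h1 h2; have {}h1 := h1 ltac:(lra); have {}h2 := h2 ltac:(lra); cyc.
  exists (x + 1); have h1 := L y x h; have h2 := L x (x + 1) ltac:(lra).
  by clear -h1 h2; cyc.
- exists (x + 1); have h1 := Linf (x + 1); have h2 := L x (x + 1) ltac:(lra).
  by clear -h1 h2; cyc.
- exists (y - 1); have h1 := Linf y; have h2 := L (y - 1) y ltac:(lra).
  by clear -h1 h2; cyc.
Qed.

Lemma ccw_mono_inj f : ccw_mono f -> injective f.
Proof.
move=> mf x y e; apply: contrapT => /exists_ccw[t h].
by have := mf _ _ _ h; rewrite e; cyc.
Qed.

Lemma ccw_reflect f x y z : ccw_mono f -> ccw (f x) (f y) (f z) -> ccw x y z.
Proof.
move=> mf h; have [h1 h2 h3] := ccw_neq h.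
have [//|h'] : ccw x y z \/ ccw x z y.
  by apply: ccw_total => e; [apply: h1|apply: h2|apply: h3]; rewrite e.
by have := mf _ _ _ h'; cyc.
Qed.

Lemma mob_mono (A : 'M[int]_2) : \det A = 1 -> ccw_mono (mob A : P -> P).
Proof. by move=> dA x y z h; apply/mob_ccw. Qed.

Lemma mob_surj (A : 'M[int]_2) : \det A = 1 -> surj (mob A : P -> P).
Proof. by move=> dA y; exists (mob (adj2 A) y); apply: adj2K'. Qed.

Lemma eq_on_cl f g (b c : P) : ccw_mono f -> surj f -> ccw_mono g -> surj g -> b <> c ->
  (forall x, ccw b x c -> f x = g x) -> f b = g b /\ f c = g c.
Proof.
have aux (h k : P -> P) t0 : ccw_mono h -> surj h -> ccw_mono k ->
    (forall x, ccw b x c -> h x = k x) -> ccw b t0 c ->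
    ~ ccw (h b) (k b) (h t0) /\ ~ ccw (h t0) (k c) (h c).
  move=> mh sh mk e h0; split=> hc.
    have [s es] := sh (k b); rewrite -es in hc.
    have hs := ccw_reflect mh hc; have hs' : ccw b s c by clear -hs h0; cyc.
    move: es; rewrite e // => /(ccw_mono_inj mk) es.
    by move: hs; rewrite es; cyc.
  have [s es] := sh (k c); rewrite -es in hc.
  have hs := ccw_reflect mh hc; have hs' : ccw b s c by clear -hs h0; cyc.
  move: es; rewrite e // => /(ccw_mono_inj mk) es.
  by move: hs; rewrite es; cyc.
move=> mf sf mg sg bc e; have [t h] := exists_ccw bc.
have [f1 f2] := aux f g _ mf sf mg e h.
have [g1 g2] := aux g f _ mg sg mf (fun x hx => esym (e x hx)) h.
have et := e _ h; have hf := mf _ _ _ h; have hg := mg _ _ _ h.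
rewrite et in f1 f2 hf; split; [clear -f1 g1 hf hg|clear -f2 g2 hf hg]; cyc.
Qed.

Definition pieces f (B : seq rat) (A : nat -> 'M[int]_2) :=
  (forall k, \det (A k) = 1) /\
  forall t : R, f (Some t) = mob (A (count (fun b : rat => ratr b < t) B)) (Some t).

Definition pl f := [/\ ccw_mono f, surj f & exists B A, pieces f B A].

(** All inner points have the same breakpoints below them, so that one matrix serves. The bound on
    [k] leaves finitely many matrices to consider. *)
Lemma piece_arc f B A x y : ccw_mono f -> surj f -> pieces f B A -> x <> y ->
  ~ ccw x None y -> (forall b : rat, b \in B -> ~ ccw x (Some (ratr b)) y) ->
  exists2 k : nat, (k <= size B)%N & forall z, cl x y z -> f z = mob (A k) z.
Proof.
move=> mf sf [dA fA] xy n0 nB; have [t0 h0] := exists_ccw xy.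
exists (count (fun b : rat => ratr b < t0) B); first exact: count_size.
set k := count _ _.
have L (t u : R) : t < u -> ltp (Some t) (Some u) by rewrite /ltp lp_mono.
have Linf (t : R) : ltp (Some t) None by rewrite /ltp lp_lt1.
have btw (t u v : R) : ccw x (Some t) y -> ccw x (Some v) y -> t <= u -> u < v ->
    ccw x (Some u) y.
  move=> ht hv; rewrite le_eqVlt => /orP[/eqP <- //|tu] uv.
  have h1 := L _ _ tu; have h2 := L _ _ uv; have h3 := Linf v.
  by clear -h1 h2 h3 n0 ht hv; cyc.
have op z : ccw x z y -> f z = mob (A k) z.
  case: z => [t|] // ht; rewrite fA; congr (mob (A _) _).
  apply: eq_in_count => b bB; apply/idP/idP => hb; apply: contrapT => /negP;
    rewrite -leNgt => hb'; apply: (nB _ bB).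
    exact: btw h0 ht hb' hb.
  exact: btw ht h0 hb' hb.
have [ex ey] := eq_on_cl mf sf (mob_mono (dA k)) (mob_surj (dA k)) xy op.
by move=> z [->|[->|/op]].
Qed.

Lemma ratp_mobP (A : 'M[int]_2) x : \det A = 1 -> ratp (mob A x) <-> ratp x.
Proof.
move=> dA; split; last exact: ratp_mob.
by move=> /(ratp_mob (adj2_det dA)); rewrite adj2K.
Qed.

Lemma ratp_rat (b : rat) : ratp (Some (ratr b) : P).
Proof. by exists (Some b). Qed.

Lemma seq_upper (B : seq rat) : exists m : R, forall b, b \in B -> ratr b < m.
Proof.
elim: B => [|b B [m hm]]; first by exists 0.
exists (Num.max m (ratr b + 1)) => c; rewrite inE lt_max => /orP[/eqP ->|/hm ->] //.
by rewrite ltrDl ltr01 orbT.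
Qed.

Lemma pl_ratp f x : pl f -> ratp (f x) <-> ratp x.
Proof.
move=> [mf sf [B [A [dA fA]]]]; case: x => [t|].
  by rewrite fA; apply: ratp_mobP.
(* Infinity is an end of the piece beyond the last breakpoint. *)
have [m hm] := seq_upper B.
have [||b bB|k _ hk] := @piece_arc f B A (Some m) None mf sf (conj dA fA).
- by [].
- by cyc.
- have h : ltp (Some (ratr b)) (Some m : P) by rewrite /ltp lp_mono hm.
  have h3 : ltp (Some m : P) None by rewrite /ltp lp_lt1.
  by clear -h h3; cyc.
by rewrite hk; [apply: ratp_mobP|apply: cl_r].
Qed.

(** Both vectors lie in one closed quadrant; [s] is the sign of the numerators, and infinity is
    [s/0]. With these representatives the mediant is the sum of the vectors. *)
Definition quad (s : int) u w := [/\ s = 1 \/ s = -1, 0 <= u.2, 0 <= w.2,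
  0 <= s * u.1 & 0 <= s * w.1].

(** With positive denominators, numerators of strictly opposite signs would give [|det u w|] at
    least 2: no Farey edge crosses the one from 0 to infinity. *)
Lemma quad_flip u w : `|det u w| = 1 -> exists s u' w',
  [/\ quad s u' w', u' = u \/ u' = - u & w' = w \/ w' = - w].
Proof.
have H1 v : exists2 v', 0 <= v'.2 & v' = v \/ v' = - v.
  case: (lerP 0 v.2) => h; first by exists v => //; left.
  by exists (- v); rewrite /= ?oppr_ge0 ?ltW //; right.
have Hs (c : int) : exists2 s : int, s = 1 \/ s = -1 & 0 <= s * c.
  by case: (lerP 0 c) => h; [exists 1; [left|lia]|exists (-1); [right|lia]].
have Hf (s : int) v : s = 1 \/ s = -1 -> v.2 = 0 ->
    exists v', [/\ v' = v \/ v' = - v, v'.2 = 0 & 0 <= s * v'.1].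
  move=> hs v0; case: (lerP 0 (s * v.1)) => h; first by exists v; split=> //; left.
  exists (- v); split; [by right|by rewrite /= v0 oppr0|].
  by rewrite /= mulrN oppr_ge0 ltW.
have [u1 u0 su] := H1 u; have [w1 w0 sw] := H1 w => d.
have {}d : `|det u1 w1| = 1.
  by case: su => ->; case: sw => ->; rewrite ?detNl ?detNr ?normrN.
suff [s [u' [w' [hq eu ew]]]] : exists s u' w',
    [/\ quad s u' w', u' = u1 \/ u' = - u1 & w' = w1 \/ w' = - w1].
  exists s, u', w'; split=> //.
    by case: eu => ->; case: su => ->; rewrite ?opprK; by [left|right].
  by case: ew => ->; case: sw => ->; rewrite ?opprK; by [left|right].
have [u20|u20] := eqVneq u1.2 0.
  have [s hs sc] := Hs w1.1; have [u' [eu u'0 su']] := Hf s u1 hs u20.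
  by exists s, u', w1; split=> //; [split; rewrite ?u'0|left].
have [w20|w20] := eqVneq w1.2 0.
  have [s hs sc] := Hs u1.1; have [w' [ew w'0 sw']] := Hf s w1 hs w20.
  by exists s, u1, w'; split=> //; [split; rewrite ?w'0|left].
have [s hs] : exists2 s : int, s = 1 \/ s = -1 & 0 <= s * u1.1 /\ 0 <= s * w1.1.
  clear -d u0 w0 u20 w20; move: d u0 w0 u20 w20; rewrite /det.
  case: u1 w1 => a b [c e] /=.
  move=> d b0 e0 bn en; have {b0 bn}b0 : 0 < b by lia.
  have {e0 en}e0 : 0 < e by lia.
  case: (lerP 0 a) => ha; case: (lerP 0 c) => hc.
  - by exists 1; [left|lia].
  - have [a0|an] := eqVneq a 0; first by exists (-1); [right|lia].
    by exists 1; [left|nia].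
  - have [c0|cn] := eqVneq c 0; first by exists (-1); [right|lia].
    by exists 1; [left|nia].
  - by exists (-1); [right|lia].
by move=> [h1 h2]; exists s, u1, w1; split=> //; left.
Qed.

Lemma quadC s u w : quad s u w -> quad s w u.
Proof. by case. Qed.

Lemma fa_quad x y : fa x y -> exists s u w, [/\ quad s u w, det u w = -1 &
  (proj u = x /\ proj w = y) \/ (proj u = y /\ proj w = x)].
Proof.
move=> [u [w [d eu ew]]]; have [s [u' [w' [hq su sw]]]] := quad_flip d.
have eu' : proj u' = x by case: su => ->; rewrite ?proj_opp.
have ew' : proj w' = y by case: sw => ->; rewrite ?proj_opp.
have {}d : `|det u' w'| = 1.
  by case: su => ->; case: sw => ->; rewrite ?detNl ?detNr ?normrN.
have [e|e] : det u' w' = -1 \/ det w' u' = -1.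
  by rewrite (detC u'); move: d; move: (det u' w') => X; lia.
  by exists s, u', w'; split=> //; left.
by exists s, w', u'; split=> //; [exact: quadC|right].
Qed.

Lemma proj_ccw u v w : det u v != 0 -> det v w != 0 -> det w u != 0 ->
  ccw (proj u) (proj v) (proj w : P) <-> 0 < det u v * det v w * det w u.
Proof.
move=> d1 d2 d3.
have [l l0 [e1 e2]] := @proj_ex R _ (det_neq0 d1).
have [m m0 [f1 f2]] := @proj_ex R _ (det_neq0 d2).
have [n n0 [g1 g2]] := @proj_ex R _ (det_neq0 d3).
rewrite -(ltr0z R) /ccw !intrM /det !(intrD, intrN, intrM) e1 e2 f1 f2 g1 g2.
set X := br _ _ * _ * _; set Y := (X in _ <-> is_true (0 < X)).
have -> : Y = (l * m * n) ^+ 2 * X by rewrite /X /Y /br; ring.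
have h : 0 < (l * m * n) ^+ 2 by rewrite exprn_even_gt0 //= !mulf_neq0.
by rewrite (pmulr_rgt0 _ h).
Qed.

Lemma det_proj_neq0 u v : (u.1 != 0) || (u.2 != 0) -> (v.1 != 0) || (v.2 != 0) ->
  proj u <> proj v :> P -> det u v != 0.
Proof.
move=> /(@proj_ex R)[l l0 [e1 e2]] /(@proj_ex R)[m m0 [f1 f2]] ne.
rewrite -(intr_eq0 R) /det !(intrD, intrN, intrM) e1 e2 f1 f2.
apply/negP => /eqP h; apply: ne; apply/br_eq0; rewrite /br.
have /eqP : l * m * (hx (proj u) * hy (proj v) - hy (proj u) * hx (proj v)) = 0.
  by rewrite -h; ring.
by rewrite !mulf_eq0 (negbTE l0) (negbTE m0) => /eqP.
Qed.

(* An integer vector strictly inside the cone of a unimodular basis is a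
   positive integral combination of it, so it bounds the basis. *)
Lemma cone_bound s u w v : quad s u w -> det u w = -1 ->
  0 < det u v * det v w -> [/\ `|u.1| <= `|v.1|, `|u.2| <= `|v.2|,
  `|w.1| <= `|v.1| & `|w.2| <= `|v.2|].
Proof.
move=> [hs u0 w0 su sw] d hv.
have e1 : v.1 = - det v w * u.1 - det u v * w.1.
  transitivity (- det u w * v.1); first by rewrite d; ring.
  by rewrite /det; ring.
have e2 : v.2 = - det v w * u.2 - det u v * w.2.
  transitivity (- det u w * v.2); first by rewrite d; ring.
  by rewrite /det; ring.
move: hv e1 e2; move: (det u v) (det v w) => X Y hv e1 e2.
have {hv}[[hX hY]|[hX hY]] : (1 <= X /\ 1 <= Y) \/ (X <= -1 /\ Y <= -1).
  case: (ltrgtP X 0) => hX; last by rewrite hX mul0r in hv.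
  - by right; rewrite nmulr_rgt0 // in hv; lia.
  - by left; rewrite pmulr_rgt0 // in hv; lia.
  rewrite e1 e2; case: hs su sw => -> su sw; split; nia.
rewrite e1 e2; case: hs su sw => -> su sw; split; nia.
Qed.

Lemma ccw_middle u w : det u w = -1 -> ccw (proj u) (proj (u + w)) (proj w : P).
Proof.
move=> d; have d1 : det u (u + w) = -1 by rewrite -d /det /=; ring.
have d2 : det (u + w) w = -1 by rewrite -d /det /=; ring.
have d3 : det w u = 1 by rewrite detC d.
by apply/proj_ccw; rewrite ?d1 ?d2 ?d3.
Qed.

Lemma cone_ccw_bound s u w v : quad s u w -> det u w = -1 ->
  (v.1 != 0) || (v.2 != 0) -> ccw (proj u) (proj v) (proj w : P) ->
  [/\ `|u.1| <= `|v.1|, `|u.2| <= `|v.2|, `|w.1| <= `|v.1| & `|w.2| <= `|v.2|].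
Proof.
move=> hq d v0 h; apply: (cone_bound hq d).
have d3 : det w u = 1 by rewrite detC d.
have u0 : (u.1 != 0) || (u.2 != 0) by apply: (@det_neq0 u w); rewrite d.
have w0 : (w.1 != 0) || (w.2 != 0) by apply: (@det_neq0 w u); rewrite d3.
have [n1 n2 n3] := ccw_neq h.
have /proj_ccw : ccw (proj u) (proj v) (proj w : P) by [].
by rewrite d3 mulr1; apply => //; apply: det_proj_neq0.
Qed.

Lemma mem_seq_bound (B : seq rat) : exists M : nat, forall b, b \in B ->
  `|numq b| <= M%:Z /\ `|denq b| <= M%:Z.
Proof.
elim: B => [|b B [M hM]]; first by exists 0%N.
exists (M + `|numq b| + `|denq b|)%N => c; rewrite inE => /orP[/eqP ->|/hM]; lia.
Qed.

Lemma mx_bound (A : nat -> 'M[int]_2) n : exists M : nat, forall k, (k <= n)%N ->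
  [/\ `|A k 0 0| <= M%:Z, `|A k 0 1| <= M%:Z, `|A k 1 0| <= M%:Z & `|A k 1 1| <= M%:Z].
Proof.
elim: n => [|n [M hM]].
  exists (`|A 0%N 0%R 0%R| + `|A 0%N 0%R 1%R| + `|A 0%N 1%R 0%R| + `|A 0%N 1%R 1%R|)%N.
  by case=> // _; split; lia.
exists (M + `|A n.+1 0%R 0%R| + `|A n.+1 0%R 1%R| + `|A n.+1 1%R 0%R| + `|A n.+1 1%R 1%R|)%N => k.
rewrite leq_eqVlt => /orP[/eqP ->|]; first by split; lia.
by rewrite ltnS => /hM[h1 h2 h3 h4]; split; lia.
Qed.

(** Infinity is [1/0], so by the cone bound both denominators would vanish. *)
Lemma none_not_inside s u w : quad s u w -> det u w = -1 ->
  ~ ccw (proj u) None (proj w : P).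
Proof.
move=> hq d h.
have eN : None = proj (1, 0) :> P by rewrite /proj /prj /= eqxx.
rewrite eN in h; have [_ h2 _ h4] := @cone_ccw_bound s u w (1, 0) hq d isT h.
have {}h2 : u.2 = 0 by move: h2; rewrite /=; lia.
have {}h4 : w.2 = 0 by move: h4; rewrite /=; lia.
by move: d; rewrite /det h2 h4 mul0r mulr0.
Qed.

Lemma box_bound s u w (M : nat) (b : rat) : quad s u w -> det u w = -1 ->
  `|numq b| <= M%:Z /\ `|denq b| <= M%:Z ->
  ccw (proj u) (Some (ratr b)) (proj w : P) -> u \in box M /\ w \in box M.
Proof.
move=> hq d [h1 h2] h.
have eb : Some (ratr b) = proj (numq b, denq b) :> P.
  by have := @proj_reduced R 1 (Some b) isT.
rewrite eb in h; have [|a1 a2 a3 a4] := @cone_ccw_bound s u w _ hq d _ h.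
  by rewrite /= denq_eq0 orbT.
by split; apply: boxP; [exact: le_trans a1 h1|exact: le_trans a2 h2
  |exact: le_trans a3 h1|exact: le_trans a4 h2].
Qed.

(* The three points of a Farey triangle, in counterclockwise order, with [z] its
   middle vertex. *)
Definition fmid x z y := exists s u w, [/\ quad s u w, det u w = -1, proj u = x,
  proj w = y & proj (u + w) = z].

(** By the cone bound, a point with small coordinates lies inside an arc only if the basis of the
    arc is small. So outside a finite box the arc contains no breakpoint, and one matrix serves; nor
    does it contain the preimage of 0 or infinity under this matrix, and the image vectors have no
    coordinates of opposite signs. *)
Lemma pl_cone f : pl f -> exists (M : nat), forall s u w, quad s u w ->
  det u w = -1 -> ~ (u \in box M /\ w \in box M) -> exists A : 'M[int]_2,
  [/\ \det A = 1, forall x, cl (proj u) (proj w) x -> f x = mob A x,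
     0 <= (app A u).1 * (app A w).1 & 0 <= (app A u).2 * (app A w).2].
Proof.
move=> [mf sf [B [A pA]]]; have [dA _] := pA.
have [M1 hM1] := mem_seq_bound B; have [M2 hM2] := mx_bound A (size B).
exists (M1 + M2)%N => s u w hq d nb.
have uw : proj u <> proj w :> P by have [h1 h2 h3] := ccw_neq (ccw_middle d); move=> e; apply: h3.
have nB (b : rat) : b \in B -> ~ ccw (proj u) (Some (ratr b)) (proj w : P).
  move=> bB h; apply: nb; apply: (box_bound hq d _ h).
  by have [] := hM1 _ bB; lia.
have [k kB hk] := piece_arc mf sf pA uw (none_not_inside hq d) nB.
have [h1 h2 h3 h4] := hM2 _ kB.
have key v : `|v.1| <= M2%:Z -> `|v.2| <= M2%:Z -> 0 <= det u v * det w v.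
  move=> v1 v2; rewrite leNgt; apply/negP => hlt; apply: nb.
  have [|a1 a2 a3 a4] := cone_bound hq d (_ : 0 < det u v * det v w).
    by rewrite (detC w) mulrN oppr_gt0.
  by split; apply: boxP; lia.
exists (A k); split=> //.
  (* This vector represents the preimage of 0, and the one used below that of infinity. Their
     determinants against [u] and [w] are the coordinates of the image vectors. *)
  have := key (- A k 0 1, A k 0 0); rewrite /det /app /= normrN => /(_ h2 h1).
  by congr (0 <= _ * _); ring.
have := key (- A k 1 1, A k 1 0); rewrite /det /app /= normrN => /(_ h4 h3).
by congr (0 <= _ * _); ring.
Qed.

Lemma proj_add_app (A : 'M[int]_2) u w : app A (u + w) = app A u + app A w.
Proof.
rewrite /app; apply/eqP; rewrite xpair_eqE /=.
by apply/andP; split; apply/eqP; ring.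
Qed.

Lemma fmid_fa x z y : fmid x z y -> [/\ ccw x z y, fa x z, fa z y & fa x y].
Proof.
move=> [s [u [w [hq d <- <- <-]]]]; split; first exact: ccw_middle.
- by exists u, (u + w); split=> //; rewrite (_ : det _ _ = -1) // -d /det /=; ring.
- by exists (u + w), w; split=> //; rewrite (_ : det _ _ = -1) // -d /det /=; ring.
- by exists u, w; rewrite d.
Qed.

Lemma quad_signs u w : 0 <= u.1 * w.1 -> 0 <= u.2 * w.2 -> exists s u' w',
  quad s u' w' /\ ((u' = u /\ w' = w) \/ (u' = - u /\ w' = - w)).
Proof.
case: u w => [a b] [c e] /= h1 h2.
have sgn (x y : int) : 0 <= x * y -> exists2 s : int, s = 1 \/ s = -1 &
    0 <= s * x /\ 0 <= s * y.
  move=> h; case: (ltrgtP x 0) => hx.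
  - by exists (-1); [right|split; nia].
  - by exists 1; [left|split; nia].
  - by case: (lerP 0 y) => hy; [exists 1; [left|split; lia]|exists (-1); [right|split; lia]].
have [s hs [sa sc]] := sgn _ _ h1; have [t ht [tb te]] := sgn _ _ h2.
case: ht tb te => -> tb te.
  by exists s, (a, b), (c, e); split; [split=> //=; lia|left].
exists (- s), (- (a, b)), (- (c, e)); split; last by right.
by split=> /=; [case: hs => ->; [right|left]|lia..].
Qed.

Lemma pl_fa_finite f : pl f ->
  finite_set [set A | exists x y, [/\ fa x y, ~ fa (f x) (f y) & A = arc x y]].
Proof.
move=> /pl_cone[M hM].
apply: (@finite_sub_list _ _ _ [seq (u, v) | u <- box M, v <- box M]
  (fun uv : (int * int) * (int * int) => arc (proj uv.1) (proj uv.2))).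
move=> A [x [y [/fa_quad[s [u [w [hq d exy]]]] nf ->]]].
have [[ub wb]|nb] := pselect (u \in box M /\ w \in box M).
  exists (u, w); first by apply: mem_In; apply/allpairsP; exists (u, w).
  by case: exy => -[<- <-] //=; rewrite arcC.
have [B [dB fB _ _]] := hM _ _ _ hq d nb.
have h : fa (f (proj u)) (f (proj w)).
  rewrite !fB; [|exact: cl_r|exact: cl_l].
  by apply: mob_fa => //; exists u, w; rewrite d.
by case: nf; case: exy h => -[<- <-] //; apply: faC.
Qed.

(** The middle vertex goes to the sum of the image vectors, which is a mediant again when these
    share a quadrant up to a common sign; [pl_cone] grants this outside a finite box. *)
Lemma pl_fmid_finite f : pl f -> finite_set [set T | exists x z y,
  [/\ fmid x z y, ~ fmid (f x) (f z) (f y) & T = tri x z y]].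
Proof.
move=> /pl_cone[M hM].
apply: (@finite_sub_list _ _ _ [seq (u, v) | u <- box M, v <- box M]
  (fun uv : (int * int) * (int * int) =>
     tri (proj uv.1) (proj (uv.1 + uv.2)) (proj uv.2))).
move=> T [x [z [y [[s [u [w [hq d <- <- <-]]]] nf ->]]]].
have [[ub wb]|nb] := pselect (u \in box M /\ w \in box M).
  by exists (u, w) => //; apply: mem_In; apply/allpairsP; exists (u, w).
have [A [dA fA h1 h2]] := hM _ _ _ hq d nb; case: nf.
have hm : cl (proj u) (proj w) (proj (u + w) : P) by right; right; apply: ccw_middle.
rewrite !fA //; [|exact: cl_r|exact: cl_l].
have u0 : (u.1 != 0) || (u.2 != 0) by apply: (@det_neq0 u w); rewrite d.
have w0 : (w.1 != 0) || (w.2 != 0) by apply: (@det_neq0 w u); rewrite detC d.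
have uw0 : ((u + w).1 != 0) || ((u + w).2 != 0).
  by apply: (@det_neq0 _ w); rewrite (_ : det _ _ = -1) // -d /det /=; ring.
rewrite !mob_proj // proj_add_app.
have [s' [u' [w' [hq' huw]]]] := quad_signs h1 h2.
have d' : det (app A u) (app A w) = -1 by rewrite app_det dA mul1r.
exists s', u', w'; case: huw hq' => -[-> ->] hq'; split=> //.
- by rewrite detNl detNr opprK.
- exact: proj_opp.
- exact: proj_opp.
- by rewrite -opprD proj_opp.
Qed.

End CircleMaps.

(** * Homeomorphisms of the disc *)

Section DiscHomeo.
Context {R : realType}.
Local Notation C := (plane R).
Local Notation P := (option R).
Local Notation mu := (@cayley R).
Implicit Types (z w p q a b : C).

Lemma lin0 z w : lin 0 z w = z.
Proof. by rewrite /lin subr0 mul1r mul0r addr0. Qed.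
Lemma lin1 z w : lin 1 z w = w.
Proof. by rewrite /lin subrr mul0r mul1r add0r. Qed.

Lemma cvg_muls (c : C) (T : Type) (F : set_system T) (FF : Filter F) (f : T -> C) l :
  f x @[x --> F] --> l -> (c * f x) @[x --> F] --> c * l.
Proof.
move=> h; have hr := cvg_re h; have hi := cvg_im h.
apply: cvg_plane.
  under eq_fun do rewrite reM; rewrite reM.
  by apply: cvgB; apply: cvgM; first [exact: cvg_cst|exact: hr|exact: hi].
under eq_fun do rewrite imM; rewrite imM.
by apply: cvgD; apply: cvgM; first [exact: cvg_cst|exact: hr|exact: hi].
Qed.

Lemma sqn_Some (t : R) : sqn (Some t) = t * t + 1.
Proof. by rewrite /sqn /= expr1n expr2. Qed.

Lemma cayley_continuous (t : R) : mu (Some s) @[s --> t] --> mu (Some t).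
Proof.
have n0 : sqn (Some t) != 0 by rewrite lt0r_neq0 ?sqn_gt0.
have cs : sqn (Some s) @[s --> t] --> sqn (Some t).
  under eq_fun do rewrite sqn_Some; rewrite sqn_Some.
  by apply: cvgD; [apply: cvgM; exact: cvg_id|exact: cvg_cst].
apply: cvg_plane.
  under eq_fun do rewrite re_cayley /= expr1n expr2; rewrite re_cayley /= expr1n expr2.
  apply: cvgM; last exact: cvgV.
  by apply: cvgB; [apply: cvgM; exact: cvg_id|exact: cvg_cst].
under eq_fun do rewrite im_cayley /= mulr1; rewrite im_cayley /= mulr1.
apply: cvgM; last exact: cvgV.
by apply: cvgN; apply: cvgM; [exact: cvg_cst|exact: cvg_id].
Qed.

Lemma nsqM z w : nsq (z * w) = nsq z * nsq w.
Proof. by rewrite /nsq !planeE; ring. Qed.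

Lemma circleM z w : circle z -> circle w -> circle (z * w).
Proof. by move=> /circleE hz /circleE hw; apply/circleE; rewrite nsqM hz hw mulr1. Qed.

Lemma circle_neq0 z : circle z -> z != 0.
Proof.
move=> /circleE h; apply/eqP => e; move: h; rewrite e /nsq /re /im /= expr0n addr0.
by move/eqP; rewrite eq_sym oner_eq0.
Qed.

(* The circle minus [c] is parametrized by [t |-> c * mu t]. *)
Lemma circle_chart c z : circle c -> circle z -> z <> c ->
  exists t, z = c * mu (Some t).
Proof.
move=> cc cz zc; have c0 := circle_neq0 cc.
have : circle (c^-1 * z).
  apply/circleE; have /circleE := cc; have /circleE := cz => hz hc.
  by have := nsqM c (c^-1 * z); rewrite mulVKf // hz hc mul1r => <-.
move=> /cayley_surj[[t|] e].
  by exists t; rewrite e mulVKf.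
by case: zc; rewrite -(mulVKf c0 z) -e mulr1.
Qed.

Lemma orientM c z1 z2 z3 : orient (c * z1) (c * z2) (c * z3) = nsq c * orient z1 z2 z3.
Proof. by rewrite /orient /nsq !planeE; ring. Qed.

Lemma within_fst (D : set (R * R)) (x : R * R) : fst @ within D (nbhs x) --> x.1.
Proof.
move=> S hS; apply: (@cvg_within_fst _ _ D setT x); first by move=> [u v] _; split.
by rewrite /within /=; apply: filterS hS.
Qed.

Lemma within_snd (D : set (R * R)) (x : R * R) : snd @ within D (nbhs x) --> x.2.
Proof.
move=> S hS; apply: (@cvg_within_snd _ _ D setT x); first by move=> [u v] _; split.
by rewrite /within /=; apply: filterS hS.
Qed.

Lemma nsq_lin_sub t z1 z2 z (e : R) : 0 <= t <= 1 -> nsq (z1 - z) < e ->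
  nsq (z2 - z) < e -> nsq (lin t z1 z2 - z) < e.
Proof.
move=> ht h1 h2; have -> : lin t z1 z2 - z = lin t (z1 - z) (z2 - z).
  by apply: plane_eq; rewrite /lin !planeE; ring.
apply: (@le_lt_trans _ _ (Num.max (nsq (z1 - z)) (nsq (z2 - z)))).
  by apply: nsq_lin_le; rewrite // le_max lexx ?orbT.
by rewrite gt_max h1.
Qed.

Context (f g : C -> C).
Context (cf : {within cdisc, continuous f}) (cg : {within disc, continuous g}).
Context (bf : set_bij disc disc f) (gf : forall z, disc z -> g (f z) = z).

Lemma fdisc z : disc z -> disc (f z).
Proof. by case: bf => h _ _; apply: h. Qed.

Lemma gdisc z : disc z -> disc (g z).
Proof. by case: bf => _ _ h /h[w dw <-]; rewrite gf. Qed.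

Lemma fg z : disc z -> f (g z) = z.
Proof. by case: bf => _ _ h /h[w dw <-]; rewrite gf. Qed.

Lemma cvg_f (T : Type) (F : set_system T) (FF : Filter F) (k : T -> C) z :
  cdisc z -> (\forall t \near F, cdisc (k t)) -> k t @[t --> F] --> z ->
  f (k t) @[t --> F] --> f z.
Proof.
move=> dz hk kz; move/subspace_continuousP: cf => /(_ _ dz) h.
apply: (@cvg_comp _ _ _ k f F (within cdisc (nbhs z))); last exact: h.
move=> S; rewrite /within /= => hS; have := kz _ hS.
apply: filterS2 hk => t /= d; exact.
Qed.

Lemma cvg_g (T : Type) (F : set_system T) (FF : Filter F) (k : T -> C) z :
  disc z -> (\forall t \near F, disc (k t)) -> k t @[t --> F] --> z ->
  g (k t) @[t --> F] --> g z.
Proof.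
move=> dz hk kz; move/subspace_continuousP: cg => /(_ _ dz) h.
apply: (@cvg_comp _ _ _ k g F (within disc (nbhs z))); last exact: h.
move=> S; rewrite /within /= => hS; have := kz _ hS.
apply: filterS2 hk => t /= d; exact.
Qed.

Lemma disc0 : disc (0 : C).
Proof. by apply/discE; rewrite /nsq /re /im /= expr0n addr0 ltr01. Qed.

Lemma radial_disc z s : circle z -> 0 < s < 1 -> disc (lin s z 0).
Proof.
move=> cz hs; apply: disc_lin => //; first exact: circle_cdisc.
  exact/disc_cdisc/disc0.
by move=> e; have := circle_neq0 cz; rewrite e eqxx.
Qed.

Lemma radial_cvg z : lin s z 0 @[s --> 0^'+] --> z.
Proof.
have {2}-> : z = lin 0 z 0 by rewrite /lin subr0 mul1r mul0r addr0.
apply: cvg_lin; [|exact: cvg_cst..].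
exact: cvg_at_right_filter.
Qed.

Lemma radial_f z : circle z -> f (lin s z 0) @[s --> 0^'+] --> f z.
Proof.
move=> cz; apply: cvg_f; [exact: circle_cdisc| |exact: radial_cvg].
by have := @near0_lt1 R; apply: filterS => s hs; apply/disc_cdisc/radial_disc.
Qed.

(** By continuity [f z] is in the closed disc. Were it inside, continuity of the inverse [g] along
    the radius would give [g (f z) = z], a point of the circle in the open disc. *)
Lemma fcircle z : circle z -> circle (f z).
Proof.
move=> cz; have h := radial_f cz.
have hn : nsq (f (lin s z 0)) @[s --> 0^'+] --> nsq (f z) by apply: cvg_nsq.
have le1 : nsq (f z) <= 1.
  rewrite leNgt; apply/negP => lt1.
  near (0 : R)^'+ => s.
  have hs : 0 < s < 1 by near: s; apply: near0_lt1.
  have /discE d1 := fdisc (radial_disc cz hs).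
  have : 1 < nsq (f (lin s z 0)) by near: s; apply: (cvgr_gt _ hn).
  by rewrite ltNge (ltW d1).
apply/circleE/eqP; rewrite eq_le le1 leNgt; apply/negP => /discE dfz.
have hg : g (f (lin s z 0)) @[s --> 0^'+] --> g (f z).
  apply: cvg_g => //.
  by have := @near0_lt1 R; apply: filterS => s hs; apply/fdisc/radial_disc.
have hz : g (f (lin s z 0)) @[s --> 0^'+] --> z.
  apply: cvg_trans; last exact: radial_cvg.
  apply: near_eq_cvg.
  by have := @near0_lt1 R; apply: filterS => s hs; rewrite gf //; apply: radial_disc.
have e : g (f z) = z by apply: (cvg_unique _ hg hz).
by have := gdisc dfz; rewrite e => /disc_ncircle; apply.
Unshelve. all: by end_near. Qed.

(** Intermediate value theorem for the side of [g (k t)]: a zero would be a point of the chord,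
    whose image the path avoids. *)
Lemma path_side (k : R -> C) p q : circle p -> circle q -> p <> q ->
  {within `[0, 1], continuous k} ->
  (forall t, 0 <= t <= 1 -> disc (k t)) ->
  (forall t s, 0 <= t <= 1 -> 0 < s < 1 -> f (lin s p q) <> k t) ->
  0 < orient p q (g (k 0)) -> 0 < orient p q (g (k 1)).
Proof.
move=> cp cq pq ck dk nk h0; rewrite ltNge; apply/negP => h1.
have [||c /itv01 hc e] := @IVT R (fun t => orient p q (g (k t))) 0 1 0 ler01.
- apply/subspace_continuousP => t /itv01 ht; apply: cvg_orient; apply: cvg_g.
  + exact: dk.
  + near=> s; apply: dk; apply/itv01; near: s; exact: withinT.
  + by move/subspace_continuousP: ck; apply; apply/itv01.
- by rewrite ge_min le_max h1 (ltW h0) orbT.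
have [s hs es] := orient0_chord cp cq pq (gdisc (dk _ hc)) e.
by apply: (nk _ _ hc hs); rewrite -es fg //; apply: dk.
Unshelve. all: by end_near. Qed.


(** The image of the closed chord and the arc are compact and disjoint: inner points of the chord
    stay in the open disc, and its ends are covered by the assumption. *)
Lemma arc_dist p q (c : C) (m M : R) : circle p -> circle q -> p <> q -> circle c ->
  m <= M -> (forall t, m <= t <= M -> f p <> c * mu (Some t) /\ f q <> c * mu (Some t)) ->
  exists2 e : R, 0 < e & forall s t, 0 <= s <= 1 -> m <= t <= M ->
    e <= nsq (f (lin s p q) - c * mu (Some t)).
Proof.
move=> cp cq pq cc mM npq.
pose F (u : R * R) := nsq (f (lin u.1 p q) - c * mu (Some u.2)).
pose D : set (R * R) := `[0, 1] `*` `[m, M].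
have cD : compact D by apply: compact_setX; exact: segment_compact.
have D0 : D !=set0.
  by exists (0, m); split; rewrite /= in_itv /= ?lexx ?ler01.
have cF : {within D, continuous F}.
  apply/subspace_continuousP => -[s t] [/itv01 hs ht].
  have c1 : f (lin u.1 p q) @[u --> within D (nbhs (s, t))] --> f (lin s p q).
    apply: cvg_f.
    - by apply: cdisc_lin => //; apply: circle_cdisc.
    - have : \forall u \near within D (nbhs (s, t)), D u by exact: withinT.
      apply: filterS => u [/itv01 hu _].
      by apply: cdisc_lin => //; apply: circle_cdisc.
    apply: cvg_lin; [|exact: cvg_cst..].
    exact: within_fst.
  have c2 : c * mu (Some u.2) @[u --> within D (nbhs (s, t))] --> c * mu (Some t).
    apply: cvg_muls.
    apply: (@cvg_comp _ _ _ snd (fun t => mu (Some t)) _ (nbhs t)); last exact: cayley_continuous.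
    exact: within_snd.
  have r1 := cvg_re c1; have r2 := cvg_re c2; have i1 := cvg_im c1; have i2 := cvg_im c2.
  apply: cvg_nsq; apply: cvg_plane.
    by under eq_fun do rewrite reD reN; rewrite reD reN; apply: cvgB; [exact: r1|exact: r2].
  by under eq_fun do rewrite imD imN; rewrite imD imN; apply: cvgB; [exact: i1|exact: i2].
have [[s t] /set_mem[/itv01 hs ht] hmin] := compact_EVT_min D0 cD cF.
exists (F (s, t)); last first.
  move=> s' t' hs' ht'; apply: (hmin (s', t')); apply/mem_set; split=> /=.
    exact/itv01.
  by rewrite in_itv.
rewrite /= in hs; rewrite /F /=; apply: nsq_gt0 => e.
have cr : circle (c * mu (Some t)) by apply: circleM => //; exact: cayley_circle.
have ht' : m <= t <= M by move: ht; rewrite /= in_itv.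
have [n1 n2] := npq _ ht'.
case/andP: hs; rewrite le_eqVlt => /orP[/eqP s0|s0].
  by move=> _; apply: n1; rewrite -e /= -s0 lin0.
rewrite le_eqVlt => /orP[/eqP s1|s1].
  by apply: n2; rewrite -e /= s1 lin1.
have : disc (f (lin s p q)).
  by apply: fdisc; apply: disc_lin => //; rewrite ?s0 //; apply: circle_cdisc.
by rewrite e => /disc_ncircle.
Qed.

(* Points separated by the chord [p q] have images separated by [f p] and
   [f q]: an arc between the images, pushed inside the disc, avoids the image of
   the chord, and its preimage would join the two sides of the chord. *)
Lemma chord_separates p q a b (c : C) (s1 s2 m M : R) :
  circle p -> circle q -> circle a -> circle b -> circle c ->
  0 < orient p q a -> orient p q b < 0 ->
  f a = c * mu (Some s1) -> f b = c * mu (Some s2) ->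
  m <= s1 <= M -> m <= s2 <= M ->
  (forall t, m <= t <= M -> f p <> c * mu (Some t) /\ f q <> c * mu (Some t)) -> False.
Proof.
move=> cp cq ca cb cc oa ob ea eb h1 h2 npq.
have pq : p <> q by move=> e; move: oa; rewrite e /orient; lra.
have mM : m <= M by lra.
have [e e0 he] := arc_dist cp cq pq cc mM npq.
have ch t : circle (c * mu (Some t)) by apply: circleM => //; exact: cayley_circle.
pose push s z := lin s z 0.
have pushn s z : circle z -> nsq (push s z - z) = s ^+ 2.
  move=> /circleE nz; transitivity (s ^+ 2 * nsq z); last by rewrite nz mulr1.
  by rewrite /push /lin /nsq !planeE /re /im /=; ring.
have near_f z : circle z -> \forall s \near (0 : R)^'+, nsq (f (push s z) - f z) < e.
  move=> cz; have hn : nbhs (f z) [set w | nsq (w - f z) < e].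
    by apply/nbhs_plane; exists e.
  exact: (radial_f cz hn).
have near_o z : 0 < orient p q z -> \forall s \near (0 : R)^'+, 0 < orient p q (push s z).
  move=> oz; have := near0_pos (orient p q 0 - orient p q z) oz; apply: filterS => s.
  by rewrite /push orient_lin; lra.
have ob' : 0 < orient q p b by rewrite orient_swap; lra.
have near_o' : \forall s \near (0 : R)^'+, orient p q (push s b) < 0.
  have h : 0 < - orient p q b by lra.
  have := near0_pos (orient p q b - orient p q 0) h; apply: filterS => s.
  by rewrite /push orient_lin; lra.
have [s [hs se fa fb [oa1 ob1]]] : exists s, [/\ 0 < s < 1, s ^+ 2 < e,
    nsq (f (push s a) - f a) < e, nsq (f (push s b) - f b) < e &
    0 < orient p q (push s a) /\ orient p q (push s b) < 0].
  have na := near_f _ ca; have nb := near_f _ cb; have no := near_o _ oa.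
  near (0 : R)^'+ => s; exists s.
  have hs : 0 < s < 1 by near: s; apply: near0_lt1.
  split=> //.
  - have : 0 < e + (- 1) * s by near: s; apply: near0_pos.
    by case/andP: hs => ? ?; nra.
  - by near: s.
  - by near: s.
  - by split; near: s.
have pushd z : circle z -> disc (push s z) by move=> cz; apply: radial_disc.
have pushs z : circle z -> nsq (push s z - z) < e by move=> cz; rewrite pushn.
have nohit (k : R -> C) u : m <= u <= M -> forall t, nsq (k t - c * mu (Some u)) < e ->
    forall r, 0 < r < 1 -> f (lin r p q) <> k t.
  move=> hu t hk r /andP[r0 r1] ek.
  have := he r u _ hu; rewrite ek => /(_ _)/le_lt_trans/(_ hk).
  by rewrite ltxx => h; have := h ltac:(lra).
have dA := pushd _ ca; have dB := pushd _ cb.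
have cfa := fcircle ca; have cfb := fcircle cb.
(* The path goes straight from [f (push s a)] to [push s (f a)], along the pushed arc to
   [push s (f b)], and straight to [f (push s b)]. It stays within squared distance [e] of the arc,
   hence off the image of the chord. *)
have k1 : 0 < orient p q (g (push s (f a))).
  have -> : push s (f a) = lin 1 (f (push s a)) (push s (f a)).
    by rewrite [RHS]/lin subrr mul0r mul1r add0r.
  apply: (@path_side (fun t => lin t (f (push s a)) (push s (f a))) p q cp cq pq).
  - exact: within_lin_path.
  - by move=> t ht; apply: disc_convex => //; [apply: fdisc|apply: pushd].
  - move=> t r ht; apply: (nohit (fun t => lin t (f (push s a)) (push s (f a))) s1) => //.
    by rewrite -ea; apply: nsq_lin_sub => //; apply: pushs.
  - by rewrite /lin subr0 mul1r mul0r addr0 gf.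
have k2 : 0 < orient p q (g (push s (f b))).
  pose k t := push s (c * mu (Some ((1 - t) * s1 + t * s2))).
  have e1 : k 1 = push s (f b) by rewrite eb /k subrr mul0r mul1r add0r.
  have e0' : k 0 = push s (f a) by rewrite ea /k subr0 mul0r mul1r addr0.
  rewrite -e1; apply: (path_side cp cq pq).
  - apply: continuous_subspaceT => t; apply: cvg_lin; [exact: cvg_cst| |exact: cvg_cst].
    apply: cvg_muls.
    apply: (@cvg_comp _ _ _ (fun t => (1 - t) * s1 + t * s2) (fun t => mu (Some t)) _
      (nbhs ((1 - t) * s1 + t * s2))); last exact: cayley_continuous.
    apply: cvgD; apply: cvgM; first [exact: cvg_cst|exact: cvg_id|idtac].
    by apply: cvgB; [exact: cvg_cst|exact: cvg_id].
  - by move=> t ht; apply: pushd.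
  - move=> t r ht; apply: (nohit k ((1 - t) * s1 + t * s2)); last exact: pushs.
    case/andP: h1 => ? ?; case/andP: h2 => ? ?; case/andP: ht => ? ?.
    by apply/andP; split; nra.
  - by rewrite e0'.
have : 0 < orient p q (g (f (push s b))).
  have -> : f (push s b) = lin 1 (push s (f b)) (f (push s b)).
    by rewrite [RHS]/lin subrr mul0r mul1r add0r.
  apply: (@path_side (fun t => lin t (push s (f b)) (f (push s b))) p q cp cq pq).
  - exact: within_lin_path.
  - by move=> t ht; apply: disc_convex => //; [apply: pushd|apply: fdisc].
  - move=> t r ht; apply: (nohit (fun t => lin t (push s (f b)) (f (push s b))) s2) => //.
    by rewrite -eb; apply: nsq_lin_sub => //; apply: pushs.
  - by rewrite /lin subr0 mul1r mul0r addr0.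
by rewrite gf //; lra.
Unshelve. all: by end_near. Qed.

(** Otherwise the circle without the point [f p = f q] contains an arc joining [f a] to [f b], which
    avoids both ends of the image of the chord. *)
Lemma chord_collapse p q a b : circle p -> circle q -> circle a -> circle b ->
  0 < orient p q a -> orient p q b < 0 -> f p = f q -> f a <> f p -> f b = f p.
Proof.
move=> cp cq ca cb oa ob epq na; apply: contrapT => nb.
have cc := fcircle cp.
have [s1 ea] := circle_chart cc (fcircle ca) na.
have [s2 eb] := circle_chart cc (fcircle cb) nb.
apply: (@chord_separates p q a b (f p) s1 s2 (Num.min s1 s2) (Num.max s1 s2)) => //.
- by rewrite ge_min le_max lexx.
- by rewrite ge_min le_max lexx !orbT.
move=> t _; rewrite -epq; suff h : f p <> f p * mu (Some t) by [].
move=> e; have : mu None = mu (Some t).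
  by apply: (mulfI (circle_neq0 cc)); rewrite -e mulr1.
by move=> /cayley_inj.
Qed.

(** In the chart with [f p] at infinity, [f q] must lie between [f a] and [f b]; otherwise the arc
    between these would avoid both ends of the image of the chord. *)
Lemma chord_image_separates p q a b : circle p -> circle q -> circle a -> circle b ->
  0 < orient p q a -> orient p q b < 0 -> f p <> f q -> f a <> f p -> f b <> f p ->
  f a <> f q -> f b <> f q ->
  orient (f p) (f q) (f a) * orient (f p) (f q) (f b) < 0.
Proof.
move=> cp cq ca cb oa ob npq na nb naq nbq.
have cc := fcircle cp.
have [s1 ea] := circle_chart cc (fcircle ca) na.
have [s2 eb] := circle_chart cc (fcircle cb) nb.
have [s3 eq] := circle_chart cc (fcircle cq) (fun e => npq (esym e)).
have Linf (t : R) : ltp (Some t) None by rewrite /ltp lp_lt1.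
have L (t u : R) : t < u -> ltp (Some t) (Some u) by rewrite /ltp lp_mono.
have side t : t <> s3 -> (s3 < t -> 0 < orient (f p) (f q) (f p * mu (Some t))) /\
    (t < s3 -> orient (f p) (f q) (f p * mu (Some t)) < 0).
  move=> nt; have -> : orient (f p) (f q) (f p * mu (Some t)) =
      orient (mu None) (mu (Some s3)) (mu (Some t)).
    have e0 : f p = f p * mu None by rewrite mulr1.
    rewrite {1}e0 eq orientM; have /circleE -> := cc.
    by rewrite mul1r.
  split=> h; [apply/orient_gt0|apply/orient_lt0]; have h1 := L _ _ h;
    have h2 := Linf t; have h3 := Linf s3; clear -h1 h2 h3; cyc.
have n13 : s1 <> s3 by move=> e; apply: naq; rewrite ea eq e.
have n23 : s2 <> s3 by move=> e; apply: nbq; rewrite eb eq e.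
have nb3 : ~ (Num.min s1 s2 <= s3 <= Num.max s1 s2) -> False.
  move=> h.
  apply: (@chord_separates p q a b (f p) s1 s2 (Num.min s1 s2) (Num.max s1 s2)) => //.
  - by rewrite ge_min le_max lexx.
  - by rewrite ge_min le_max lexx !orbT.
  move=> t ht; split=> e.
    have : mu None = mu (Some t).
      by apply: (mulfI (circle_neq0 cc)); rewrite -e mulr1.
    by move=> /cayley_inj.
  move: e; rewrite eq => /(mulfI (circle_neq0 cc))/cayley_inj[e].
  by apply: h; rewrite e.
have {nb3}/andP[] := contrapT nb3; rewrite ge_min le_max ea eb.
have [p1 p2] := side _ n13; have [p3 p4] := side _ n23.
case: (ltrgtP s1 s3) => // h1; case: (ltrgtP s2 s3) => // h2 _ _.
- by rewrite nmulr_rlt0 ?p2 // p3.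
- by rewrite pmulr_rlt0 ?p1 // p4.
Qed.
End DiscHomeo.

(** * Boundary maps of mapping classes *)

Section BoundaryMap.
Context {R : realType}.
Local Notation C := (plane R).
Local Notation P := (option R).
Local Notation mu := (@cayley R).
Implicit Types (x y z : P).

Lemma ltp_SomeE (t u : R) : t < u -> ltp (Some t) (Some u).
Proof. by rewrite /ltp lp_mono. Qed.
Lemma ltp_None (t : R) : ltp (Some t) None.
Proof. exact: lp_lt1. Qed.

Lemma left_gap (l : seq R) (t0 : R) : exists2 t : R, t < t0 &
  forall r, r \in l -> r < t0 -> r < t.
Proof.
elim: l => [|r l [t tt ht]]; first by exists (t0 - 1) => //; lra.
have [rt|rt] := ltP r t0; last first.
  by exists t => // s; rewrite inE => /orP[/eqP ->|]; [rewrite ltNge rt|apply: ht].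
exists (Num.max t ((r + t0) / 2)).
  by rewrite gt_max tt /=; lra.
move=> s; rewrite inE => /orP[/eqP -> _|/ht h /h]; rewrite lt_max; last by move=> ->.
by apply/orP; right; lra.
Qed.

(** Two points of one piece have distinct images under its matrix, so a piecewise map is constant on
    no arc. Together with [chord_collapse] this yields injectivity on the circle. *)
Lemma pieces_avoid (f : P -> P) B A x y c : pieces f B A -> x <> y ->
  exists2 z, ccw x z y & f z <> c.
Proof.
move=> [dA fA] xy; have [t0 h0] := exists_ccw xy.
pose l := (if x is Some r then [:: r] else [::]) ++ [seq ratr b | b : rat <- B].
(* Neither a breakpoint nor [x] separates [t] from [t0], so [t] stays in the arc and in the piece of
   [t0]. *)
have [t tt ht] := left_gap l t0.
have ht1 : ccw x (Some t) y.
  have h1 := ltp_SomeE tt; have h2 := ltp_None t0.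
  rewrite /l in ht; case: (x) h0 ht => [r|] h0 ht; last by clear -h0 h1 h2; cyc.
  case: (ltrgtP r t0) => hr.
  - have hr' : r < t by apply: ht => //; rewrite inE eqxx.
    by have h3 := ltp_SomeE hr'; clear -h0 h1 h2 h3; cyc.
  - by have h3 := ltp_SomeE hr; have h4 := ltp_None r; clear -h0 h1 h2 h3 h4; cyc.
  - by rewrite hr in h0; clear -h0; cyc.
have [e|ne] := pselect (f (Some t0) = c); last by exists (Some t0).
exists (Some t) => // e'; have : f (Some t) = f (Some t0) by rewrite e e'.
rewrite !fA (_ : count _ _ = count (fun b : rat => ratr b < t0) B).
  by move=> /(mob_inj (dA _)) [ett]; rewrite ett ltxx in tt.
apply: eq_in_count => b bB; apply/idP/idP => h; first exact: lt_trans tt.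
by apply: ht => //; rewrite mem_cat map_f ?orbT.
Qed.

(** Separated pairs go to separated pairs, in one of two orientations that might a priori depend on
    the points. *)
Definition sep_mono (f : P -> P) := forall x y a b, ccw x y a -> ccw x b y ->
  (ccw (f x) (f y) (f a) /\ ccw (f x) (f b) (f y)) \/
  (ccw (f x) (f a) (f y) /\ ccw (f x) (f y) (f b)).

Definition mono3 (f : P -> P) x y z := (ccw x y z -> ccw (f x) (f y) (f z)) /\
  (ccw x z y -> ccw (f x) (f z) (f y)).

(** Orientation propagates when one point of a triple is replaced: [w] lies on one of the three arcs
    cut out by the triple, and separation keeps it on the corresponding arc of the image. *)
Lemma sep_mono3 (f : P -> P) (x y z w : P) : sep_mono f -> distinct3 x y z ->
  w <> x -> w <> y -> w <> z -> mono3 f x y z -> mono3 f x y w.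
Proof.
move=> sf; have H u v t s : ccw u v t -> ccw (f u) (f v) (f t) ->
    s <> u -> s <> v -> s <> t -> mono3 f u v s.
  move=> h h' su sv st.
  have ins a b c : ccw a b c -> ccw (f a) (f b) (f c) -> ccw a s b ->
      ccw (f a) (f s) (f b).
    by move=> h1 h2 h3; have := sf _ _ _ _ h1 h3; clear -h2; cyc.
  have i1 := ins u v t h h'; have i2 := ins v t u (ccw_rot h) (ccw_rot h').
  have i3 := ins t u v (ccw_rot (ccw_rot h)) (ccw_rot (ccw_rot h')).
  have [c1|[c2|c3]] : ccw u s v \/ ccw v s t \/ ccw t s u by clear -h su sv st; cyc.
  - by have {}i1 := i1 c1; clear -i1 c1; split; cyc.
  - by have {}i2 := i2 c2; clear -i2 c2 h h'; split; cyc.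
  - by have {}i3 := i3 c3; clear -i3 c3 h h'; split; cyc.
move=> [xy yz zx] wx wy wz [m1 m2].
have [h|h] := ccw_total xy yz zx; first exact: H (m1 h) _ _ _.
have [n1 n2] := H _ _ _ _ (ccw_rot (ccw_rot h)) (ccw_rot (ccw_rot (m2 h))) wy wx wz.
clear -n1 n2; split=> hh.
  by have := n2 (ccw_rot hh); cyc.
by apply: ccw_rot; apply: n1; do 2!apply: ccw_rot.
Qed.

Lemma mono3_perm (f : P -> P) x y z : mono3 f x y z -> mono3 f y z x /\ mono3 f x z y.
Proof.
move=> [h1 h2]; split; split=> h; [| |exact: h2|exact: h1].
- by have := h1 (ccw_rot (ccw_rot h)); cyc.
- by have := h2 (ccw_rot h); cyc.
Qed.

Lemma seq_lower (l : seq R) : exists m : R, forall r, r \in l -> m < r.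
Proof.
elim: l => [|b B [m hm]]; first by exists 0.
exists (Num.min m (b - 1)) => c; rewrite inE gt_min => /orP[/eqP ->|/hm ->] //.
by rewrite ltrBlDr ltrDl ltr01 orbT.
Qed.

(** Three points to the left of all breakpoints are moved by one matrix of determinant 1, which
    keeps their order. Exchanging them one at a time for [x], [y], [z] spreads this to every
    triple. *)
Lemma sep_pieces_mono (f : P -> P) B A : sep_mono f -> pieces f B A -> ccw_mono f.
Proof.
move=> sf [dA fA] x y z h; have [xy yz zx] := ccw_neq h.
pose fin (u : P) := if u is Some r then [:: r] else [::].
have [m hm] := seq_lower (fin x ++ fin y ++ fin z ++ [seq ratr b | b : rat <- B]).
have fm (t : R) : t < m -> f (Some t) = mob (A 0%N) (Some t).
  move=> tm; rewrite fA (_ : count _ _ = 0%N) //; apply/eqP.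
  rewrite -leqn0 leqNgt -has_count; apply/hasPn => b bB.
  rewrite -leNgt ltW // (lt_trans tm) //; apply: hm.
  by rewrite !mem_cat map_f ?orbT.
have nx u t : t < m -> (forall r, r \in fin u -> m < r) -> u <> Some t.
  by case: u => [r|] // tm hr [e]; have := hr r; rewrite inE eqxx e => /(_ isT); lra.
have hx r : r \in fin x -> m < r by move=> h'; apply: hm; rewrite mem_cat h'.
have hy r : r \in fin y -> m < r by move=> h'; apply: hm; rewrite !mem_cat h' !orbT.
have hz r : r \in fin z -> m < r by move=> h'; apply: hm; rewrite !mem_cat h' !orbT.
have [t1 [t2 [t3 [l1 l2 l3 /ltp_SomeE h12 /ltp_SomeE h23]]]] : exists t1 t2 t3 : R,
    [/\ t1 < m, t2 < m, t3 < m, t1 < t2 & t2 < t3].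
  by exists (m - 3), (m - 2), (m - 1); split; lra.
have c123 : ccw (Some t1) (Some t2) (Some t3) by clear -h12 h23; cyc.
have [d12 d23 d31] := ccw_neq c123.
have m0 : mono3 f (Some t1) (Some t2) (Some t3).
  split=> hh; first by rewrite !fm //; apply: mob_mono.
  by clear -c123 hh; cyc.
have m1 : mono3 f (Some t1) (Some t2) x.
  by apply: sep_mono3 m0 => //; apply: nx.
have [_ m1'] := mono3_perm m1.
have m2 : mono3 f (Some t1) x y.
  apply: sep_mono3 m1' => //; try exact: nx; try by move=> e; apply: xy.
  split=> e; [exact: (nx x _ l1 hx (esym e))|exact: (nx x _ l2 hx e)|].
  exact: d12 (esym e).
have [m2' _] := mono3_perm m2.
have : mono3 f x y z; last by case=> h1 _; apply: h1.
apply: sep_mono3 m2' => //; try exact: nx; try by move=> e; apply: yz.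
by split=> // e; [exact: (nx y _ l1 hy e)|exact: (nx x _ l1 hx (esym e))].
Qed.

Lemma cdisc_compact : compact (cdisc : set C).
Proof.
pose h (u : R * R) : C := u.1 +i* u.2.
have hc : continuous h.
  move=> u; apply: cvg_plane; [exact: cvg_fst|exact: cvg_snd].
have cK : compact (h @` (`[-1, 1] `*` `[-1, 1])).
  apply: continuous_compact; first exact: continuous_subspaceT.
  by apply: compact_setX; exact: segment_compact.
apply: (subclosed_compact _ cK).
  have -> : cdisc = (@nsq R) @^-1` [set t | t <= 1].
    by apply/seteqP; split=> z; [move/cdiscE|move=> ?; apply/cdiscE].
  apply: preimage_closed; last exact: closed_le.
  by move=> z _; exact: (@cvg_nsq _ _ (nbhs z) _ id z (@cvg_id _ _)).
move=> z /cdiscE nz; exists (re z, im z); last by apply: plane_eq.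
have := sqr_ge0 (re z); have := sqr_ge0 (im z); move: nz; rewrite /nsq => ? ? ?.
by split; rewrite /= in_itv /=; apply/andP; split; nra.
Qed.

Lemma asymp_pl (f : C -> C) : asymp_rigid f ->
  exists phi, pl phi /\ forall x, f (mu x) = mu (phi x).
Proof.
move=> [bf [g cg gf] cf [B [A [dA fA]]]].
have fc (w : C) : circle w -> circle (f w) by apply: (fcircle cf cg bf gf).
have /choice[phi hphi] x : exists y, f (mu x) = mu y.
  by have [y <-] := cayley_surj (fc _ (cayley_circle x)); exists y.
have pp : pieces phi B A.
  by split=> // t; apply: cayley_inj; rewrite -hphi fA mobius_mob.
have cc := @cayley_circle R.
(* If [phi x = phi y], one of the two arcs between [x] and [y] would collapse to this point. *)
have inj : injective phi.
  move=> x y e; apply: contrapT => xy.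
  have yx : y <> x by move=> e'; apply: xy.
  have [a ha na] := pieces_avoid (phi x) pp yx.
  have [b hb nb] := pieces_avoid (phi x) pp xy.
  apply: nb; apply: cayley_inj; rewrite -!hphi.
  apply: (chord_collapse cf cg bf gf (cc x) (cc y) (cc a) (cc b)).
  - by apply/orient_gt0; clear -ha; cyc.
  - exact/orient_lt0.
  - by rewrite !hphi e.
  - by rewrite !hphi => /cayley_inj.
have ssep : sep_mono phi.
  move=> x y a b ha hb; have [n1 n2 n3] := ccw_neq ha; have [n4 n5 n6] := ccw_neq hb.
  have := chord_image_separates cf cg bf gf (cc x) (cc y) (cc a) (cc b) _ _ _ _ _ _ _.
  move=> /(_ ((orient_gt0 _ _ _).2 ha) ((orient_lt0 _ _ _).2 hb)); rewrite !hphi.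
  have nn u v : u <> v -> mu (phi u) <> mu (phi v) by move=> uv /cayley_inj/inj.
  move=> /(_ (nn _ _ n1) (nn _ _ n3) (nn _ _ (fun e => n4 (esym e)))).
  move=> /(_ (nn _ _ (fun e => n2 (esym e))) (nn _ _ n5)) h.
  case: (ltrgtP (orient (mu (phi x)) (mu (phi y)) (mu (phi a))) 0) => ho.
  - right; split; first exact/orient_lt0.
    by apply/orient_gt0; rewrite nmulr_rlt0 in h.
  - left; split; first exact/orient_gt0.
    by apply/orient_lt0; rewrite pmulr_rlt0 in h.
  - by rewrite ho mul0r ltxx in h.
exists phi; split=> //; split; [exact: sep_pieces_mono pp| |by exists B, A].
move=> y.
(* The image of the closed disc is closed and contains the open disc, hence the circle, which only
   boundary points can reach. *)
have clos : closed (f @` cdisc).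
  apply: compact_closed; first exact: norm_hausdorff.
  by apply: continuous_compact => //; exact: cdisc_compact.
have : (f @` cdisc) (mu y).
  apply: clos => U /nbhs_plane[e e0 eU].
  near (0 : R)^'+ => s.
  have hs : 0 < s < 1 by near: s; apply: near0_lt1.
  have ds := radial_disc (cc y) hs.
  exists (lin s (mu y) 0); split.
    exists (g (lin s (mu y) 0)); last exact: fg bf gf _ ds.
    by apply: disc_cdisc; apply: (gdisc bf gf).
  apply: eU; have -> : nsq (lin s (mu y) 0 - mu y) = s ^+ 2.
    transitivity (s ^+ 2 * nsq (mu y)).
      by rewrite /lin /nsq !planeE /re /im /=; ring.
    by have /circleE -> := cc y; rewrite mulr1.
  have : 0 < e + (- 1) * s by near: s; apply: near0_pos.
  by case/andP: hs => ? ?; nra.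
move=> [z cz ez]; case: (cdisc_split cz) => [dz|/cayley_surj[x ex]].
  by have := fdisc bf dz; rewrite ez => /disc_ncircle; case.
by exists x; apply: cayley_inj; rewrite -hphi ex.
Unshelve. all: by end_near. Qed.


(** * Radial extension of circle maps *)

Lemma cayley_nbhs x (e : R) : 0 < e -> exists a b,
  ccw a x b /\ forall y, ccw a y b -> nsq (mu y - mu x) < e.
Proof.
move=> e0; case: x => [t|].
  (* The squared chordal distance is at most [4 d^2 <= 4 d <= e / 2]. *)
  pose d : R := Num.min 1 (e / 8); have d0 : 0 < d by rewrite lt_min ltr01 /=; lra.
  have [d1 d2] : d <= 1 /\ d <= e / 8 by split; rewrite ge_min lexx ?orbT.
  have [a [b [/ltp_SomeE h1 /ltp_SomeE h2 [ea eb]]]] : exists a b : R,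
    [/\ a < t, t < b & a = t - d /\ b = t + d] by exists (t - d), (t + d); split; lra.
  exists (Some a), (Some b); split; first by clear -h1 h2; cyc.
  move=> [u|] hy; last by have h3 := ltp_None b; clear -h1 h2 h3 hy; cyc.
  have au : a < u.
    rewrite ltNge; apply/negP; rewrite le_eqVlt => /orP[/eqP ua|/ltp_SomeE h3].
      by rewrite ua in hy; clear -hy; cyc.
    by clear -h1 h2 h3 hy; cyc.
  have ub : u < b.
    rewrite ltNge; apply/negP; rewrite le_eqVlt => /orP[/eqP ua|/ltp_SomeE h3].
      by rewrite ua in hy; clear -hy; cyc.
    by clear -h1 h2 h3 hy; cyc.
  rewrite cayley_dist ltr_pdivrMr ?mulr_gt0 ?sqn_gt0 // !sqn_Some /br /=.
  have h : (u * 1 - 1 * t) ^+ 2 <= d ^+ 2.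
    have h0 : 0 <= (d - (u - t)) * (d + (u - t)) by apply: mulr_ge0; lra.
    by lra.
  have : 1 <= (u * u + 1) * (t * t + 1) by nra.
  have : d ^+ 2 <= d by nra.
  by move=> k1 /(ler_wpM2l (ltW e0)) k2; lra.
(* The squared chordal distance to infinity is [4 / (u^2 + 1)], and [u^2 >= M] because
   [|u| > M > 1]. *)
pose M : R := 1 + 4 / e; have M1 : 1 < M by rewrite ltrDl divr_gt0.
have hM : 4 < e * M by rewrite /M mulrDr mulr1 mulrC divfK ?lt0r_neq0 //; lra.
have [a [b [/ltp_SomeE h1 [ea eb]]]] : exists a b : R, b < a /\ (a = M /\ b = - M).
  by exists M, (- M); split=> //; lra.
have h2 := ltp_None a; have h3 := ltp_None b.
exists (Some a), (Some b); split; first by clear -h1 h2 h3; cyc.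
move=> [u|] hy; last first.
  by rewrite (_ : mu None - mu None = 0) ?subrr // /nsq /re /im /= expr0n addr0.
have hu : a < u \/ u < b.
  case: (ltrgtP u b) => [|/ltp_SomeE k|k]; [by right| |].
    left; rewrite ltNge; apply/negP; rewrite le_eqVlt => /orP[/eqP ua|/ltp_SomeE h4].
      by rewrite ua in hy; clear -hy; cyc.
    by clear -h1 h2 h3 h4 hy k; cyc.
  by rewrite k in hy; clear -hy; cyc.
rewrite cayley_dist ltr_pdivrMr ?mulr_gt0 ?sqn_gt0 // sqn_Some /sqn /br /=.
have : M <= u * u by case: hu => hu; nra.
by move=> /(ler_wpM2l (ltW e0)) k; rewrite !(mulr0, mulr1, mul1r, mul0r) ?expr0n ?expr1n /= ?add0r ?addr0 ?sub0r ?sqrrN ?expr1n; lra.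
Qed.

Definition radius (w : C) : R := Num.sqrt (nsq w).
Definition unitv (w : C) : C := (radius w)^-1%:C * w.

Lemma radius_gt0 (w : C) : w != 0 -> 0 < radius w.
Proof.
move=> w0; rewrite sqrtr_gt0 lt_def nsq_ge0 andbT; apply/eqP => /nsq_eq0 e.
by rewrite e eqxx in w0.
Qed.

Lemma nsqZ (t : R) (w : C) : nsq (t%:C * w) = t ^+ 2 * nsq w.
Proof. by rewrite /nsq !planeE; ring. Qed.

Lemma unitv_circle (w : C) : w != 0 -> circle (unitv w).
Proof.
move=> w0; apply/circleE; rewrite nsqZ exprVn sqr_sqrtr ?nsq_ge0 // mulVf //.
by apply/eqP => /nsq_eq0 e; rewrite e eqxx in w0.
Qed.

Lemma radial_angle : exists ux : C -> P, forall w : C, w != 0 -> mu (ux w) = unitv w.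
Proof.
have H (w : C) : exists x, w != 0 -> mu x = unitv w.
  have [->|w0] := eqVneq w 0; first by exists None; rewrite ?eqxx.
  by have [x ex] := cayley_surj (unitv_circle w0); exists x.
by have [ux hux] := choice H; exists ux.
Qed.

(** Moduli are kept and [phi] acts on directions. The direction [ux 0] is arbitrary, and the zero
    modulus annihilates it. *)
Definition conj_map (ux : C -> P) (phi : P -> P) (w : C) : C :=
  (radius w)%:C * mu (phi (ux w)).

Lemma radius_cvg (w : C) : radius v @[v --> w] --> radius w.
Proof.
apply: (@cvg_comp _ _ _ (@nsq R) Num.sqrt _ (nbhs (nsq w))).
  exact: (@cvg_nsq _ _ (nbhs w) _ id w (@cvg_id _ _)).
exact: sqrt_continuous.
Qed.

Lemma unitv_cvg (w : C) : w != 0 -> unitv v @[v --> w] --> unitv w.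
Proof.
move=> w0; have h := @radius_cvg w.
have hr := @cvg_re _ _ (nbhs w) _ id w (@cvg_id _ _).
have hi := @cvg_im _ _ (nbhs w) _ id w (@cvg_id _ _).
have hv : (radius v)^-1 @[v --> w] --> (radius w)^-1.
  exact: (cvgV (lt0r_neq0 (radius_gt0 w0)) h).
apply: (@cvg_plane _ _ (nbhs w)).
  under eq_fun do rewrite /unitv reM re_real im_real mul0r subr0.
  rewrite /unitv reM re_real im_real mul0r subr0.
  by apply: cvgM; [exact: hv|exact: hr].
under eq_fun do rewrite /unitv imM re_real im_real mul0r addr0.
rewrite /unitv imM re_real im_real mul0r addr0.
by apply: cvgM; [exact: hv|exact: hi].
Qed.

Section Radial.
Context (ux : C -> P) (hux : forall w : C, w != 0 -> mu (ux w) = unitv w).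

Lemma conj_map_radius phi (w : C) : radius (conj_map ux phi w) = radius w.
Proof.
rewrite /radius nsqZ; have /circleE -> := cayley_circle (phi (ux w)).
by rewrite mulr1 sqrtr_sqr ger0_norm ?sqrtr_ge0.
Qed.

Lemma conj_map0 phi (w : C) : conj_map ux phi w = 0 <-> w = 0.
Proof.
have r0 : radius (0 : C) = 0.
  by rewrite /radius /nsq /re /im /= expr0n addr0 sqrtr0.
split=> [e|->]; last by rewrite /conj_map r0 mul0r.
apply: contrapT => /eqP/radius_gt0; rewrite -(conj_map_radius phi) e r0.
by rewrite ltxx.
Qed.

Lemma conj_mapK phi psi : cancel phi psi -> cancel (conj_map ux phi) (conj_map ux psi).
Proof.
move=> K w; have [->|w0] := eqVneq w 0.
  by rewrite (conj_map0 _ _).2 //; apply/conj_map0.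
have cw0 : conj_map ux phi w != 0.
  by apply/eqP => /conj_map0 e; rewrite e eqxx in w0.
rewrite {1}/conj_map conj_map_radius.
have -> : ux (conj_map ux phi w) = phi (ux w).
  apply: cayley_inj; rewrite hux // /unitv conj_map_radius /conj_map mulrA.
  by rewrite -rmorphM /= mulVf ?mul1r // lt0r_neq0 ?radius_gt0.
rewrite K hux // /unitv mulrA -rmorphM /= divff ?mul1r //.
by rewrite lt0r_neq0 ?radius_gt0.
Qed.

Lemma conj_map_disc phi (w : C) : disc w -> disc (conj_map ux phi w).
Proof.
move=> /discE h; apply/discE.
by rewrite nsqZ; have /circleE -> := cayley_circle (phi (ux w)); rewrite mulr1 sqr_sqrtr ?nsq_ge0.
Qed.

Lemma conj_map_cayley phi x : conj_map ux phi (mu x) = mu (phi x).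
Proof.
have cx := cayley_circle x; have r1 : radius (mu x) = 1.
  by rewrite /radius; have /circleE -> := cx; rewrite sqrtr1.
rewrite /conj_map r1 mul1r; congr (mu (phi _)); apply: cayley_inj.
by rewrite hux ?circle_neq0 // /unitv r1 invr1 mul1r.
Qed.

(** Away from 0, an arc around the image direction pulls back, by monotonicity and surjectivity, to
    an arc around the direction, cut out by an open condition on [orient]. *)
Lemma conj_map_cvg phi (w : C) : ccw_mono phi -> surj phi ->
  conj_map ux phi v @[v --> w] --> conj_map ux phi w.
Proof.
move=> mp sp; have hr := @radius_cvg w.
have [->|w0] := eqVneq w 0.
  rewrite (conj_map0 _ _).2 //; move=> S /nbhs_plane[e e0 eS].
  apply/nbhs_plane; exists e => // v; rewrite !subr0 => nv; apply: eS.
  rewrite subr0 nsqZ; have /circleE -> := cayley_circle (phi (ux v)).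
  by rewrite mulr1 sqr_sqrtr ?nsq_ge0.
have hm : mu (phi (ux v)) @[v --> w] --> mu (phi (ux w)).
  move=> S /nbhs_plane[e e0 eS].
  have [a' [b' [h1 h2]]] := cayley_nbhs (phi (ux w)) e0.
  have [a ea] := sp a'; have [b eb] := sp b'; rewrite -ea -eb in h1 h2.
  have haw := ccw_reflect mp h1.
  have ow : 0 < orient (mu b) (mu a) (unitv w).
    by rewrite -hux //; apply/orient_gt0; clear -haw; cyc.
  have ho : orient (mu b) (mu a) (unitv v) @[v --> w] --> orient (mu b) (mu a) (unitv w).
    exact: (@cvg_orient _ _ (nbhs w) _ _ _ _ _ (unitv_cvg w0)).
  have n0 : \forall v \near w, v != 0.
    apply/nbhs_plane; exists (nsq w); first by rewrite -sqrtr_gt0 radius_gt0.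
    move=> v nv; apply/eqP => v0; move: nv; rewrite v0 /nsq !planeE !sub0r.
    by rewrite !sqrrN ltxx.
  suff : \forall v \near w, S (mu (phi (ux v))) by [].
  near=> v; apply: eS; apply: h2.
  have v0 : v != 0 by near: v.
  have : 0 < orient (mu b) (mu a) (unitv v) by near: v; apply: (cvgr_gt _ ho).
  rewrite -hux // => /orient_gt0 h; rewrite -/(ccw _ _ _).
  have h' : ccw a (ux v) b by clear -h; cyc.
  exact: mp.
have r1 := @cvg_re _ _ (nbhs w) _ _ _ hm; have i1 := @cvg_im _ _ (nbhs w) _ _ _ hm.
apply: (@cvg_plane _ _ (nbhs w)).
  under eq_fun do rewrite /conj_map reM re_real im_real mul0r subr0.
  rewrite /conj_map reM re_real im_real mul0r subr0.
  by apply: cvgM; [exact: hr|exact: r1].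
under eq_fun do rewrite /conj_map imM re_real im_real mul0r addr0.
rewrite /conj_map imM re_real im_real mul0r addr0.
by apply: cvgM; [exact: hr|exact: i1].
Unshelve. all: by end_near. Qed.
End Radial.

Lemma pl_asymp phi : pl phi -> exists f : C -> C,
  asymp_rigid f /\ forall x, f (mu x) = mu (phi x).
Proof.
move=> [mp sp [B [A [dA fA]]]]; have [ux hux] := radial_angle.
have /choice[psi phiK] := sp.
have psiK : cancel phi psi by move=> x; apply: (ccw_mono_inj mp); rewrite phiK.
have mpsi : ccw_mono psi by move=> x y z h; apply: (ccw_reflect mp); rewrite !phiK.
have spsi : surj psi by move=> y; exists (phi y).
exists (conj_map ux phi); split; last by move=> x; apply: conj_map_cayley.
have K := conj_mapK hux psiK; have K' := conj_mapK hux phiK.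
split.
- split.
  + by move=> w; apply: conj_map_disc.
  + by move=> w v _ _; apply: (can_inj K).
  + move=> w dw; exists (conj_map ux psi w); last exact: K'.
    exact: conj_map_disc.
- exists (conj_map ux psi) => //.
  by apply: continuous_subspaceT => w; apply: conj_map_cvg.
- by apply: continuous_subspaceT => w; apply: conj_map_cvg.
- exists B, A; split=> // t.
  by rewrite conj_map_cayley // fA mobius_mob.
Qed.

End BoundaryMap.

(** * Simple transitivity on marked tessellations *)

Section Transitivity.
Context {R : realType}.
Local Notation C := (plane R).
Local Notation P := (option R).
Local Notation mu := (@cayley R).
Implicit Types (x y z p q r : P) (phi : P -> P) (B : seq rat).

Definition cell B (t s : R) := forall b : rat, b \in B -> (ratr b < t) = (ratr b < s).

Lemma cellC B t s : cell B t s -> cell B s t.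
Proof. by move=> h b /h. Qed.

Lemma count_cell B (t s : R) :
  count (fun b : rat => ratr b < t) B = count (fun b : rat => ratr b < s) B ->
  cell B t s.
Proof.
wlog ts : t s / t <= s => [H e|].
  by case: (leP t s) => h; [exact: H|apply/cellC/H; rewrite ?ltW].
move=> e b bB; apply/idP/idP => h; first exact: lt_le_trans ts.
apply: contrapT => /negP nh.
have sub (c : rat) : ratr c < t -> ratr c < s by move=> hc; exact: lt_le_trans ts.
have := @count_lt _ (fun b : rat => ratr b < t) (fun b : rat => ratr b < s) B b
  (mem_In bB) sub nh h.
by rewrite e ltnn.
Qed.

(** Local form of [pieces]: one matrix for each cell of [B], without numbering the cells, so that
    gluing maps amounts to concatenating lists of breakpoints. *)
Definition piecewise_on (S : set P) phi B := forall t : R, S (Some t) ->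
  exists2 A : 'M[int]_2, \det A = 1 &
  forall s, cell B t s -> S (Some s) -> phi (Some s) = mob A (Some s).

Lemma piecewise_pieces phi B : piecewise_on setT phi B -> exists A, pieces phi B A.
Proof.
move=> h; have H (k : nat) : exists A : 'M[int]_2, \det A = 1 /\
    forall t : R, count (fun b : rat => ratr b < t) B = k -> phi (Some t) = mob A (Some t).
  have [[t et]|no] := pselect (exists t : R, count (fun b : rat => ratr b < t) B = k).
    have [A dA hA] := h t I; exists A; split=> // s es; apply: hA => //.
    by apply: count_cell; rewrite et es.
  exists 1%:M; split; first exact: det1.
  by move=> t et; case: no; exists t.
have [A hA] := choice H; exists A; split=> [k|t]; first by case: (hA k).
by case: (hA (count (fun b : rat => ratr b < t) B)) => _; apply.
Qed.

(** Closed at [q] only, like the cells of [B]: since [ratr b < t] is strict, a breakpoint belongs to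
    the piece on its left. *)
Definition hopen p q : set P := [set x | ccw p x q \/ x = q].

Definition arc_iso tau tau' phi B p q p' q' := [/\ phi p = p' /\ phi q = q',
  forall x y, ccw p x y -> cl p q y -> ccw p' (phi x) (phi y),
  forall y', ccw p' y' q' -> exists2 x, ccw p x q & phi x = y',
  forall x y, cl p q x -> cl p q y -> E tau x y <-> E tau' (phi x) (phi y)
  & piecewise_on (hopen p q) phi B].

Definition good tau tau' p q p' q' := exists phi B, arc_iso tau tau' phi B p q p' q'.

(** The breakpoints contributed by a rational end of an arc: none at infinity, where pieces end
    anyway. *)
Definition fin_pt x : seq rat :=
  if pselect (exists b : rat, x = Some (ratr b)) is left h then [:: projT1 (cid h)] else [::].

Lemma fin_ptP x : ratp x -> forall t s : R, cell (fin_pt x) t s ->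
  (ltp x (Some t) /\ ltp x (Some s)) \/ (~ ltp x (Some t) /\ ~ ltp x (Some s)).
Proof.
move=> [[b|] ->] t s; last first.
  by move=> _; right; split=> h; apply: (ltp2 h); apply: ltp_None.
rewrite /fin_pt; case: pselect => [h|[]]; last by exists b.
case: (cid h) => /= c [] /(fmorph_inj _) <- /(_ b); rewrite inE eqxx => /(_ isT) e.
rewrite /ltp !lp_mono e; case: (ratr b < s); [by left|by right].
Qed.

Lemma cell_cat B1 B2 (t s : R) : cell (B1 ++ B2) t s -> cell B1 t s /\ cell B2 t s.
Proof. by move=> h; split=> b bB; apply: h; rewrite mem_cat bB ?orbT. Qed.

Definition glue p r (phi psi : P -> P) x := if `[< cl p r x >] then phi x else psi x.

Lemma glueL p r phi psi x : cl p r x -> glue p r phi psi x = phi x.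
Proof. by move=> h; rewrite /glue asboolT. Qed.
Lemma glueR p r phi psi x : ~ cl p r x -> glue p r phi psi x = psi x.
Proof. by move=> h; rewrite /glue asboolF. Qed.

Lemma hopen_cell p r (t s : R) : ratp p -> ratp r -> p <> r ->
  cell (fin_pt p ++ fin_pt r) t s -> hopen p r (Some t) -> hopen p r (Some s).
Proof.
move=> rp rr pr /cell_cat[/(fin_ptP rp) hp /(fin_ptP rr) hr].
rewrite /hopen /=; have N (u v : P) : ~ ltp u v -> u = v \/ ltp v u.
  move=> h; case: (pselect (u = v)) => [|/ltp_neq[]]; [by left|by []|by right].
have h1 := ltp_None t; have h2 := ltp_None s.
move=> ht; apply: contrapT; rewrite not_orP => -[n1 n2].
have hp' : (ltp p (Some t) /\ ltp p (Some s)) \/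
   ((p = Some t \/ ltp (Some t) p) /\ (p = Some s \/ ltp (Some s) p)).
  by case: hp => -[a b]; [left|right; split; apply: N].
have hr' : (ltp r (Some t) /\ ltp r (Some s)) \/
   ((r = Some t \/ ltp (Some t) r) /\ (r = Some s \/ ltp (Some s) r)).
  by case: hr => -[a b]; [left|right; split; apply: N].
clear -hp' hr' ht n1 n2 pr.
case: hp' => -[]; case: hr' => -[]; case: ht => ht; cyc.
Qed.

Lemma hopen_cl p q x : p <> q -> hopen p q x -> cl p q x.
Proof. by move=> pq [|->]; [right; right|apply: cl_r]. Qed.

(** An edge joining the two sub-arcs away from [r] crosses [p r] or [r q], unless it is [p q]. So in
    both tessellations the edges of the arc are those of the two sub-arcs together with the edge
    between its ends. *)
Lemma good_glue tau tau' p r q p' r' q' : ctess tau -> ctess tau' ->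
  ccw p r q -> ccw p' r' q' -> ratp p -> ratp r -> ratp q ->
  E tau p q -> E tau p r -> E tau r q -> E tau' p' q' -> E tau' p' r' -> E tau' r' q' ->
  good tau tau' p r p' r' -> good tau tau' r q r' q' -> good tau tau' p q p' q'.
Proof.
move=> [_ nc _ _ _] [_ nc' _ _ _] prq prq' rp rr rq Epq Epr Erq Epq' Epr' Erq'.
move=> [f [B1 [[fp fr] mf sf ef pf]]] [g [B2 [[gr gq] mg sg eg pg]]].
have [pr rq0 qp] := ccw_neq prq; have [pr' rq0' qp'] := ccw_neq prq'.
pose h := glue p r f g.
have hl x : cl p r x -> h x = f x by exact: glueL.
have hr x : cl r q x -> h x = g x.
  move=> hx; have [e|nx] := pselect (x = r); first by rewrite e hl ?fr ?gr //; apply: cl_r.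
  by apply: glueR; clear -hx nx prq; cyc.
have split_cl x : cl p q x -> cl p r x \/ ccw r x q \/ x = q.
  by move=> hx; case: (pselect (cl p r x)); [left|right; clear -b hx prq; case: (pselect (x = q)); [right|left]; cyc].
have fin x : ccw p x r -> ccw p' (f x) r'.
  by move=> hx; rewrite -fr; apply: mf => //; apply: cl_r.
have gin x : ccw r x q -> ccw r' (g x) q'.
  by move=> hx; rewrite -gq; apply: mg => //; apply: cl_r.
have crossl x y : ccw p x r -> ccw r y q \/ y = q -> cross p r x y.
  by move=> h1 h2; clear -h1 h2 prq; split; cyc.
have crossr x y : ccw p x r \/ x = p -> ccw r y q -> cross r q y x.
  by move=> h1 h2; clear -h1 h2 prq; split; cyc.
have crossl' x y : ccw p' x r' -> ccw r' y q' \/ y = q' -> cross p' r' x y.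
  by move=> h1 h2; clear -h1 h2 prq'; split; cyc.
have crossr' x y : ccw p' x r' \/ x = p' -> ccw r' y q' -> cross r' q' y x.
  by move=> h1 h2; clear -h1 h2 prq'; split; cyc.
have mixed x y : ccw p x r \/ x = p -> ccw r y q \/ y = q ->
    E tau x y <-> E tau' (h x) (h y).
  move=> hx hy.
  have ex : h x = f x by apply: hl; clear -hx; case: hx; [right; right|left].
  have ey : h y = g y by apply: hr; clear -hy; case: hy; [right; right|right; left].
  rewrite ex ey; case: hx => [hx|->].
    split=> Exy; exfalso; first exact: (nc _ _ _ _ Epr Exy (crossl _ _ hx hy)).
    apply: (nc' _ _ _ _ Epr' Exy (crossl' _ _ (fin _ hx) _)).
    by case: hy => [/gin|->]; [left|right].
  rewrite fp; case: hy => [hy|->]; last by rewrite gq.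
  split=> Exy; exfalso; first exact: (nc _ _ _ _ Erq (EC Exy) (crossr _ _ (or_intror erefl) hy)).
  exact: (nc' _ _ _ _ Erq' (EC Exy) (crossr' _ _ (or_intror erefl) (gin _ hy))).
exists h, (B1 ++ B2 ++ fin_pt p ++ fin_pt r ++ fin_pt q); split.
- split; first by rewrite hl ?fp //; apply: cl_l.
  by rewrite hr ?gq //; apply: cl_r.
- move=> x y pxy py; have [yl|yr] := split_cl _ py.
    have xl : cl p r x by clear -pxy yl; cyc.
    by rewrite !hl //; apply: mf.
  have yr' : cl r q y by clear -yr; cyc.
  have gy : ccw r' (g y) q' \/ g y = q' by case: yr => [/gin|->]; [left|right].
  rewrite (hr y) //; have [xl|xr] := pselect (cl p r x); last first.
    have rxy : ccw r x y by clear -xr pxy yr' prq yr; cyc.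
    rewrite hr; last by clear -rxy yr'; cyc.
    by have hxy := mg _ _ rxy yr'; clear -hxy gy prq'; cyc.
  rewrite hl //; have [->|xr] := pselect (x = r).
    by rewrite fr; clear -gy prq'; cyc.
  have /fin hx : ccw p x r by clear -xl xr pxy; cyc.
  by clear -hx gy prq'; cyc.
- move=> y hy; have [->|yr] := pselect (y = r').
    by exists r; rewrite ?hl ?fr //; apply: cl_r.
  have [hy'|hy'] : ccw p' y r' \/ ccw r' y q' by clear -hy yr prq'; cyc.
    have [x hx <-] := sf _ hy'; exists x; first by clear -hx prq; cyc.
    by apply: hl; right; right.
  have [x hx <-] := sg _ hy'; exists x; first by clear -hx prq; cyc.
  by apply: hr; right; right.
- move=> x y /split_cl[xl|xr] /split_cl[yl|yr].
  + by rewrite !hl //; apply: ef.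
  + have [exr|nxr] := pselect (x = r).
      have hxx : cl r q x by rewrite exr; apply: cl_l.
      have hyy : cl r q y by clear -yr; cyc.
      by rewrite !hr //; apply: eg.
    by apply: mixed => //; clear -xl nxr; cyc.
  + have [eyr|nyr] := pselect (y = r).
      have hyy : cl r q y by rewrite eyr; apply: cl_l.
      have hxx : cl r q x by clear -xr; cyc.
      by rewrite !hr //; apply: eg.
    have hy : ccw p y r \/ y = p by clear -yl nyr; cyc.
    by have [m1 m2] := mixed _ _ hy xr; split=> /EC; [move/m1|move/m2]; apply: EC.
  + have hxx : cl r q x by clear -xr; cyc.
    have hyy : cl r q y by clear -yr; cyc.
    by rewrite !hr //; apply: eg.
- move=> t ht.
  have [tl|tr] : hopen p r (Some t) \/ hopen r q (Some t).
    by rewrite /hopen /=; clear -ht prq; case: ht => ht; case: (pselect (ccw p (Some t) r)) => h;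
      [left; left|case: (pselect (Some t = r)) => h'; [left; right|right; left; cyc]|
       left; left|right; right].
  + have [A dA hA] := pf _ tl; exists A => // s.
    move=> /cell_cat[c1 /cell_cat[c2 /[dup] /cell_cat[c3 c4] c5]] hs.
    have c6 : cell (fin_pt p ++ fin_pt r) t s.
      move=> b; rewrite mem_cat => /orP[/c3//|bB]; apply: c4.
      by rewrite mem_cat bB.
    have hs' := hopen_cell rp rr pr c6 tl.
    by rewrite hl; [apply: hA|apply: hopen_cl].
  + have [A dA hA] := pg _ tr; exists A => // s.
    move=> /cell_cat[c1 /cell_cat[c2 /cell_cat[c3 c4]]] hs.
    have hs' := hopen_cell rr rq rq0 c4 tr.
    by rewrite hr; [apply: hA|apply: hopen_cl].
Qed.

Lemma edge_side tau p q a b : ctess tau -> E tau p q -> E tau a b ->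
  (cl p q a /\ cl p q b) \/ (cl q p a /\ cl q p b).
Proof.
move=> ct Epq Eab; have pq := ctess_neq ct Epq; have [_ nc _ _ _] := ct.
have n1 := nc _ _ _ _ Epq Eab; have n2 := nc _ _ _ _ Epq (EC Eab).
have [ha|ha] := cl_cases a pq; have [hb|hb] := cl_cases b pq; [by left| | |by right].
  have [e|na] := pselect (a = p); first by right; split=> //; rewrite e; apply: cl_r.
  have [e|na'] := pselect (a = q); first by right; split=> //; rewrite e; apply: cl_l.
  have [e|nb] := pselect (b = p); first by left; split=> //; rewrite e; apply: cl_l.
  have [e|nb'] := pselect (b = q); first by left; split=> //; rewrite e; apply: cl_r.
  by exfalso; apply: n1; clear -ha hb na na' nb nb'; split; cyc.
have [e|na] := pselect (a = p); first by left; split=> //; rewrite e; apply: cl_l.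
have [e|na'] := pselect (a = q); first by left; split=> //; rewrite e; apply: cl_r.
have [e|nb] := pselect (b = p); first by right; split=> //; rewrite e; apply: cl_r.
have [e|nb'] := pselect (b = q); first by right; split=> //; rewrite e; apply: cl_l.
by exfalso; apply: n2; clear -ha hb na na' nb nb'; split; cyc.
Qed.

Definition farey_on tau p q := forall x y, E tau x y -> cl p q x -> cl p q y -> fa x y.

(** By maximality it suffices that the Farey edge crosses no edge of [tau]: those within the arc are
    Farey edges, and those on the other side of [p q] stay away. *)
Lemma farey_on_full tau p q x y : ctess tau -> E tau p q -> farey_on tau p q ->
  cl p q x -> cl p q y -> fa x y -> E tau x y.
Proof.
move=> ct Epq ft px py f; apply: (ctess_max ct (fa_neq f)) => a b Eab cr.
have pq := ctess_neq ct Epq.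
have [[ha hb]|[ha hb]] := edge_side ct Epq Eab.
- exact: fa_noncross (ft _ _ Eab ha hb) f cr.
- by case: cr; clear -ha hb px py pq; cyc.
Qed.

Lemma good_farey tau tau' p q p' q' : ctess tau -> ctess tau' ->
  E tau p q -> E tau' p' q' -> farey_on tau p q -> farey_on tau' p' q' ->
  good tau tau' p q p' q'.
Proof.
move=> ct ct' Epq Epq' ft ft'.
have pq := ctess_neq ct Epq.
have fpq : fa p q by apply: ft => //; [apply: cl_l|apply: cl_r].
have fpq' : fa p' q' by apply: ft' => //; [apply: cl_l|apply: cl_r].
have [A [dA Ap Aq]] := mob_edge fpq fpq'.
have mA := mob_mono dA; have iA := mob_inj dA.
have clA x : cl p q x <-> cl p' q' (mob A x).
  rewrite -Ap -Aq /cl; split=> [[->|[->|h]]|[/iA ->|[/iA ->|h]]].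
  - by left.
  - by right; left.
  - by right; right; apply: mA.
  - by left.
  - by right; left.
  - by right; right; apply/(mob_ccw _ _ _ dA).
exists (mob A), [::]; split=> //.
- by move=> x y h _; rewrite -Ap; apply: mA.
- move=> y; have [x <-] := mob_surj dA y; rewrite -Ap -Aq => h.
  by exists x => //; apply/(mob_ccw _ _ _ dA).
- move=> x y hx hy; split=> Exy.
    apply: (farey_on_full ct' Epq' ft') => //; [exact/clA|exact/clA|].
    by apply: mob_fa => //; apply: ft.
  apply: (farey_on_full ct Epq ft hx hy) => //.
  rewrite -(adj2K x dA) -(adj2K y dA); apply: mob_fa; first exact: adj2_det.
  exact: ft' _ _ Exy ((clA _).1 hx) ((clA _).1 hy).
- by move=> t _; exists A.
Qed.

Lemma exists_rho (S : set (set (R -> C))) : finite_set S ->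
  exists2 rho : R, rho < 1 & forall x y, x <> y -> S (arc x y) -> meets rho x y.
Proof.
move=> /finite_list[L hL].
suff [rho r1 h] : exists2 rho : R, rho < 1 & forall x y, x <> y -> List.In (arc x y) L -> meets rho x y.
  by exists rho => // x y xy /hL; apply: h.
elim: L {S hL} => [|A L [rho r1 IH]]; first by exists 0.
have [[x [y [xy eA]]]|no] := pselect (exists x y, x <> y /\ A = arc x y); last first.
  by exists rho => // x y xy [eA|]; [case: no; exists x, y|apply: IH].
pose w := lin (1 / 2) (mu x) (mu y).
have xyw : onch x y w by split; [exact: lin_disc xy (@half01 R)|exact: orient_chord].
exists (Num.max rho (nsq w)).
  by rewrite gt_max r1; apply/discE; case: xyw.
move=> a b ab [e|/(IH _ _ ab)[v hv nv]]; last by exists v => //; rewrite le_max nv.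
have nw : nsq w <= Num.max rho (nsq w) by rewrite le_max lexx orbT.
rewrite eA in e; have := arc_inj xy e; case=> -[<- <-]; exists w => //.
exact: onchC.
Qed.

(** The disc is taken large enough to meet [p0 q0] and all non-Farey edges. An edge that misses it
    and has [p0 q0] on one side cannot have a non-Farey edge on the other. *)
Lemma exists_farey_rho tau p0 q0 : ctess tau -> E tau p0 q0 ->
  exists rho : R, [/\ rho < 1, meets rho p0 q0 &
    forall p q, E tau p q -> cl q p p0 -> cl q p q0 -> ~ meets rho p q ->
    farey_on tau p q].
Proof.
move=> ct E0; have [_ _ _ _ fF] := ct.
have fS : finite_set ((tau `\` farey) `|` [set arc p0 q0]).
  by rewrite finite_setU; split=> //; exact: finite_set1.
have [rho r1 h] := exists_rho fS; have pq0 := ctess_neq ct E0.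
have m0 : meets rho p0 q0 by apply: h => //; right.
exists rho; split=> // p q Epq h1 h2 nm x y Exy hx hy.
have xy := ctess_neq ct Exy; apply/farey_arc => //; apply: contrapT => nf; apply: nm.
apply: (meets_sep_edges (ctess_neq ct Epq) r1 xy pq0 _ m0 hx hy h1 h2).
by apply: h => //; left.
Qed.

Lemma ctess_ratp tau x y : ctess tau -> E tau x y -> ratp x /\ ratp y.
Proof.
move=> ct Exy; have [tA _ _ _ _] := ct; have [a [b [ab ra rb e]]] := tA _ Exy.
by have := arc_inj (ctess_neq ct Exy) e; case=> -[-> ->].
Qed.

(** Two nested descents. Until [tau] is Farey on the arc, both arcs are split at their apexes; from
    there the descent runs on [tau'], and the Farey arc of [tau] is split along with it, its parts
    being Farey again. *)
Lemma good_arc tau tau' p0 q0 p0' q0' : ctess tau -> ctess tau' ->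
  E tau p0 q0 -> E tau' p0' q0' -> good tau tau' p0 q0 p0' q0'.
Proof.
move=> ct ct' E0 E0'.
have [rho [r1 _ hrho]] := exists_farey_rho ct E0.
have [rho' [r1' _ hrho']] := exists_farey_rho ct' E0'.
have [_ _ apex _ _] := ct; have [_ _ apex' _ _] := ct'.
have glu p r q p' r' q' : ccw p r q -> ccw p' r' q' ->
    E tau p q -> E tau p r -> E tau r q -> E tau' p' q' -> E tau' p' r' -> E tau' r' q' ->
    good tau tau' p r p' r' -> good tau tau' r q r' q' -> good tau tau' p q p' q'.
  move=> h1 h2 Epq Epr Erq Epq' Epr' Erq'.
  have [rp rr] := ctess_ratp ct Epr; have [_ rq] := ctess_ratp ct Erq.
  exact: good_glue.
suff H p q : E tau p q -> cl q p p0 -> cl q p q0 -> forall p' q', E tau' p' q' ->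
    cl q' p' p0' -> cl q' p' q0' -> good tau tau' p q p' q'.
  by apply: H => //; first [apply: cl_l|apply: cl_r].
move: p q; apply: (descent ct r1).
  move=> p q Epq h1 h2 nm p' q' Epq' h1' h2'.
  have ft := hrho _ _ Epq h1 h2 nm; clear h1 h2 nm.
  move: p' q' Epq' h1' h2' p q Epq ft; apply: (descent ct' r1').
    move=> p' q' Epq' h1' h2' nm' p q Epq ft.
    by apply: good_farey => //; apply: hrho'.
  move=> p' r' q' Epq' h1' h2' prq' Epr' Erq' Q1 Q2 p q Epq ft.
  have [r [prq Epr Erq]] := apex _ _ Epq.
  apply: (glu _ _ _ _ _ _ prq prq') => //; [apply: Q1 => //|apply: Q2 => //] => x y Exy hx hy;
    apply: ft => //.
  - exact: cl_left prq hx.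
  - exact: cl_left prq hy.
  - exact: cl_right prq hx.
  - exact: cl_right prq hy.
move=> p r q Epq h1 h2 prq Epr Erq Q1 Q2 p' q' Epq' h1' h2'.
have [r' [prq' Epr' Erq']] := apex' _ _ Epq'.
apply: (glu _ _ _ _ _ _ prq prq') => //; [apply: Q1 => //|apply: Q2 => //].
- exact: cl_out_left prq' h1'.
- exact: cl_out_left prq' h2'.
- exact: cl_out_right prq' h1'.
- exact: cl_out_right prq' h2'.
Qed.

Lemma transitivity_pl tau tau' p q p' q' : ctess tau -> ctess tau' ->
  E tau p q -> E tau' p' q' -> exists phi, [/\ pl phi, phi p = p', phi q = q' &
    forall x y, E tau x y <-> E tau' (phi x) (phi y)].
Proof.
move=> ct ct' Epq Epq'.
have [f [B1 [[fp fq] mf sf ef pf]]] := good_arc ct ct' Epq Epq'.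
have [g [B2 [[gq gp] mg sg eg pg]]] := good_arc ct ct' (EC Epq) (EC Epq').
have pq := ctess_neq ct Epq; have pq' := ctess_neq ct' Epq'.
have [rp rq] := ctess_ratp ct Epq.
pose h := glue p q f g.
have hl x : cl p q x -> h x = f x by exact: glueL.
have hr x : cl q p x -> h x = g x.
  move=> hx; have [->|np] := pselect (x = p); first by rewrite hl ?fp ?gp //; apply: cl_l.
  have [->|nq] := pselect (x = q); first by rewrite hl ?fq ?gq //; apply: cl_r.
  by apply: glueR; clear -hx np nq; cyc.
have hp : h p = p' by rewrite hl ?fp //; apply: cl_l.
have hq : h q = q' by rewrite hl ?fq //; apply: cl_r.
have fin x : ccw p x q -> ccw p' (h x) q'.
  move=> hx; rewrite hl; last by right; right.
  by rewrite -fq; apply: mf => //; apply: cl_r.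
have gin x : ccw q x p -> ccw q' (h x) p'.
  move=> hx; rewrite hr; last by right; right.
  by rewrite -gp; apply: mg => //; apply: cl_r.
have mono_p x y : ccw p x y -> ccw p' (h x) (h y).
  move=> pxy; have [yl|yr] := cl_cases y pq.
    have xl : cl p q x by clear -pxy yl; cyc.
    by rewrite !hl //; apply: mf.
  have [yq|nyq] := pselect (y = q).
    by rewrite yq hq; apply: fin; rewrite -yq.
  have /gin hy : ccw q y p by clear -yr pxy nyq; cyc.
  have [xq|nxq] := pselect (x = q).
    by rewrite xq hq; clear -hy; cyc.
  have [xl|xr] := cl_cases x pq.
    have /fin hx : ccw p x q by clear -xl pxy nxq; cyc.
    by clear -hx hy; cyc.
  have qxy : ccw q x y by clear -xr pxy nxq yr nyq; cyc.
  have := mg _ _ qxy yr; rewrite -!hr // => hxy.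
  by clear -hxy hy; cyc.
have mh : ccw_mono h.
  move=> x y z xyz; have [xp|nxp] := pselect (x = p).
    by rewrite xp hp; apply: mono_p; rewrite -xp.
  have [yp|nyp] := pselect (y = p).
    have := @mono_p z x; rewrite yp hp => k; apply: ccw_rot; apply: ccw_rot; apply: k.
    by have := ccw_rot xyz; rewrite yp.
  have [zp|nzp] := pselect (z = p).
    by rewrite zp hp; apply: ccw_rot; apply: mono_p; rewrite -zp; do 2!apply: ccw_rot.
  have m1 := @mono_p x y; have m2 := @mono_p y z; have m3 := @mono_p z x.
  (* Seen from [p] the circle is a line, along which two of the three consecutive pairs increase. *)
  have [[c1 c2]|[[c1 c2]|[c1 c2]]] : (ccw p x y /\ ccw p y z) \/
    (ccw p y z /\ ccw p z x) \/ (ccw p z x /\ ccw p x y).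
    by clear -xyz nxp nyp nzp; case: (pselect (ccw p x y)) => h1;
      case: (pselect (ccw p y z)) => h2; [left|right; right|right; left|]; try split; cyc.
  - by have k1 := m1 c1; have k2 := m2 c2; clear -k1 k2; cyc.
  - by have k1 := m2 c1; have k2 := m3 c2; clear -k1 k2; cyc.
  - by have k1 := m3 c1; have k2 := m1 c2; clear -k1 k2; cyc.
have sh : surj h.
  move=> y; have [->|np] := pselect (y = p'); first by exists p.
  have [->|nq] := pselect (y = q'); first by exists q.
  have [hy|hy] : ccw p' y q' \/ ccw q' y p'.
    by case: (pselect (ccw p' y q')) => k; [left|right; clear -k np nq pq'; cyc].
  - by have [x hx <-] := sf _ hy; exists x; apply: hl; right; right.
  - by have [x hx <-] := sg _ hy; exists x; apply: hr; right; right.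
exists h; split=> //; last first.
  have [_ nc _ _ _] := ct; have [_ nc' _ _ _] := ct'.
  have mixed x y : ccw p x q -> ccw q y p -> E tau x y <-> E tau' (h x) (h y).
    move=> hx hy; split=> Exy; exfalso.
      exact: (nc _ _ _ _ Epq Exy (conj hx hy)).
    exact: (nc' _ _ _ _ Epq' Exy (conj (fin _ hx) (gin _ hy))).
  move=> x y; have [xl|xl] := pselect (cl p q x); have [yl|yl] := pselect (cl p q y).
  - by rewrite !hl //; apply: ef.
  - have hy : ccw q y p by clear -yl pq; cyc.
    have [xr|xr] := pselect (cl q p x).
      by rewrite !hr //; [apply: eg => //|]; right; right.
    by apply: mixed => //; clear -xl xr pq; cyc.
  - have hx : ccw q x p by clear -xl pq; cyc.
    have [yr|yr] := pselect (cl q p y).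
      by rewrite !hr //; [apply: eg => //|]; right; right.
    have hy : ccw p y q by clear -yl yr pq; cyc.
    by have [m1 m2] := mixed _ _ hy hx; split=> /EC; [move/m1|move/m2]; apply: EC.
  - have hx : cl q p x by clear -xl pq; cyc.
    have hy : cl q p y by clear -yl pq; cyc.
    by rewrite !hr //; apply: eg.
split=> //; exists (B1 ++ B2 ++ fin_pt p ++ fin_pt q); apply: piecewise_pieces.
move=> t _.
have [tl|tr] : hopen p q (Some t) \/ hopen q p (Some t).
  rewrite /hopen /=; clear -pq; case: (pselect (Some t = q)) => [|h1]; first by left; right.
  case: (pselect (Some t = p)) => [|h2]; first by right; right.
  by case: (pselect (ccw p (Some t) q)) => h3; [left; left|right; left; cyc].
- have [A dA hA] := pf _ tl; exists A => // s.
  move=> /cell_cat[c1 /cell_cat[c2 c3]] _.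
  have hs' := hopen_cell rp rq pq c3 tl.
  by rewrite hl; [apply: hA|apply: hopen_cl].
- have [A dA hA] := pg _ tr; exists A => // s.
  move=> /cell_cat[c1 /cell_cat[c2 /cell_cat[c3 c4]]] _.
  have c5 : cell (fin_pt q ++ fin_pt p) t s.
    by move=> b; rewrite mem_cat => /orP[/c4|/c3].
  have qp : q <> p by move=> e; apply: pq.
  have hs' := hopen_cell rq rp qp c5 tr.
  by rewrite hr; [apply: hA|apply: hopen_cl].
Qed.

End Transitivity.

(** * The actions of the mapping class group *)

Section Actions.
Context {R : realType}.
Local Notation C := (plane R).
Local Notation P := (option R).
Local Notation mu := (@cayley R).
Implicit Types (x y z p q r : P) (phi psi : P -> P) (m : mcg R)
  (tau : set (set (R -> C))).

(** Products of classes enter only through their boundary maps, as [acts m'' (psi \o phi)]; by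
    [acts_inj], [phi] determines the class. *)
Definition acts m phi := [/\ pl phi, exists f, mcg_class m f &
  forall f, mcg_class m f -> asymp_rigid f /\ forall x, f (mu x) = mu (phi x)].

Lemma asymp_disc (f : C -> C) w : asymp_rigid f -> disc w -> disc (f w).
Proof. by move=> [bf _ _ _]; apply: fdisc. Qed.

Lemma map_classE (f : C -> C) : asymp_rigid f -> map_class f =
  [set g | asymp_rigid g /\ forall x, g (mu x) = f (mu x)].
Proof.
move=> af; have [_ _ cf _] := af.
have H g : asymp_rigid g -> disc_homotopic f g <-> forall x, g (mu x) = f (mu x).
  move=> ag; have [_ _ cg _] := ag.
  rewrite (disc_homotopicP cf cg (fun w => @asymp_disc f w af) (fun w => @asymp_disc g w ag)).
  split=> [h x|h w]; first by rewrite h //; apply: cayley_circle.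
  by move=> /cayley_surj[x <-].
by apply/seteqP; split=> g /= [ag]; move/(H _ ag).
Qed.

Lemma mcg_acts m : exists phi, acts m phi.
Proof.
case: m => c [f af ec]; have [phi [pp hphi]] := asymp_pl af.
exists phi; split=> //=.
  by exists f; rewrite ec map_classE.
by move=> g; rewrite ec map_classE // => -[ag hg]; split=> // x; rewrite hg.
Qed.

Lemma pl_acts phi : pl phi -> exists m, acts m phi.
Proof.
move=> pp; have [f [af hf]] := pl_asymp pp.
exists (Mcg (ex_intro2 _ _ f af erefl)); split=> //=.
  by exists f; rewrite map_classE.
by move=> g; rewrite map_classE // => -[ag hg]; split=> // x; rewrite hg.
Qed.

Lemma acts_inj m m' phi : acts m phi -> acts m' phi -> m = m'.
Proof.
move=> [_ _ hm] [_ _ hm'].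
have e : mcg_class m = mcg_class m'.
  have [g ag ec] := mcgP m; have [g' ag' ec'] := mcgP m'.
  have mg : mcg_class m g by rewrite ec map_classE.
  have mg' : mcg_class m' g' by rewrite ec' map_classE.
  have [_ gE] := hm g mg; have [_ g'E] := hm' g' mg'.
  rewrite ec ec' !map_classE //; apply/seteqP; split=> h [ah hh]; split=> // x;
    by rewrite hh gE g'E.
case: m m' e {hm hm'} => c pc [c' pc'] /= e; subst c'.
by congr Mcg; apply: Prop_irrelevance.
Qed.

Lemma ideal_path_comp (f : C -> C) phi (g : R -> C) x y : asymp_rigid f ->
  (forall z, f (mu z) = mu (phi z)) -> injective phi -> x <> y ->
  dpath x y g -> dpath (phi x) (phi y) (f \o g).
Proof.
move=> af hf ip xy [ig e0 e1]; have [_ _ cf _] := af; have [cg _ _ _ gd] := ig.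
have h0 : (f \o g) 0 = mu (phi x) by rewrite /= e0 hf.
have h1 : (f \o g) 1 = mu (phi y) by rewrite /= e1 hf.
split; [split|exact: h0|exact: h1].
- apply/subspace_continuousP => t ht.
  apply: (cvg_f cf).
  + by apply: (ideal_path_cdisc ig); apply/itv01.
  + near=> s; apply: (ideal_path_cdisc ig); apply/itv01; near: s; exact: withinT.
  + by move/subspace_continuousP: cg; apply.
- by rewrite h0; apply: cayley_circle.
- by rewrite h1; apply: cayley_circle.
- by rewrite h0 h1 => /cayley_inj/ip.
- by move=> t ht; apply: asymp_disc => //; apply: gd.
Unshelve. all: by end_near. Qed.

Lemma act_dpath m phi x y : acts m phi -> x <> y ->
  act_arc m (dpath x y) = dpath (phi x) (phi y).
Proof.
move=> [pp [f0 mf0] hm] xy; have ip := ccw_mono_inj (let: And3 h _ _ := pp in h).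
have comp f g : mcg_class m f -> dpath x y g -> dpath (phi x) (phi y) (f \o g).
  by move=> /hm[af hf] dg; apply: ideal_path_comp.
have pc f g : mcg_class m f -> dpath x y g -> path_class (f \o g) = dpath (phi x) (phi y).
  by move=> mf dg; have [i e0 e1] := comp _ _ mf dg; apply: path_class_dpath.
apply/seteqP; split=> h; first by move=> [f mf [g dg]]; rewrite pc.
move=> dh; exists f0 => //; exists (fun t => lin t (mu x) (mu y)); first exact: dpath_lin.
by rewrite pc //; apply: dpath_lin.
Qed.

Lemma acts_inj_map m phi : acts m phi -> injective phi.
Proof. by move=> [[mp _ _] _ _]; apply: ccw_mono_inj. Qed.

Lemma act_arcE m phi x y : acts m phi -> x <> y ->
  act_arc m (arc x y) = arc (phi x) (phi y).
Proof.
move=> am xy; have yx : y <> x by move=> e; apply: xy.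
rewrite /arc -(act_dpath am xy) -(act_dpath am yx).
apply/seteqP; split=> h.
  by move=> [f mf [g [dg|dg]]] hh; [left|right]; exists f => //; exists g.
by move=> [] [f mf [g dg]] hh; exists f => //; exists g => //; [left|right].
Qed.

Lemma act_tri m phi x y z : acts m phi -> distinct3 x y z ->
  act_triangle m (tri x y z) = tri (phi x) (phi y) (phi z).
Proof.
move=> am [xy yz zx]; rewrite /act_triangle /tri !image_setU !image_set1.
by rewrite !(act_arcE am).
Qed.

Lemma E_act m phi tau x y : acts m phi -> ctess tau ->
  E (act_arc m @` tau) (phi x) (phi y) <-> E tau x y.
Proof.
move=> am ct; have ip := acts_inj_map am; split.
  move=> [A tA]; have [tA' _ _ _ _] := ct; have [a [b [ab _ _ eA]]] := tA' _ tA.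
  rewrite eA (act_arcE am ab) => e.
  have fab : phi a <> phi b by move=> /ip.
  have Eab : E tau a b by rewrite /E -eA.
  by have := arc_inj fab e; case=> -[/ip <- /ip <-] //; apply: EC.
by move=> Exy; exists (arc x y) => //; apply: act_arcE am (ctess_neq ct Exy).
Qed.

Lemma ctess_act m phi tau : acts m phi -> ctess tau -> ctess (act_arc m @` tau).
Proof.
move=> am ct; have [pp _ _] := am; have [mp sp _] := pp; have ip := acts_inj_map am.
have [tA nc apex tV fF] := ct; split.
- move=> _ [A tauA <-]; have [x [y [xy rx ry ->]]] := tA _ tauA.
  exists (phi x), (phi y); rewrite (act_arcE am xy); split=> //.
  + by move=> /ip.
  + exact/pl_ratp.
  + exact/pl_ratp.
- move=> x y a b; have [x' <-] := sp x; have [y' <-] := sp y.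
  have [a' <-] := sp a; have [b' <-] := sp b.
  move=> /(E_act _ _ am ct) h1 /(E_act _ _ am ct) h2 [c1 c2].
  by apply: (nc _ _ _ _ h1 h2); split; apply: (ccw_reflect mp).
- move=> x y; have [x' <-] := sp x; have [y' <-] := sp y.
  move=> /(E_act _ _ am ct)/apex[z [c Exz Ezy]]; exists (phi z).
  by split; [apply: mp|apply/(E_act _ _ am ct)|apply/(E_act _ _ am ct)].
- move=> x; have [x' <-] := sp x; move=> /(pl_ratp _ pp)/tV[y Exy].
  by exists (phi y); apply/(E_act _ _ am ct).
(* A non-Farey edge of the image comes from a non-Farey edge or from one of the finitely many Farey
   edges that [phi] does not keep Farey. *)
- apply: (@sub_finite_set _ _ (act_arc m @` ((tau `\` farey) `|`
    [set A | exists x y, [/\ fa x y, ~ fa (phi x) (phi y) & A = arc x y]]))); last first.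
    by apply: finite_image; rewrite finite_setU; split=> //; apply: pl_fa_finite.
  move=> _ [[A tauA <-] nf]; exists A => //.
  have [fA|nfA] := pselect (farey A); last by left.
  have [x [y [xy _ _ eA]]] := tA _ tauA; right; exists x, y; split=> //.
    by apply/farey_arc; rewrite -?eA.
  move=> f; apply: nf; rewrite eA (act_arcE am xy).
  by apply/farey_arc => // /ip.
Qed.

Lemma oriented_edgeP tau e : oriented_edge tau e <->
  exists p q, [/\ p <> q, e = dpath p q & E tau p q].
Proof.
split.
  move=> [g [ig -> tg]]; have [p [q [pq e0 e1]]] := ideal_pathP ig.
  by exists p, q; rewrite (path_class_dpath ig e0 e1) /E -(arc_classE ig e0 e1).
move=> [p [q [pq -> Epq]]]; exists (fun t => lin t (mu p) (mu q)).
have [ig e0 e1] := dpath_lin pq.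
by rewrite (path_class_dpath ig e0 e1) (arc_classE ig e0 e1).
Qed.

Lemma dpath_inj p q a b : p <> q -> dpath p q = dpath a b -> p = a /\ q = b.
Proof.
move=> pq e; have := dpath_lin pq; have [_ e0 e1] := dpath_lin pq.
rewrite e => -[_ f0 f1].
by split; apply: cayley_inj; [exact: etrans (esym e0) f0|exact: etrans (esym e1) f1].
Qed.

Lemma marked_eq (x y : marked_tessellation R) : mt_edges x = mt_edges y ->
  mt_doe x = mt_doe y -> x = y.
Proof.
case: x y => [t e p1 p2] [t' e' p1' p2'] /= et ee; subst t' e'.
by congr MarkedTessellation; apply: Prop_irrelevance.
Qed.

Lemma dotted_eq (x y : dotted_tessellation R) : dt_edges x = dt_edges y ->
  dt_dot x = dt_dot y -> dt_label x = dt_label y -> x = y.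
Proof.
case: x y => [t d l p1 p2 p3] [t' d' l' p1' p2' p3'] /= et ed el; subst t' d' l'.
by congr DottedTessellation; apply: Prop_irrelevance.
Qed.

Lemma marked_act_exists m (x : marked_tessellation R) :
  exists y : marked_tessellation R, marked_act m x y.
Proof.
have [phi am] := mcg_acts m; have ct := tess_ctess (mt_edgesP x).
have [p [q [pq ed Epq]]] := (oriented_edgeP _ _).1 (mt_doeP x).
have tt := ctess_tess (ctess_act am ct).
have od : oriented_edge (act_arc m @` mt_edges x) (act_arc m (mt_doe x)).
  apply/oriented_edgeP; exists (phi p), (phi q); rewrite ed (act_dpath am pq); split=> //.
    by move=> /(acts_inj_map am).
  exact/(E_act _ _ am ct).
by exists (MarkedTessellation tt od).
Qed.

Lemma marked_transitive (x y : marked_tessellation R) : exists m, marked_act m x y.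
Proof.
have ct := tess_ctess (mt_edgesP x); have ct' := tess_ctess (mt_edgesP y).
have [p [q [pq ed Epq]]] := (oriented_edgeP _ _).1 (mt_doeP x).
have [p' [q' [pq' ed' Epq']]] := (oriented_edgeP _ _).1 (mt_doeP y).
have [phi [pp ep eq hE]] := transitivity_pl ct ct' Epq Epq'.
have [m am] := pl_acts pp; exists m; split.
  have [tA _ _ _ _] := ct; have [tA' _ _ _ _] := ct'; have [_ sp _] := pp.
  apply/seteqP; split=> A.
    move=> tauA; have [a [b [ab _ _ eA]]] := tA' _ tauA.
    have [a' ea] := sp a; have [b' eb] := sp b; rewrite eA -ea -eb.
    by apply/(E_act _ _ am ct)/hE; rewrite ea eb /E -eA.
  move=> [B tauB <-]; have [a [b [ab _ _ eB]]] := tA _ tauB.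
  by rewrite eB (act_arcE am ab); apply/hE; rewrite /E -eB.
by rewrite ed ed' (act_dpath am pq) ep eq.
Qed.

Lemma exists_rat_ccw x y : x <> y -> exists2 r, ratp r & ccw x r y.
Proof.
move=> xy; have [t h] := exists_ccw xy.
have [s st hs] : exists2 s : R, s < t & forall b : R, s < b -> b < t -> ccw x (Some b) y.
  have h1 := ltp_None t; have hl := @ltp_SomeE R.
  case: x xy h => [x0|] xy h; last first.
    exists (t - 1) => [|b sb bt]; first lra.
    by have h2 := hl _ _ bt; clear -h h1 h2; cyc.
  case: (ltrgtP x0 t) => xt.
  - exists x0 => // b sb bt; have h2 := hl _ _ sb; have h3 := hl _ _ bt.
    by clear -h h1 h2 h3; cyc.
  - exists (t - 1) => [|b sb bt]; first lra.
    by have h2 := hl _ _ xt; have h3 := hl _ _ bt; have h4 := ltp_None x0; clear -h h1 h2 h3 h4; cyc.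
  - by rewrite xt in h; clear -h; cyc.
have [b] := rat_in_itvoo st; rewrite in_itv /= => /andP[b1 b2].
by exists (Some (ratr b)); [exact: ratp_rat|exact: hs].
Qed.

(** Rational points [r'] and [r] on both sides of [x] force [g x] between [f r'] and [f r]. They are
    chosen closer to [x] than preimages of points separating [f x] from [g x], so this arc excludes
    [g x]. *)
Lemma mono_eq_rat (f g : P -> P) : ccw_mono f -> surj f -> ccw_mono g ->
  (forall x, ratp x -> f x = g x) -> f = g.
Proof.
move=> mf sf mg e; apply/funext => x; apply: contrapT => ne.
have [m hm] := exists_ccw ne; have [s es] := sf (Some m).
have [n hn] := exists_ccw (fun e => ne (esym e)); have [s' es'] := sf (Some n).
rewrite -es in hm; rewrite -es' in hn.
have h1 : ccw (f x) (f s) (f s') by clear -hm hn; cyc.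
have h2 := ccw_reflect mf h1.
have [xs ss s'x] := ccw_neq h2.
have [r rr hr] := exists_rat_ccw xs; have [r' rr' hr'] := exists_rat_ccw s'x.
have k1 := mf _ _ _ hr; have k2 := mf _ _ _ hr'.
have k3 : ccw r' x r by clear -hr hr' h2; cyc.
have := mg _ _ _ k3; rewrite -(e _ rr) -(e _ rr') => k4.
by clear -k1 k2 k4 hm hn; cyc.
Qed.

Lemma apex_unique tau p q r r' : ctess tau -> ccw p r q -> ccw p r' q ->
  E tau p r -> E tau r q -> E tau p r' -> E tau r' q -> r = r'.
Proof.
move=> [_ nc _ _ _] h h' Epr Erq Epr' Erq'; apply: contrapT => ne.
have [c|c] : ccw p r r' \/ ccw p r' r.
  by case: (pselect (ccw p r r')) => k; [left|right; clear -h h' ne k; cyc].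
- by apply: (nc _ _ _ _ Epr' Erq); split=> //; clear -h'; cyc.
- by apply: (nc _ _ _ _ Epr Erq'); split=> //; clear -h; cyc.
Qed.

(** Apexes are unique, so agreement on an edge passes to the apex beyond it. For a rational [a] on
    an edge [a b], the disc of the descent meets both [p0 q0] and [a b], so agreement reaches [a];
    density of the rational points concludes. *)
Lemma agree_all tau tau' (f g : P -> P) p0 q0 : ctess tau -> ctess tau' ->
  ccw_mono f -> surj f -> ccw_mono g ->
  (forall x y, E tau x y -> E tau' (f x) (f y)) ->
  (forall x y, E tau x y -> E tau' (g x) (g y)) ->
  E tau p0 q0 -> f p0 = g p0 -> f q0 = g q0 -> f = g.
Proof.
move=> ct ct' mf sf mg fE gE E0 ep eq; apply: mono_eq_rat => // a ra.
have [_ _ _ tV _] := ct; have [b Eab] := tV _ ra.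
have [rho r1 hrho] : exists2 rho : R, rho < 1 & forall x y, x <> y ->
    ([set arc p0 q0] `|` [set arc a b]) (arc x y) -> meets rho x y.
  by apply: exists_rho; rewrite finite_setU; split; exact: finite_set1.
have ab := ctess_neq ct Eab; have pq0 := ctess_neq ct E0.
have m0 : meets rho p0 q0 by apply: hrho => //; left.
have m1 : meets rho a b by apply: hrho => //; right.
have key p q : E tau p q -> cl q p p0 -> cl q p q0 ->
    f p = g p -> f q = g q -> cl p q a -> cl p q b -> f a = g a.
  move: p q; apply: (descent ct r1) => [p q Epq h1 h2 nm _ _ ha hb|].
    by case: nm; apply: (meets_sep_edges (ctess_neq ct Epq) r1 ab pq0 m1 m0).
  move=> p r q Epq h1 h2 prq Epr Erq Q1 Q2 fp fq ha hb.
  have fr : f r = g r.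
    have k1 := mf _ _ _ prq; have k2 := mg _ _ _ prq; rewrite -fp -fq in k2.
    have e1 := gE _ _ Epr; have e2 := gE _ _ Erq; rewrite -fp in e1; rewrite -fq in e2.
    exact: apex_unique ct' k1 k2 (fE _ _ Epr) (fE _ _ Erq) e1 e2.
  have [[ha1 hb1]|[ha1 hb1]] := edge_side ct Epr Eab; first exact: Q1.
  have [[ha2 hb2]|[ha2 hb2]] := edge_side ct Erq Eab; first exact: Q2.
  have [->|[->|->]] // : a = p \/ a = q \/ a = r by clear -ha ha1 ha2 prq; cyc.
have [[ha hb]|[ha hb]] := edge_side ct E0 Eab.
  by apply: (key p0 q0) => //; [apply: cl_r|apply: cl_l].
by apply: (key q0 p0) => //; [apply: EC|apply: cl_l|apply: cl_r].
Qed.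


(** * Triangles, dots and labels under the action *)

Lemma trianglesE tau T : ctess tau -> triangles tau T <->
  exists x y z, [/\ ccw x y z, T = tri x y z, E tau x y, E tau y z & E tau z x].
Proof.
move=> ct; split.
  move=> /trianglesP[x [y [z [c -> /triangle_edges[? ? ?]]]]]; by exists x, y, z.
by move=> [x [y [z [c -> ? ? ?]]]]; apply: ctess_triangle.
Qed.

Lemma act_triangles m phi tau : acts m phi -> ctess tau ->
  triangles (act_arc m @` tau) = act_triangle m @` triangles tau.
Proof.
move=> am ct; have [[mp sp _] _ _] := am; have ct' := ctess_act am ct.
apply/seteqP; split=> T.
  move=> /(trianglesE _ ct')[x [y [z]]].
  have [x' <-] := sp x; have [y' <-] := sp y; have [z' <-] := sp z.
  move=> [/(ccw_reflect mp) c ->] /(E_act _ _ am ct) h1 /(E_act _ _ am ct) h2.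
  move=> /(E_act _ _ am ct) h3; exists (tri x' y' z').
    exact: ctess_triangle.
  by apply: act_tri am _; apply: ccw_neq.
move=> [S /(trianglesE _ ct)[x [y [z [c -> h1 h2 h3]]]] <-].
rewrite (act_tri am (ccw_neq c)); apply: ctess_triangle => //; first exact: mp.
- exact/(E_act _ _ am ct).
- exact/(E_act _ _ am ct).
- exact/(E_act _ _ am ct).
Qed.

Lemma distinct3_map phi x y z : injective phi -> distinct3 x y z ->
  distinct3 (phi x) (phi y) (phi z).
Proof. by move=> ip [h1 h2 h3]; split=> /ip. Qed.

Lemma act_triangle_inj m phi tau : acts m phi -> ctess tau ->
  {in triangles tau &, injective (act_triangle m)}.
Proof.
move=> am ct T T' /set_mem/trianglesP[x [y [z [c -> _]]]].
move=> /set_mem/trianglesP[x' [y' [z' [c' -> _]]]].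
have ip := acts_inj_map am; have d := ccw_neq c; have d' := ccw_neq c'.
rewrite !(act_tri am) // => e.
have [m1 m2 m3] := tri_inj (distinct3_map ip d) e.
have back a : mem3 (phi a) (phi x') (phi y') (phi z') -> mem3 a x' y' z'.
  by case=> /ip ->; [apply: Or31|apply: Or32|apply: Or33].
by apply: tri_perm => //; apply: back.
Qed.

Lemma farey_triangle x y z : ccw x y z -> fa x y -> fa y z -> fa z x ->
  triangles farey (tri x y z : set (set (R -> C))).
Proof.
move=> c f1 f2 f3; have [xy yz zx] := ccw_neq c.
have Efa (a b : P) : E farey a b -> fa a b.
  by move=> h; have ab := ideal_arc_neq (proj1 h); apply/farey_arc.
have faE (a b : P) : a <> b -> fa a b -> E farey a b by move=> ab; move/farey_arc; apply.
have nc (a b u v : P) : E farey a b -> E farey u v -> ~ cross a b u v.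
  by move=> /Efa h1 /Efa; apply: fa_noncross.
have [e1 e2 e3] : [/\ E farey x y, E farey y z & E farey z x] by split; apply: faE.
split; first by apply/ideal_triangleP; exists x, y, z.
  by move=> A [->|[->|->]].
apply/seteqP; split=> // w [/region_tri-/(_ (ccw_neq c)) Tw [A fA]].
have [a [b [ab eA]]] := (ideal_arcP A).1 (proj1 fA).
have Eab : E farey a b by rewrite /E -eA.
by rewrite eA => /chordE-/(_ ab); exact: (inT_noncross nc c e1 e2 e3 Tw ab Eab).
Qed.

Lemma omap_ratr_inj (x y : option rat) : omap ratr x = omap ratr y :> P -> x = y.
Proof. by case: x y => [a|] [b|] //= [] /(fmorph_inj _) ->. Qed.

Lemma reduced_det (s : int) (x y : option rat) : s = 1 \/ s = -1 ->
  `|det (reduced_expr s x) (reduced_expr s y)| =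
  `|det (reduced_expr 1 x) (reduced_expr 1 y)|.
Proof.
by case=> -> //; case: x y => [a|] [b|] //=; rewrite /det /= ?(mulN1r, mulrN1, mul1r, mulr1, mul0r, mulr0, subr0, sub0r, oppr0, normrN).
Qed.

(** [middle_vertex] only adds reduced expressions; that the outer vertices have determinant 1 or -1
    comes from their side being a Farey edge. The sign convention for infinity becomes a common
    quadrant, and exchanging the outer vertices makes the determinant -1. *)
Lemma middle_vertexP T v : triangles farey T /\ middle_vertex T v <->
  exists x z y, [/\ fmid x z y, T = tri x z y & v = mu z].
Proof.
split.
  move=> [[_ sub _] [s [x [y [z [hs hpos hred]]]]]].
  move=> /triangle_onP[X [Z [Y [d /cayley_inj eX /cayley_inj eZ /cayley_inj eY eT]]]] ->.
  have s0 : s != 0 by case: hs => ->.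
  have [jX jY] : proj (reduced_expr s x) = X /\ proj (reduced_expr s y) = Y.
    by rewrite !proj_reduced.
  have jZ : proj (reduced_expr s x + reduced_expr s y) = Z.
    by rewrite -hred proj_reduced.
  have hd : `|det (reduced_expr s x) (reduced_expr s y)| = 1.
    rewrite reduced_det //.
    have [_ [x' [y' [jj hdet]]]] : farey (arc Y X).
      by apply: sub; rewrite eT; right; right.
    have {}hdet : `|det (reduced_expr 1 x') (reduced_expr 1 y')| = 1.
      by move: hdet; rewrite /det; case: (reduced_expr 1 x') => ? ?; case: (reduced_expr 1 y').
    have [XZ ZY YX] := d.
    move: jj => /joins_arc-/(_ YX)[] [/cayley_inj e1 /cayley_inj e2]; move: e1 e2;
      rewrite -eX -eY => /omap_ratr_inj e1 /omap_ratr_inj e2.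
      by rewrite detC normrN -e1 -e2.
    by rewrite -e1 -e2.
  have hq (t : option rat) : t \in [:: x; y; z] -> 0 <= (reduced_expr s t).2 /\
      0 <= s * (reduced_expr s t).1.
    case: t => [t|] tin /=; last by case: hs => ->.
    split; first exact: denq_ge0.
    have := hpos _ tin; case: hs => -> /=; first by rewrite !mul1r numq_ge0.
    by rewrite !mulN1r !oppr_ge0 numq_le0.
  have [hx2 hx1] : _ := hq x (mem_head _ _).
  have [hy2 hy1] : _ := hq y ltac:(by rewrite !inE eqxx orbT).
  have qd : quad s (reduced_expr s x) (reduced_expr s y) by split.
  have [e|e] : det (reduced_expr s x) (reduced_expr s y) = -1 \/
      det (reduced_expr s y) (reduced_expr s x) = -1.
    by rewrite (detC (reduced_expr s x)); move: hd; move: (det _ _) => D; lia.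
    exists X, Z, Y; split=> //; last by rewrite /rat_pt eZ.
    by exists s, (reduced_expr s x), (reduced_expr s y).
  exists Y, Z, X; split; last by rewrite /rat_pt eZ.
    exists s, (reduced_expr s y), (reduced_expr s x); split=> //.
    by rewrite addrC.
  by rewrite eT -(tri_rot X Z Y) tri_swap -tri_rot.
move=> [X [Z [Y [fm -> ->]]]]; have [c f1 f2 f3] := fmid_fa fm.
split; first by apply: farey_triangle => //; apply: faC.
have [s [u [w [[hs u2 w2 u1 w1] d eX eY eZ]]]] := fm.
have cu : coprime `|u.1| `|u.2| by apply: (@det1_coprime u w); rewrite d.
have cw : coprime `|w.1| `|w.2| by apply: (@det1_coprime w u); rewrite detC d.
have cuw : coprime `|(u + w).1| `|(u + w).2|.
  by apply: (@det1_coprime _ w); rewrite (_ : det _ _ = -1) // -d /det /=; ring.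
have inf (t : int * int) : coprime `|t.1| `|t.2| -> 0 <= s * t.1 -> t.2 = 0 -> t.1 = s.
  move=> ct st t20; move: ct st; rewrite t20 /coprime gcdn0 => /eqP t1 st.
  by clear -t1 st hs; case: hs st => -> st; lia.
have [x ex rx] := @reduced_coprime R s u cu u2 (inf _ cu u1).
have [y ey ry] := @reduced_coprime R s w cw w2 (inf _ cw w1).
have z1 : 0 <= s * (u + w).1 by rewrite /= mulrDr addr_ge0.
have [z ez rz] := @reduced_coprime R s (u + w) cuw (addr_ge0 u2 w2) (inf _ cuw z1).
exists s, x, y, z; split=> //.
- have pos (t : rat) (k : int * int) : 0 <= s * k.1 -> reduced_expr s (Some t) = k ->
      0 <= s%:~R * t.
    move=> + /= ek; rewrite -ek /=; case: hs => ->.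
      by rewrite !mul1r numq_ge0.
    by rewrite !mulN1r !oppr_ge0 numq_le0.
  move=> t; rewrite !inE => /or3P[] /eqP et.
  + by apply: (pos t u) => //; rewrite et.
  + by apply: (pos t w) => //; rewrite et.
  + by apply: (pos t (u + w)) => //; rewrite et.
- by rewrite rx ry rz.
- apply/triangle_onP; exists X, Z, Y; rewrite /rat_pt -ex -ey -ez eX eY eZ.
  by split=> //; apply: ccw_neq.
- by rewrite /rat_pt -ez eZ.
Qed.

Lemma dotted_act_exists m (x : dotted_tessellation R) :
  exists y : dotted_tessellation R, dotted_act m x y.
Proof.
have [phi am] := mcg_acts m; have ct := tess_ctess (dt_edgesP x).
have tt := ctess_tess (ctess_act am ct).
have [pp [f0 mf0] hm] := am; have ip := acts_inj_map am.
set tau := dt_edges x in ct tt *; set tau' := act_arc m @` tau in tt *.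
have tE := act_triangles am ct.
(* [inv] selects the triangle of [tau] above a triangle of the image; dots and labels are
   transported along it. *)
have /choice[inv hinv] T : exists S, triangles tau' T ->
    triangles tau S /\ act_triangle m S = T.
  have [|nT] := pselect (triangles tau' T); last by exists set0.
  by rewrite tE => -[S tS eS]; exists S.
have invK S : triangles tau S -> inv (act_triangle m S) = S.
  move=> tS; have tS' : triangles tau' (act_triangle m S) by rewrite tE; exists S.
  have [t1 e1] := hinv _ tS'.
  by apply: (act_triangle_inj am ct) e1; apply/mem_set.
have [d [ed cd fd]] := dt_dotP x; have [l el bl] := dt_labelP x.
rewrite -/tau in ed cd fd el bl.
have cornerT S v : triangles tau S -> corner S v -> exists a b c,
    [/\ distinct3 a b c, S = tri a b c & v = mu a].
  by move=> _ [q [r /triangle_onP[a [b [c [dd -> _ _ ->]]]]]]; exists a, b, c.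
pose d' T := f0 (d (inv T)).
have dott : dotting tau' [set Tv | exists T v f, [/\ dt_dot x (T, v), mcg_class m f
                                           & Tv = (act_triangle m T, f v)]].
  exists d'; split.
  - apply/seteqP; split=> -[T v].
      move=> [S [u [f [+ mf [-> ->]]]]]; rewrite ed => -[S' tS [<- <-]].
      exists (act_triangle m S'); first by rewrite tE; exists S'.
      rewrite /d' invK //; congr pair.
      have [a [b [c [_ _ ->]]]] := cornerT _ _ tS (cd _ tS).
      by have [_ ->] := hm _ mf0; have [_ ->] := hm _ mf.
    move=> [S tS [<- <-]]; have [t1 e1] := hinv _ tS.
    exists (inv S), (d (inv S)), f0; split=> //; last by rewrite e1.
    by rewrite ed; exists (inv S).
  - move=> T tT; have [t1 <-] := hinv _ tT; rewrite /d' invK //.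
    have [a [b [c [dd eS ->]]]] := cornerT _ _ t1 (cd _ t1).
    rewrite eS (act_tri am dd); apply/cornerP; first exact: distinct3_map.
    by apply: Or31; have [_ ->] := hm _ mf0.
  (* Exceptional dots of the image come from exceptional dots or from the finitely many middle
     vertices that [phi] does not keep. *)
  - apply: (@sub_finite_set _ _ (act_triangle m @`
      ([set T | triangles tau T /\ ~ (triangles farey T /\ middle_vertex T (d T))] `|`
       [set T | exists x z y, [/\ fmid x z y, ~ fmid (phi x) (phi z) (phi y) & T = tri x z y]])));
      last by apply: finite_image; rewrite finite_setU; split=> //; apply: pl_fmid_finite.
    move=> T [tT nT]; have [t1 e1] := hinv _ tT; exists (inv T) => //.
    have [mid|nmid] := pselect (triangles farey (inv T) /\ middle_vertex (inv T) (d (inv T)));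
      last by left.
    right; have [a [c [b [fm eT ev]]]] := (middle_vertexP _ _).1 mid.
    exists a, c, b; split=> // fm'; apply: nT; apply/middle_vertexP.
    exists (phi a), (phi c), (phi b); split=> //.
      rewrite -{1}e1 eT (act_tri am) //; apply: ccw_neq.
      by have [] := fmid_fa fm.
    by rewrite /d' ev; have [_ ->] := hm _ mf0.
have labl : labelling tau' [set (act_triangle m Tq.1, Tq.2) | Tq in dt_label x].
  exists (fun T => l (inv T)).
    rewrite el; apply/seteqP; split=> -[T q].
      move=> [_ [S tS <-] /= [<- <-]]; exists (act_triangle m S); first by rewrite tE; exists S.
      by rewrite invK.
    move=> [S tS [<- <-]]; have [t1 e1] := hinv _ tS.
    by exists (inv S, l (inv S)); [exists (inv S)|rewrite /= e1].
  have [l1 l2 l3] := bl; split.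
  - by move=> T tT; have [t1 _] := hinv _ tT; apply: l1.
  - move=> S T /set_mem tS /set_mem tT e.
    have [t1 <-] := hinv _ tS; have [t2 <-] := hinv _ tT.
    by congr act_triangle; apply: l2 => //; apply/mem_set.
  - move=> q /l3[S tS <-]; exists (act_triangle m S); first by rewrite tE; exists S.
    by rewrite invK.
by exists (DottedTessellation tt dott labl).
Qed.

Lemma dotted_act_fun m (x y y' : dotted_tessellation R) :
  dotted_act m x y -> dotted_act m x y' -> y = y'.
Proof.
by move=> [e1 e2 e3] [f1 f2 f3]; apply: dotted_eq; rewrite ?e1 ?e2 ?e3 ?f1 ?f2 ?f3.
Qed.

Lemma marked_act_fun m (x y y' : marked_tessellation R) :
  marked_act m x y -> marked_act m x y' -> y = y'.
Proof. by move=> [e1 e2] [f1 f2]; apply: marked_eq; rewrite ?e1 ?e2 ?f1 ?f2. Qed.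

Lemma act_arc_comp m m' m'' phi psi tau A : acts m phi -> acts m' psi ->
  acts m'' (psi \o phi) -> tau `<=` ideal_arc -> tau A ->
  act_arc m'' A = act_arc m' (act_arc m A).
Proof.
move=> a1 a2 a3 tI /tI/ideal_arcP[x [y [xy ->]]].
have fxy : phi x <> phi y by move=> /(acts_inj_map a1).
by rewrite (act_arcE a3 xy) (act_arcE a1 xy) (act_arcE a2 fxy).
Qed.

Lemma act_triangle_comp m m' m'' phi psi tau T : acts m phi -> acts m' psi ->
  acts m'' (psi \o phi) -> triangles tau T ->
  act_triangle m'' T = act_triangle m' (act_triangle m T).
Proof.
move=> a1 a2 a3 /trianglesP[x [y [z [c -> _]]]].
have d := ccw_neq c; have d' := distinct3_map (acts_inj_map a1) d.
by rewrite (act_tri a3 d) (act_tri a1 d) (act_tri a2 d').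
Qed.

Lemma dotted_act_comp m m' m'' phi psi (x y z : dotted_tessellation R) :
  acts m phi -> acts m' psi -> acts m'' (psi \o phi) ->
  dotted_act m x y -> dotted_act m' y z -> dotted_act m'' x z.
Proof.
move=> a1 a2 a3 [e1 e2 e3] [f1 f2 f3].
have tI := ctess_ideal (tess_ctess (dt_edgesP x)).
have [d [ed cd _]] := dt_dotP x; have [l el _] := dt_labelP x.
have [_ [f0 mf0] hm] := a1; have [_ [g0 mg0] hm'] := a2; have [_ [h0 mh0] hm''] := a3.
split.
- rewrite f1 e1; apply/seteqP; split=> A.
    move=> [B [D tD <-] <-]; exists D => //; exact: act_arc_comp a1 a2 a3 tI tD.
  move=> [D tD <-]; exists (act_arc m D); first by exists D.
  exact/esym/(act_arc_comp a1 a2 a3 tI tD).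
- have dotE T v f g h : dt_dot x (T, v) -> mcg_class m f -> mcg_class m' g ->
      mcg_class m'' h -> (act_triangle m'' T, h v) =
      (act_triangle m' (act_triangle m T), g (f v)).
    rewrite ed => -[T' tT [<- <-]] mf mg mh.
    rewrite (act_triangle_comp a1 a2 a3 tT); congr pair.
    have [q [r /triangle_onP[a [_ [_ [_ -> _ _ _]]]]]] := cd _ tT.
    by have [_ ->] := hm _ mf; have [_ ->] := hm' _ mg; have [_ ->] := hm'' _ mh.
  rewrite f2 e2; apply/seteqP; split=> Tv.
    move=> [T [v [g [[S [u [f [dS mf [-> ->]]]]] mg ->]]]].
    by exists S, u, h0; split=> //; exact: esym (dotE _ _ _ _ _ dS mf mg mh0).
  move=> [S [u [h [dS mh ->]]]].
  exists (act_triangle m S), (f0 u), g0; split=> //; last exact: (dotE _ _ _ _ _ dS mf0 mg0 mh).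
  by exists S, u, f0.
- rewrite f3 e3 el; apply/seteqP; split=> -[T q].
    move=> [_ [_ [S tS <-] <-] /= [<- <-]]; exists (S, l S) => /=; first by exists S.
    by rewrite (act_triangle_comp a1 a2 a3 tS).
  move=> [_ [S tS <-] /= [<- <-]]; exists (act_triangle m S, l S).
    by exists (S, l S) => //; exists S.
  by rewrite /= (act_triangle_comp a1 a2 a3 tS).
Qed.

Lemma dotted_act_id m (x : dotted_tessellation R) : acts m id -> dotted_act m x x.
Proof.
move=> a1; have ct := tess_ctess (dt_edgesP x); have tI := ctess_ideal ct.
have [d [ed cd _]] := dt_dotP x; have [l el _] := dt_labelP x.
have [_ [f0 mf0] hm] := a1.
have arcE A : dt_edges x A -> act_arc m A = A.
  by move=> /tI/ideal_arcP[a [b [ab ->]]]; rewrite (act_arcE a1 ab).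
have triE T : triangles (dt_edges x) T -> act_triangle m T = T.
  by move=> /trianglesP[a [b [c [/ccw_neq h -> _]]]]; rewrite (act_tri a1 h).
have corE f T : mcg_class m f -> triangles (dt_edges x) T -> f (d T) = d T.
  move=> mf /cd[q [r /triangle_onP[a [_ [_ [_ -> _ _ _]]]]]].
  by have [_ ->] := hm _ mf.
split.
- apply/seteqP; split=> A; first by move=> tA; exists A; rewrite ?arcE.
  by move=> [B tB <-]; rewrite arcE.
- rewrite ed; apply/seteqP; split=> Tv.
    by move=> [T tT <-]; exists T, (d T), f0; rewrite triE // corE //; split=> //; exists T.
  by move=> [_ [_ [f [[T tT [<- <-]] mf ->]]]]; rewrite triE // corE //; exists T.
- rewrite el; apply/seteqP; split=> Tq.
    by move=> [T tT <-]; exists (T, l T); [exists T|rewrite /= triE].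
  by move=> [_ [T tT <-] <-]; rewrite /= triE //; exists T.
Qed.

Lemma tri_ccw_fix x y z y' z' : ccw x y z -> ccw x y' z' ->
  tri x y z = tri x y' z' -> y = y' /\ z = z'.
Proof.
move=> c c' /(tri_inj (ccw_neq c))[_ my mz].
by case: my => ey; case: mz => ez; move: c; rewrite ey ez => c; split=> //; clear -c c'; cyc.
Qed.

Lemma dotted_free m m' phi psi (x y : dotted_tessellation R) : acts m phi ->
  acts m' psi -> dotted_act m x y -> dotted_act m' x y -> phi = psi.
Proof.
move=> a1 a2 [e1 e2 e3] [f1 f2 f3].
have ct := tess_ctess (dt_edgesP x).
have [d [ed cd _]] := dt_dotP x; have [l el [_ linj _]] := dt_labelP x.
have [d' [ed' _ _]] := dt_dotP y.
have [[mf sf _] [f0 mf0] hm] := a1; have [[mg _ _] [g0 mg0] hm'] := a2.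
apply: mono_eq_rat => // u /(let: And5 _ _ _ h _ := ct in h _)[v Euv].
(* Every rational point is a corner of some triangle, on whose corners the two maps are compared. *)
have [_ _ apex _ _] := ct; have [w [c Euw Ewv]] := apex _ _ Euv.
have tT := ctess_triangle ct c Euw Ewv (EC Euv); set T := tri u w v in tT.
have eT : act_triangle m' T = act_triangle m T.
  have : dt_label y (act_triangle m' T, l T).
    by rewrite f3; exists (T, l T) => //; rewrite el; exists T.
  rewrite e3 el => -[_ [S tS <-] /= [eS eq]].
  by rewrite -eS; congr act_triangle; apply: linj => //; apply/mem_set.
have dT : f0 (d T) = g0 (d T).
  have h1 : dt_dot y (act_triangle m T, f0 (d T)).
    by rewrite e2; exists T, (d T), f0; split=> //; rewrite ed; exists T.
  have h2 : dt_dot y (act_triangle m' T, g0 (d T)).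
    by rewrite f2; exists T, (d T), g0; split=> //; rewrite ed; exists T.
  by move: h1 h2; rewrite ed' => -[S _ [eS <-]] [S' _ [eS' <-]]; rewrite eS eS' eT.
(* Once the image of the dotted corner [a] is known, the cyclic order leaves no choice for the other
   two corners of the image triangle. *)
have key a b e : ccw a b e -> T = tri a b e -> d T = mu a -> mem3 u a b e -> phi u = psi u.
  move=> cabe eT' da mu3; have hd := ccw_neq cabe.
  have pa : phi a = psi a.
    by apply: cayley_inj; have [_ <-] := hm _ mf0; have [_ <-] := hm' _ mg0; rewrite -da.
  have := eT; rewrite eT' (act_tri a1 hd) (act_tri a2 hd) -pa => e'.
  have k1 := mf _ _ _ cabe; have k2 := mg _ _ _ cabe; rewrite -pa in k2.
  have [pb pe] := tri_ccw_fix k1 k2 (esym e').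
  by case: mu3 => ->.
have := (cornerP _ (ccw_neq c)).1 (cd _ tT); case=> h.
- by apply: (key u w v) => //; apply: Or31.
- apply: (key w v u) => //; [exact: ccw_rot|by rewrite /T (tri_rot u)|exact: Or33].
- apply: (key v u w) => //; first by do 2!apply: ccw_rot.
    by rewrite /T 2!tri_rot.
  exact: Or32.
Qed.

Lemma marked_act_map m phi (x y : marked_tessellation R) : acts m phi ->
  marked_act m x y -> exists p q, [/\ E (mt_edges x) p q,
    mt_doe y = dpath (phi p) (phi q), mt_doe x = dpath p q, p <> q &
    forall a b, E (mt_edges x) a b -> E (mt_edges y) (phi a) (phi b)].
Proof.
move=> am [e1 e2]; have ct := tess_ctess (mt_edgesP x).
have [p [q [pq ed Epq]]] := (oriented_edgeP _ _).1 (mt_doeP x).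
exists p, q; split=> //; first by rewrite e2 ed (act_dpath am pq).
by move=> a b Eab; rewrite e1; apply/(E_act _ _ am ct).
Qed.

(** Both [chi] and [psi \o phi] send the distinguished oriented edge of [x] to that of [z], and
    edges to edges, so [agree_all] applies. Freeness is stated as a cocycle identity, the form in
    which equivariance uses it. *)
Lemma marked_act_comp_map m m' m'' phi psi chi (x y z : marked_tessellation R) :
  acts m phi -> acts m' psi -> acts m'' chi ->
  marked_act m x y -> marked_act m' y z -> marked_act m'' x z -> chi = psi \o phi.
Proof.
move=> a1 a2 a3 h1 h2 h3.
have [p [q [Epq d1 dx pq H1]]] := marked_act_map a1 h1.
have [p' [q' [_ d2 dy pq' H2]]] := marked_act_map a2 h2.
have [p2 [q2 [_ d3 dx2 pq2 H3]]] := marked_act_map a3 h3.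
have [ep eq] : p = p2 /\ q = q2 by apply: dpath_inj pq _; rewrite -dx.
have [ep' eq'] : p' = phi p /\ q' = phi q by apply: dpath_inj pq' _; rewrite -dy.
have [[mf sf _] _ _] := a1; have [[mg sg _] _ _] := a2; have [[mh sh _] _ _] := a3.
have npq : psi p' <> psi q' by move=> /(acts_inj_map a2).
have [fp fq] : psi p' = chi p2 /\ psi q' = chi q2.
  by apply: dpath_inj npq _; rewrite -d2.
apply: (agree_all (tess_ctess (mt_edgesP x)) (tess_ctess (mt_edgesP z)) mh sh _ H3 _ Epq).
- by move=> a b c h; apply: mg; apply: mf.
- by move=> a b h; apply: H2; apply: H1.
- by rewrite /= -ep' fp ep.
- by rewrite /= -eq' fq eq.
Qed.

End Actions.

Theorem proposition2p37 (R : realType)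
    (tau_mark : marked_tessellation R) (tau_dot : dotted_tessellation R) :
  (exists! F : functor (Pt R) (Ptdot R),
     equivariant F /\ F tau_mark = tau_dot)
  /\ (forall F : functor (Pt R) (Ptdot R),
        equivariant F /\ F tau_mark = tau_dot -> injective F).
Proof.
have id_acts m phi : acts m phi -> marked_act m tau_mark tau_mark -> phi = id.
  (* The cocycle identity gives [phi = phi \o phi], and [phi] is injective. *)
  move=> am h; have e := marked_act_comp_map am am am h h h.
  apply/funext => x; have := congr1 (fun f => f x) e => /= /(acts_inj_map am).
  by [].
have /choice[mx hmx] x := @marked_transitive R tau_mark x.
have /choice[F0 hF0] x := dotted_act_exists (mx x) tau_dot.
have orbit (F : functor (Pt R) (Ptdot R)) : equivariant F /\ F tau_mark = tau_dot ->
    forall x, dotted_act (mx x) tau_dot (F x).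
  move=> [eF <-] x; have [y hy hFy] := eF (mx x) tau_mark.
  by have e := marked_act_fun (hmx x) hy; move: hFy; rewrite -e.
have inj (G : marked_tessellation R -> dotted_tessellation R) :
    (forall x, dotted_act (mx x) tau_dot (G x)) -> injective G.
  move=> hG x y e; have [phi am] := mcg_acts (mx x); have [psi am'] := mcg_acts (mx y).
  have h1 := hG x; have h2 := hG y; rewrite -e in h2.
  have ephi := dotted_free am am' h1 h2; rewrite -ephi in am'.
  have em := acts_inj am am'.
  by apply: (marked_act_fun (hmx x)); rewrite em.
(* All morphism types are [unit], so a functor is determined by its object map. *)
have uniq_fun (F G : functor (Pt R) (Ptdot R)) : fobj F = fobj G -> F = G.
  case: F G => [f fm f1 f2] [g gm g1 g2] /= e; subst g.
  have em : fm = gm.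
    apply: functional_extensionality_dep => x; apply: functional_extensionality_dep => y.
    by apply: functional_extensionality_dep => u; case: (fm x y u); case: (gm x y u).
  by subst gm; congr Functor; apply: Prop_irrelevance.
split; last by move=> F /orbit; apply: inj.
pose F : functor (Pt R) (Ptdot R) := @Functor (Pt R) (Ptdot R) F0
  (fun x y _ => tt) (fun x => erefl) (fun x y z g f => erefl).
have Fmark : F tau_mark = tau_dot.
  have [phi am] := mcg_acts (mx tau_mark).
  have e := id_acts _ _ am (hmx tau_mark); rewrite e in am.
  exact: dotted_act_fun (hF0 tau_mark) (dotted_act_id _ am).
exists F; split; last first.
  move=> G hG; apply: uniq_fun; apply/funext => x.
  exact: dotted_act_fun (hF0 x) (orbit _ hG x).
split=> // m x; have [y hy] := marked_act_exists m x; exists y => //.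
have [w hw] := dotted_act_exists m (F0 x).
have [phi a1] := mcg_acts (mx x); have [psi a2] := mcg_acts m.
have [chi a3] := mcg_acts (mx y).
(* The class chosen for [y] has the boundary map of [m] after [mx x], so both act alike on
   [tau_dot]. *)
have echi := marked_act_comp_map a1 a2 a3 (hmx x) hy (hmx y); rewrite echi in a3.
have hw' := dotted_act_comp a1 a2 a3 (hF0 x) hw.
by rewrite /= (dotted_act_fun (hF0 y) hw').
Qed.
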